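(* Let $(M,\rho,\mu)$ be an unbounded metric measure space with $0<\mu(M)<\infty$ satisfying the properties (LD), (AM) and (I$^c_{B_0}$) defined in the context, and let $R_0\in[0,\infty)$ and $\beta\in(1/2,1)$ be the constants appearing in (AM). Suppose that $r\in(1,\infty]$, $q\in[1,\infty)$, and that $b,c\in(0,\infty)$ satisfy $R_0/(1-\beta)<c<b$. The following hold: (i) the identity is a Banach space isomorphism between $H_c^{1,r}(\mu)$ and $H_b^{1,r}(\mu)$, and between $BMO_b^q(\mu)$ and $BMO_c^q(\mu)$; (ii) (John–Nirenberg type inequality) there exist positive constants $c_0$ and $C$ such that for all $f\in BMO_b^1(\mu)$, all $B\in\mathcal{B}_b$ and all $s>0$ $$\mu\bigl(\{x\in B: |f(x)-f_B|>s\}\bigr)\le C\,e^{-c_0 s/N_b^1(f)}\,\mu(B);$$ (iii) for each $q\in(1,\infty)$ there exists a constant $C$ such that $$N_b^1(f)\le N_b^q(f)\le C\,N_b^1(f)\qquad\text{for all } f\in BMO_b^q(\mu).$$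
   Context: For a metric measure space $(M,\rho,\mu)$, $\mathcal{B}$ is the family of all balls, $c_B,r_B$ are the centre and radius of a ball $B$, $\kappa B$ is the ball with centre $c_B$ and radius $\kappa r_B$, and for $b>0$, $\mathcal{B}_b=\{B\in\mathcal{B}: r_B\le b\}$. For $A\subset M$ and $\kappa>0$, $A_\kappa=\{x\in A:\rho(x,A^c)\le\kappa\}$. (LD): for every $b>0$ there is a constant $D_b$ with $\mu(2B)\le D_b\,\mu(B)$ for all $B\in\mathcal{B}_b$. (AM): there exist $R_0\in[0,\infty)$ and $\beta\in(1/2,1)$ such that for all $x,y\in M$ with $\rho(x,y)>R_0$ there is $z\in M$ with $\rho(x,z)<\beta\rho(x,y)$ and $\rho(y,z)<\beta\rho(x,y)$. (I$^c_{B_0}$): there exist a ball $B_0$ in $M$ and $\kappa_0,C>0$ such that for every open set $A\subset M\setminus\overline{B}_0$, $\mu(A_\kappa)\ge C\kappa\,\mu(A)$ for all $\kappa\in(0,\kappa_0]$. Atoms: for $r\in(1,\infty]$, a $(1,r)$-standard atom is a function $a\in L^1(\mu)$ supported in a ball $B\in\mathcal{B}$ such that $\int_B a\,d\mu=0$ and $\|a\|_\infty\le\mu(B)^{-1}$ if $r=\infty$, or $\bigl(\frac{1}{\mu(B)}\int_B|a|^r\,d\mu\bigr)^{1/r}\le\mu(B)^{-1}$ if $r<\infty$. The constant function $1/\mu(M)$ is the exceptional atom. $H_b^{1,r}(\mu)$ is the space of all $g\in L^1(\mu)$ of the form $g=\sum_{k=1}^\infty\lambda_k a_k$, where each $a_k$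 is either a $(1,r)$-standard atom supported in a ball of $\mathcal{B}_b$ or the exceptional atom, and $\sum_k|\lambda_k|<\infty$ ($\lambda_k\in\mathbb{C}$). Its norm is the infimum of $\sum_k|\lambda_k|$ over all such decompositions. For $q\in[1,\infty)$ and $f$ locally integrable, $N_b^q(f)=\sup_{B\in\mathcal{B}_b}\bigl(\frac{1}{\mu(B)}\int_B|f-f_B|^q\,d\mu\bigr)^{1/q}$, where $f_B$ is the average of $f$ over $B$. $BMO_b^q(\mu)$ is the space of all $f\in L^1(\mu)$ with $N_b^q(f)<\infty$, with norm $\|f\|_1+N_b^q(f)$. When $N_b^1(f)=0$ the expression $e^{-c_0s/N_b^1(f)}$ is read as $0$. *)

(* Defs.v *)
From HB Require Import structures.
From mathcomp Require Import all_boot all_order all_algebra.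
From mathcomp Require Import all_classical all_reals all_analysis.
From mathcomp Require Import complex.

Set Implicit Arguments.
Unset Strict Implicit.
Unset Printing Implicit Defensive.

Import Order.TTheory GRing.Theory Num.Theory.
Import numFieldNormedType.Exports.
Import Normc.

Local Open Scope classical_set_scope.
Local Open Scope complex_scope.
Local Open Scope ring_scope.

(* A metric space whose measurable sets are exactly its Borel sets. The point
   that comes with the measurable structure is harmless: a space of positive
   measure is nonempty. *)
HB.mixin Record isBorelMetric (d : measure_display) (R : realType) M
    & Measurable d M & Metric R M := {
  measurable_borelE : (measurable : set (set M)) = <<s (open : set (set M)) >>
}.

#[short(type="borelMetricType")]
HB.structure Definition BorelMetric (d : measure_display) (R : realType) :=
  { M of Measurable d M & Metric R M & isBorelMetric d R M }.

Section metric_conditions.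
Context {d : measure_display} {R : realType} {M : borelMetricType d R}.
Implicit Types (mu : {measure set M -> \bar R}) (A : set M).

(* A ball is given by its centre [x] and radius [t > 0], since the underlying
   set need not determine them; balls are open. *)

Definition unbounded_space (X : metricType R) :=
  forall K : R, exists x y : X, K < mdist x y.

Definition locally_doubling mu :=
  forall b : R, 0 < b -> exists D : R, forall (x : M) (t : R), 0 < t <= b ->
    (mu (ball x (2 * t)) <= D%:E * mu (ball x t))%E.

Definition approx_midpoint (X : metricType R) (R0 beta : R) :=
  [/\ 0 <= R0, 2^-1 < beta < 1 &
    forall x y : X, R0 < mdist x y ->
      exists z : X, mdist x z < beta * mdist x y /\
                    mdist y z < beta * mdist x y].

Definition inner_boundary A (kappa : R) : set M :=
  [set x | A x /\ (edist_inf (~` A) x <= kappa%:E)%E].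

Definition complementary_isoperimetric mu :=
  exists (x0 : M) (r0 kappa0 C : R), [/\ 0 < r0, 0 < kappa0, 0 < C &
    forall A, open A -> A `<=` ~` closure (ball x0 r0) ->
      forall kappa : R, 0 < kappa <= kappa0 ->
        ((C * kappa)%:E * mu A <= mu (inner_boundary A kappa))%E].

End metric_conditions.

(* Elements of L^1 are represented by functions, so that a space of classes is
   given by the set of all the representatives of its elements. *)
Section complex_L1.
Context {d : measure_display} {R : realType} {M : borelMetricType d R}.
Variable mu : {measure set M -> \bar R}.
Implicit Types (f g : M -> R[i]) (B : set M).

Definition cintegrable f :=
  mu.-integrable setT (fun x => (complex.Re (f x))%:E) /\
  mu.-integrable setT (fun x => (complex.Im (f x))%:E).

Definition cintegral B f : R[i] :=
  (\int[mu]_(x in B) complex.Re (f x)) +i* (\int[mu]_(x in B) complex.Im (f x)).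

Definition L1norm f : \bar R := (\int[mu]_x (normc (f x))%:E)%E.

Definition average B f : R[i] := ((fine (mu B))^-1)%:C * cintegral B f.

Definition power_mean (p : R) B f : \bar R :=
  (((fine (mu B))^-1%:E * \int[mu]_(x in B) (normc (f x) `^ p)%:E) `^ p^-1)%E.

(* [V] with the norm [N] is, modulo equality almost everywhere, a complex
   Banach space of classes of integrable functions. *)
Record L1_banach_space (V : set (M -> R[i])) (N : (M -> R[i]) -> \bar R) :
    Prop := {
  bs_integrable : V `<=` cintegrable ;
  bs_ae : forall f g, V f -> cintegrable g -> f = g %[ae mu] ->
    V g /\ N f = N g ;
  bs_zero : V (fun=> 0) ;
  bs_lin : forall (l : R[i]) f g, V f -> V g -> V (fun x => l * f x + g x) ;
  bs_norm_fin : forall f, V f -> (0 <= N f < +oo)%E ;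
  bs_norm_eq0 : forall f, V f -> N f = 0%E -> f = (fun=> 0) %[ae mu] ;
  bs_normZ : forall (l : R[i]) f, V f ->
    N (fun x => l * f x) = ((normc l)%:E * N f)%E ;
  bs_normD : forall f g, V f -> V g ->
    (N (fun x => f x + g x)%R <= N f + N g)%E ;
  bs_complete : forall u : nat -> M -> R[i], (forall n, V (u n)) ->
    (forall e : R, 0 < e -> exists n0 : nat, forall m n : nat,
      (n0 <= m)%N -> (n0 <= n)%N -> (N (fun x => u m x - u n x)%R <= e%:E)%E) ->
    exists2 f, V f & (fun n => N (fun x => u n x - f x)) @ \oo --> 0%E
}.

Definition id_banach_isomorphism
    (V : set (M -> R[i])) (NV : (M -> R[i]) -> \bar R)
    (W : set (M -> R[i])) (NW : (M -> R[i]) -> \bar R) :=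
  [/\ L1_banach_space V NV, L1_banach_space W NW, V = W &
    exists2 K : R, 0 < K &
      forall f, V f -> (NW f <= K%:E * NV f /\ NV f <= K%:E * NW f)%E].

End complex_L1.

Section hardy.
Context {d : measure_display} {R : realType} {M : borelMetricType d R}.
Variable mu : {measure set M -> \bar R}.
Implicit Types (a g : M -> R[i]) (b : R) (r : \bar R) (B : set M).

Definition standard_atom r B a :=
  [/\ cintegrable mu a, {ae mu, forall x, ~ B x -> a x = 0},
      cintegral mu B a = 0 &
      match r with
      | p%:E => (power_mean mu p B a <= (fine (mu B))^-1%:E)%E
      | +oo%E => (Lnorm mu +oo (fun x => (normc (a x))%:E)
                    <= (fine (mu B))^-1%:E)%E
      | -oo%E => False
      end].

Definition exceptional_atom : M -> R[i] :=
  fun=> ((fine (mu setT))^-1)%:C.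

Definition atom_le b r a :=
  (exists (x : M) (t : R), 0 < t <= b /\ standard_atom r (ball x t) a) \/
  a = exceptional_atom.

(* The series converges to [g] in L^1. *)
Definition atomic_decomposition b r g
    (lambda : nat -> R[i]) (u : nat -> M -> R[i]) :=
  [/\ forall k, atom_le b r (u k),
      (\sum_(0 <= k <oo) (normc (lambda k))%:E < +oo)%E &
      (fun n => L1norm mu (fun x => g x - \sum_(k < n) lambda k * u k x))
        @ \oo --> 0%E].

Definition hardy1 b r : set (M -> R[i]) :=
  [set g | cintegrable mu g /\
           exists (lambda : nat -> R[i]) (u : nat -> M -> R[i]),
             atomic_decomposition b r g lambda u].

Definition hardy1_norm b r g : \bar R :=
  ereal_inf [set v | exists (lambda : nat -> R[i]) (u : nat -> M -> R[i]),
    atomic_decomposition b r g lambda u /\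
    v = (\sum_(0 <= k <oo) (normc (lambda k))%:E)%E].

End hardy.

Section bmo.
Context {d : measure_display} {R : realType} {M : borelMetricType d R}.
Variable mu : {measure set M -> \bar R}.
Implicit Types (f : M -> R[i]) (b q : R).

Definition BMO_seminorm b q f : \bar R :=
  ereal_sup [set v | exists (x : M) (t : R), 0 < t <= b /\
    v = power_mean mu q (ball x t)
          (fun y => f y - average mu (ball x t) f)].

Definition BMO b q : set (M -> R[i]) :=
  [set f | cintegrable mu f /\ (BMO_seminorm b q f < +oo)%E].

Definition BMO_norm b q f : \bar R := (L1norm mu f + BMO_seminorm b q f)%E.

End bmo.

(* The value at [N = 0] is the limit as N -> 0+ ; it must be set apart because
   division by 0 yields 0. *)
Definition exp_decay {R : realType} (c0 s N : R) : R :=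
  if N == 0 then 0 else expR (- (c0 * s / N)).

(* Main.v *)
Require Import Defs.
From HB Require Import structures.
From mathcomp Require Import all_boot all_order all_algebra.
From mathcomp Require Import all_classical all_reals all_analysis.
From mathcomp Require Import measurable_realfun ess_sup_inf.
From mathcomp Require Import complex.
From mathcomp Require Import ring lra.

Set Implicit Arguments.
Unset Strict Implicit.
Unset Printing Implicit Defensive.

Import Order.TTheory GRing.Theory Num.Theory.
Import numFieldNormedType.Exports.
Import Normc.

Local Open Scope classical_set_scope.
Local Open Scope ring_scope.

(** Two consequences of the hypotheses carry the proof. Local doubling gives
    packing: boundedly many separated points of mesh [c] fit in a ball of radius at
    most [b], so that such a ball is covered by boundedly many balls of radius [c]
    ([ex_net]). Approximate midpoints give chains: since [R0 / (1 - beta) < c], two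
    points at distance at most [b] are joined by a bounded number of steps of length
    at most [c / 2] ([chain_bound]).

    For the equality of the BMO spaces, the mean oscillation of [f] on a ball of
    radius at most [b] is compared with those on the balls of radius [c] that cover
    it. The averages of [f] over two balls of radius [c] whose centres are at distance
    at most [c / 2] differ by a multiple of the seminorm at scale [c], because both
    balls contain a common ball of comparable measure; chains extend this to all the
    balls of the cover ([osc_larger_ball]). For the Hardy spaces, an atom supported in
    a ball of radius at most [b] is cut along such a cover; the mean of each piece is
    moved along a chain to a common ball, and the means add up to the integral of
    the atom, which is zero ([hardy1_norm_atom_le]). Both norms dominate the L^1
    norm and are countably subadditive on series that converge in L^1, by Fatou's
    lemma for BMO and by rearranging double series of atoms for the Hardy space;
    this yields completeness ([L1_banach_space_of_norm]).

    The John--Nirenberg inequality is first proved for the averages of [f] over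
    balls of a small fixed radius [e] in place of [f]. Only the finitely many scales
    [2 ^ k e] below the radius of the given ball occur, so that the stopping-time
    balls of a Calderon--Zygmund decomposition can be selected greedily, largest first
    ([calderon_zygmund]). The doubles of the selected balls have together at most
    half of the measure of the given ball, and outside them the averages stay close
    to the average over the given ball; iteration gives exponential decay with
    constants independent of [e] ([averages_exp_decay]). The passage to [f] uses a weak form of
    differentiation: the oscillations of [f] on the balls of radius [e] about the
    points of an [e]-net have a total integral that tends to 0 with [e]
    ([sum_osc_small]). The decomposition looks at balls slightly larger than those of
    radius [b], on which the oscillation is controlled by the comparison of
    scales above.

    The comparison of the exponents follows: one inequality is Hoelder's, and the other
    is obtained by integrating the exponential decay over the layers of
    [|f - f_B|] ([power_mean_distribution]). *)

(** * Complex moduli *)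

Section complex_numbers.
Context {R : realType}.
Implicit Types (z w : R[i]) (a : R).

Lemma normc_ge0 z : 0 <= normc z.
Proof. by case: z => a b; exact: sqrtr_ge0. Qed.

Lemma normc_distC z w : normc (z - w) = normc (w - z).
Proof. by rewrite -normcN opprB. Qed.

Lemma normc_triangle z w v : normc (z - v) <= normc (z - w) + normc (w - v).
Proof. by rewrite (le_trans _ (le_normcD _ _))// subrKA. Qed.

Lemma normc_lerB z w : `|normc z - normc w| <= normc (z - w).
Proof.
rewrite ler_norml.
have h1 : normc z <= normc (z - w) + normc w.
  by rewrite -[X in normc X <= _](subrK w); exact: le_normcD.
have h2 : normc w <= normc (z - w) + normc z.
  by rewrite normc_distC -[X in normc X <= _](subrK z); exact: le_normcD.
by lra.
Qed.

Lemma normc_real a : normc (a%:C)%C = `|a|.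
Proof. by rewrite /= expr0n addr0 sqrtr_sqr. Qed.

Lemma sqr_normcE z : normc z ^+ 2 = complex.Re z ^+ 2 + complex.Im z ^+ 2.
Proof. by case: z => a b; rewrite /= sqr_sqrtr// addr_ge0// sqr_ge0. Qed.

Lemma normc_Re z : `|complex.Re z| <= normc z.
Proof.
rewrite -(ler_pXn2r (n:=2))// ?nnegrE ?normc_ge0//.
by rewrite real_normK ?num_real// sqr_normcE lerDl sqr_ge0.
Qed.

Lemma normc_Im z : `|complex.Im z| <= normc z.
Proof.
rewrite -(ler_pXn2r (n:=2))// ?nnegrE ?normc_ge0//.
by rewrite real_normK ?num_real// sqr_normcE lerDr sqr_ge0.
Qed.

Lemma normc_le_ReIm z : normc z <= `|complex.Re z| + `|complex.Im z|.
Proof.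
rewrite -(ler_pXn2r (n:=2))// ?nnegrE ?normc_ge0 ?addr_ge0//.
rewrite sqr_normcE sqrrD !real_normK ?num_real//.
by rewrite lerD2r lerDl mulrn_wge0// mulr_ge0.
Qed.

Lemma ReD z w : complex.Re (z + w) = complex.Re z + complex.Re w.
Proof. by case: z => ? ?; case: w. Qed.
Lemma ImD z w : complex.Im (z + w) = complex.Im z + complex.Im w.
Proof. by case: z => ? ?; case: w. Qed.
Lemma ReB z w : complex.Re (z - w) = complex.Re z - complex.Re w.
Proof. by case: z => ? ?; case: w. Qed.
Lemma ImB z w : complex.Im (z - w) = complex.Im z - complex.Im w.
Proof. by case: z => ? ?; case: w. Qed.
Lemma ReMc z w : complex.Re (z * w) =
  complex.Re z * complex.Re w - complex.Im z * complex.Im w.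
Proof. by case: z => ? ?; case: w. Qed.
Lemma ImMc z w : complex.Im (z * w) =
  complex.Re z * complex.Im w + complex.Im z * complex.Re w.
Proof. by case: z => ? ?; case: w. Qed.

Lemma normc_ReIm z : normc z = Num.sqrt (complex.Re z ^+ 2 + complex.Im z ^+ 2).
Proof. by case: z. Qed.

Lemma dot_le_normc z w :
  complex.Re z * complex.Re w + complex.Im z * complex.Im w <= normc z * normc w.
Proof.
have h := normc_Re (z * (complex.Re w +i* (- complex.Im w))%C).
rewrite normcM ReMc/= mulrN opprK in h.
apply: le_trans (ler_norm _) (le_trans h _).
by rewrite sqrrN -normc_ReIm.
Qed.

End complex_numbers.

(** * Balls *)

Section balls.
Context {d : measure_display} {R : realType} {M : borelMetricType d R}.
Implicit Types (x y : M) (t : R).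

Lemma in_ballE x t y : ball x t y = (mdist x y < t) :> Prop.
Proof. by rewrite ballEmdist. Qed.

Lemma open_metric_ball x t : open (ball x t).
Proof.
rewrite openE => y; rewrite in_ballE => xyt; apply/nbhs_ballP.
exists (t - mdist x y) => /=; first by rewrite subr_gt0.
move=> z; rewrite !in_ballE => yz.
by rewrite (le_lt_trans (metric_triangle _ y _))// -ltrBrDl.
Qed.

Lemma measurable_open (U : set M) : open U -> measurable U.
Proof. by move=> Uo; rewrite measurable_borelE; exact: sub_sigma_algebra. Qed.

Lemma measurable_metric_ball x t : measurable (ball x t : set M).
Proof. exact/measurable_open/open_metric_ball. Qed.

Lemma sub_ball x y s t : mdist x y + s <= t -> ball y s `<=` ball x t.
Proof.
move=> h z; rewrite !in_ballE => yz; apply: lt_le_trans h.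
by rewrite (le_lt_trans (metric_triangle _ y _))// ltrD2l.
Qed.

End balls.

#[global] Hint Extern 0 (measurable (ball _ _)) => exact: measurable_metric_ball : core.

(** * Integrals of complex functions *)

Section integration.
Context {d : measure_display} {R : realType} {M : borelMetricType d R}.
Variable mu : {measure set M -> \bar R}.
Hypothesis mufin : (mu setT < +oo)%E.
Implicit Types (f g h : M -> R[i]) (A B : set M).

Definition mass A : R := fine (mu A).

Lemma mass_ge0 A : 0 <= mass A.
Proof. by rewrite fine_ge0. Qed.

Lemma mu_fin_num A : measurable A -> mu A \is a fin_num.
Proof.
move=> mA; rewrite ge0_fin_numE//; apply: le_lt_trans mufin.
by rewrite le_measure ?inE.
Qed.

Lemma massE A : measurable A -> mu A = (mass A)%:E.
Proof. by move=> mA; rewrite fineK// mu_fin_num. Qed.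

Lemma le_mass A B : measurable A -> measurable B -> A `<=` B -> mass A <= mass B.
Proof. by move=> mA mB AB; rewrite fine_le ?mu_fin_num ?le_measure ?inE. Qed.

Definition absint A f : R := \int[mu]_(x in A) normc (f x).

Lemma measurable_normc A f : measurable_fun A (@complex.Re R \o f) ->
  measurable_fun A (@complex.Im R \o f) -> measurable_fun A (fun x => normc (f x)).
Proof.
move=> mR mI; under eq_fun do rewrite normc_ReIm.
apply: (measurableT_comp (f := @Num.sqrt R)).
  by apply: continuous_measurable_fun; exact: sqrt_continuous.
apply: measurable_funD.
  exact: (measurable_funX 2 mR).
exact: (measurable_funX 2 mI).
Qed.

Lemma measurable_cintegrable f : cintegrable mu f ->
  measurable_fun setT (@complex.Re R \o f) /\ measurable_fun setT (@complex.Im R \o f).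
Proof.
by move=> [/measurable_int/measurable_EFinP + /measurable_int/measurable_EFinP].
Qed.

Lemma measurable_normcT f : cintegrable mu f ->
  measurable_fun setT (fun x => normc (f x)).
Proof. by move=> /measurable_cintegrable[? ?]; exact: measurable_normc. Qed.

Lemma cintegrableP f : cintegrable mu f <->
  [/\ measurable_fun setT (@complex.Re R \o f), measurable_fun setT (@complex.Im R \o f) &
      mu.-integrable setT (EFin \o (fun x => normc (f x)))].
Proof.
split=> [fi|[mR mI fi]].
- have [mR mI] := measurable_cintegrable fi; split=> //.
  case: fi => [fR fI].
  have := integrableD measurableT (integrable_norm fR) (integrable_norm fI).
  apply: le_integrable => //; first exact/measurable_EFinP/measurable_normc.
  move=> x _ /=; rewrite lee_fin (ger0_norm (normc_ge0 _)) ger0_norm ?addr_ge0//.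
  exact: normc_le_ReIm.
- by split; apply: le_integrable fi => //; try exact/measurable_EFinP;
    move=> x _ /=; rewrite lee_fin (ger0_norm (normc_ge0 _)) ?normc_Re ?normc_Im.
Qed.

Lemma integrable_normc A f : measurable A -> cintegrable mu f ->
  mu.-integrable A (EFin \o (fun x => normc (f x))).
Proof. by move=> mA /cintegrableP[_ _]; exact: integrableS. Qed.

Lemma integrable_cst A (k : R) : measurable A ->
  mu.-integrable A (EFin \o (fun _ : M => k)).
Proof.
move=> mA; apply: measurable_bounded_integrable => //.
  by rewrite ltey_eq mu_fin_num.
exists `|k|; split; first exact: num_real.
by move=> y ky x _ /=; exact: ltW.
Qed.

Lemma cintegrable_cst (z : R[i]) : cintegrable mu (fun=> z).
Proof. by split; exact: integrable_cst. Qed.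

Lemma cintegrableD f g : cintegrable mu f -> cintegrable mu g ->
  cintegrable mu (fun x => f x + g x).
Proof.
move=> [fR fI] [gR gI]; split.
  by apply: eq_integrable (integrableD measurableT fR gR) => // x _ /=; rewrite ReD.
by apply: eq_integrable (integrableD measurableT fI gI) => // x _ /=; rewrite ImD.
Qed.

Lemma cintegrableZ (z : R[i]) f : cintegrable mu f ->
  cintegrable mu (fun x => z * f x).
Proof.
move=> [fR fI]; split.
- apply: eq_integrable (integrableB measurableT (integrableZl measurableT (complex.Re z) fR) (integrableZl measurableT (complex.Im z) fI)) => // x _ /=.
  by rewrite ReMc EFinB !EFinM.
- apply: eq_integrable (integrableD measurableT (integrableZl measurableT (complex.Re z) fI) (integrableZl measurableT (complex.Im z) fR)) => // x _ /=.
  by rewrite ImMc EFinD !EFinM.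
Qed.

Lemma cintegrableB f g : cintegrable mu f -> cintegrable mu g ->
  cintegrable mu (fun x => f x - g x).
Proof.
move=> fi gi; have := cintegrableD fi (cintegrableZ (-1) gi).
by congr cintegrable; apply/funext => x; rewrite mulN1r.
Qed.

Lemma cintegrable_sum (I : Type) (s : seq I) (F : I -> M -> R[i]) :
  (forall i, cintegrable mu (F i)) ->
  cintegrable mu (fun x => \sum_(i <- s) F i x).
Proof.
move=> Fi; elim: s => [|i s IH].
  under [X in cintegrable mu X]eq_fun do rewrite big_nil.
  exact: cintegrable_cst.
under [X in cintegrable mu X]eq_fun do rewrite big_cons.
exact: cintegrableD.
Qed.

Lemma cintegrable_indicM A f : measurable A -> cintegrable mu f ->
  cintegrable mu (fun x => (\1_A x : R)%:C%C * f x).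
Proof.
move=> mA [fR fI]; split.
- have : mu.-integrable A (fun x => (complex.Re (f x))%:E) by exact: integrableS fR.
  move/(integrable_mkcond _ mA); apply: eq_integrable => // x _ /=.
  rewrite ReMc/= mul0r subr0 patchE indicE; case: ifPn => _; by rewrite ?mul1r ?mul0r.
- have : mu.-integrable A (fun x => (complex.Im (f x))%:E) by exact: integrableS fI.
  move/(integrable_mkcond _ mA); apply: eq_integrable => // x _ /=.
  rewrite ImMc/= mul0r addr0 patchE indicE; case: ifPn => _; by rewrite ?mul1r ?mul0r.
Qed.

Lemma cintegrable_indic A : measurable A ->
  cintegrable mu (fun x => (\1_A x : R)%:C%C).
Proof.
move=> mA; have := cintegrable_indicM mA (cintegrable_cst 1).
by congr cintegrable; apply/funext => x; rewrite mulr1.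
Qed.

Lemma integrable_ReS A f : measurable A -> cintegrable mu f ->
  mu.-integrable A (EFin \o (@complex.Re R \o f)).
Proof. by move=> mA [+ _]; exact: integrableS. Qed.

Lemma integrable_ImS A f : measurable A -> cintegrable mu f ->
  mu.-integrable A (EFin \o (@complex.Im R \o f)).
Proof. by move=> mA [_]; exact: integrableS. Qed.

Lemma cintegralD A f g : measurable A -> cintegrable mu f -> cintegrable mu g ->
  cintegral mu A (fun x => f x + g x) = cintegral mu A f + cintegral mu A g.
Proof.
move=> mA fi gi; rewrite /cintegral.
under [in LHS]eq_Rintegral do rewrite ReD.
rewrite RintegralD; [|by []|exact: integrable_ReS|exact: integrable_ReS].
under [X in (_ +i* X)%C = _]eq_Rintegral do rewrite ImD.
by rewrite RintegralD; [|by []|exact: integrable_ImS|exact: integrable_ImS].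
Qed.

Lemma cintegralZ A (z : R[i]) f : measurable A -> cintegrable mu f ->
  cintegral mu A (fun x => z * f x) = z * cintegral mu A f.
Proof.
move=> mA fi; case: z => a b; rewrite /cintegral.
have iR k : mu.-integrable A (EFin \o (fun x => k * complex.Re (f x))).
  by apply: eq_integrable (integrableZl mA k (integrable_ReS mA fi)) => // x _ /=;
    rewrite EFinM.
have iI k : mu.-integrable A (EFin \o (fun x => k * complex.Im (f x))).
  by apply: eq_integrable (integrableZl mA k (integrable_ImS mA fi)) => // x _ /=;
    rewrite EFinM.
under [in LHS]eq_Rintegral do rewrite ReMc/=.
rewrite (RintegralB mA (iR a) (iI b)).
under [X in (_ +i* X)%C = _]eq_Rintegral do rewrite ImMc/=.
rewrite (RintegralD mA (iI a) (iR b)).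
rewrite !(RintegralZl _ mA (integrable_ReS mA fi)).
by rewrite !(RintegralZl _ mA (integrable_ImS mA fi)).
Qed.

Lemma cintegral_cst A (z : R[i]) : measurable A ->
  cintegral mu A (fun=> z) = (mass A)%:C%C * z.
Proof.
move=> mA; rewrite /cintegral !Rintegral_cst//; case: z => a b /=.
by apply/eqP; rewrite eq_complex /= !mul0r subr0 addr0 ![mass A * _]mulrC !eqxx.
Qed.

(** The square of the modulus of the integral is the integral of a scalar product
    with [f]. *)
Lemma normc_cintegral_le A f : measurable A -> cintegrable mu f ->
  normc (cintegral mu A f) <= absint A f.
Proof.
move=> mA fi; set I := cintegral mu A f.
have [->|I0] := eqVneq (normc I) 0; first by apply: Rintegral_ge0 => *; exact: normc_ge0.
have {}I0 : 0 < normc I by rewrite lt_neqAle eq_sym I0 normc_ge0.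
rewrite -(ler_pM2l I0) -expr2 sqr_normcE.
have iR := integrable_ReS mA fi; have iI := integrable_ImS mA fi.
have iR' : mu.-integrable A (EFin \o (fun x => complex.Re I * complex.Re (f x))).
  by apply: eq_integrable (integrableZl mA (complex.Re I) iR) => // x _ /=; rewrite EFinM.
have iI' : mu.-integrable A (EFin \o (fun x => complex.Im I * complex.Im (f x))).
  by apply: eq_integrable (integrableZl mA (complex.Im I) iI) => // x _ /=; rewrite EFinM.
have iN : mu.-integrable A (EFin \o (fun x => normc I * normc (f x))).
  by apply: eq_integrable (integrableZl mA (normc I) (integrable_normc mA fi)) => // x _ /=;
    rewrite EFinM.
have -> : complex.Re I ^+ 2 + complex.Im I ^+ 2 =
    \int[mu]_(x in A) (complex.Re I * complex.Re (f x) + complex.Im I * complex.Im (f x)).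
  by rewrite RintegralD// !RintegralZl.
rewrite -(RintegralZl _ mA (integrable_normc mA fi)).
apply: le_Rintegral => //; last by move=> x _; exact: dot_le_normc.
by apply: eq_integrable (integrableD mA iR' iI').
Qed.

Lemma absint_ge0 A f : 0 <= absint A f.
Proof. by apply: Rintegral_ge0 => *; exact: normc_ge0. Qed.

Lemma absintE A f : measurable A -> cintegrable mu f ->
  (\int[mu]_(x in A) (normc (f x))%:E)%E = (absint A f)%:E.
Proof.
move=> mA fi; rewrite fineK//.
exact: (integrable_fin_num mA (integrable_normc mA fi)).
Qed.

Lemma L1normE f : cintegrable mu f -> L1norm mu f = (absint setT f)%:E.
Proof. by move=> fi; exact: absintE. Qed.

Lemma le_absint A f g : measurable A -> cintegrable mu f -> cintegrable mu g ->
  (forall x, A x -> normc (f x) <= normc (g x)) -> absint A f <= absint A g.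
Proof. by move=> mA fi gi fg; apply: le_Rintegral => //; exact: integrable_normc. Qed.

Lemma absint_mono A B f : measurable A -> measurable B -> A `<=` B ->
  cintegrable mu f -> absint A f <= absint B f.
Proof.
move=> mA mB AB fi; rewrite -lee_fin -!absintE//.
apply: ge0_subset_integral => //; last by move=> *; rewrite lee_fin normc_ge0.
exact: measurable_int (integrable_normc mB fi).
Qed.

Lemma absintD A f g : measurable A -> cintegrable mu f -> cintegrable mu g ->
  absint A (fun x => f x + g x) <= absint A f + absint A g.
Proof.
move=> mA fi gi; rewrite /absint.
have nf := integrable_normc mA fi; have ng := integrable_normc mA gi.
rewrite -RintegralD//; apply: le_Rintegral => //.
- exact: integrable_normc (cintegrableD fi gi).
- exact: eq_integrable (integrableD mA nf ng).
- by move=> x _; exact: le_normcD.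
Qed.

Lemma absintZ A (z : R[i]) f : measurable A -> cintegrable mu f ->
  absint A (fun x => z * f x) = normc z * absint A f.
Proof.
move=> mA fi; rewrite /absint; under eq_Rintegral do rewrite normcM.
by rewrite RintegralZl//; exact: integrable_normc.
Qed.

Lemma absint_cst A (z : R[i]) : measurable A -> absint A (fun=> z) = normc z * mass A.
Proof. by move=> mA; rewrite /absint Rintegral_cst. Qed.

Lemma absint0 A f : measurable A -> (forall x, f x = 0) -> absint A f = 0.
Proof.
move=> mA f0; rewrite /absint; under eq_Rintegral => x _ do rewrite f0 normc0.
by rewrite Rintegral_cst// mul0r.
Qed.

Lemma absint_distC A f g : absint A (fun x => f x - g x) = absint A (fun x => g x - f x).
Proof. by apply: eq_Rintegral => x _; rewrite normc_distC. Qed.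

Lemma absint_triangle A f g h : measurable A ->
  cintegrable mu f -> cintegrable mu g -> cintegrable mu h ->
  absint A (fun x => f x - h x) <=
  absint A (fun x => f x - g x) + absint A (fun x => g x - h x).
Proof.
move=> mA fi gi hi.
apply: le_trans (absintD mA (cintegrableB fi gi) (cintegrableB gi hi)).
by rewrite le_eqVlt; apply/orP; left; apply/eqP/eq_Rintegral => x _; rewrite subrKA.
Qed.

Lemma absint_sum (I : Type) (s : seq I) (F : I -> M -> R[i]) A : measurable A ->
  (forall i, cintegrable mu (F i)) ->
  absint A (fun x => \sum_(i <- s) F i x) <= \sum_(i <- s) absint A (F i).
Proof.
move=> mA Fi; elim: s => [|i s IH].
  rewrite big_nil /absint; under eq_Rintegral do rewrite big_nil normc0.
  by rewrite Rintegral_cst// mul0r.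
rewrite big_cons; apply: le_trans (lerD (lexx _) IH).
apply: le_trans (absintD mA (Fi i) (cintegrable_sum s Fi)).
by rewrite le_eqVlt; apply/orP; left; apply/eqP/eq_Rintegral => x _; rewrite big_cons.
Qed.

Lemma eq_ae_absint A f g : measurable A -> cintegrable mu f -> cintegrable mu g ->
  f = g %[ae mu] -> absint A f = absint A g.
Proof.
move=> mA fi gi fg; congr fine; apply: ae_eq_integral => //.
- exact: measurable_int (integrable_normc mA fi).
- exact: measurable_int (integrable_normc mA gi).
- by apply: filterS fg => x fgx _; rewrite fgx.
Qed.

Lemma absint_eq0 f : cintegrable mu f -> absint setT f = 0 -> f = (fun=> 0) %[ae mu].
Proof.
move=> fi f0.
have : (\int[mu]_x `|(normc (f x))%:E| = 0)%E.
  under eq_integral do rewrite gee0_abs ?lee_fin ?normc_ge0//.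
  by rewrite absintE// f0.
move/(ae_eq_integral_abs _ measurableT (measurable_int _ (integrable_normc measurableT fi))).
by apply: filterS => x /(_ I) [] /eq0_normc.
Qed.

End integration.

(** * Series in L^1 *)

Lemma cvg0_le {R : realType} (u v : nat -> R) :
  (forall n, 0 <= u n <= v n) -> v @ \oo --> 0 -> u @ \oo --> 0.
Proof.
by move=> uv; apply: squeeze_cvgr; [exact: nearW uv | exact: cvg_cst].
Qed.

Section L1_series.
Context {d : measure_display} {R : realType} {M : borelMetricType d R}.
Variable mu : {measure set M -> \bar R}.
Hypothesis mufin : (mu setT < +oo)%E.

(** The series of the absolute values has a finite integral, hence is finite
    almost everywhere; its sum dominates the partial sums. *)
Lemma real_L1_series (h : nat -> M -> R) :
  (forall k, mu.-integrable setT (EFin \o h k)) ->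
  (\sum_(0 <= k <oo) \int[mu]_x `|(h k x)%:E| < +oo)%E ->
  exists G : M -> R, [/\ mu.-integrable setT (EFin \o G),
    {ae mu, forall x, (fun n => \sum_(k < n) h k x) @ \oo --> G x} &
    (fun n => \int[mu]_x `|G x - \sum_(k < n) h k x|) @ \oo --> (0 : R)].
Proof.
move=> hi hs.
have mh k : measurable_fun setT (h k) by exact/measurable_EFinP/measurable_int/hi.
pose g x := (\sum_(0 <= k <oo) `|h k x|%:E)%E.
have mnh k : measurable_fun setT (fun x => `|h k x|%:E).
  by apply/measurable_EFinP; exact: measurableT_comp.
have g0 x : (0 <= g x)%E by apply: nneseries_ge0 => *; rewrite lee_fin.
have mg : measurable_fun setT g.
  exact: (ge0_emeasurable_sum (P := xpredT) (fun k x _ _ => lee_tofin (normr_ge0 (h k x)))).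
have ig : mu.-integrable setT g.
  apply/integrableP; split => //.
  under eq_integral do rewrite gee0_abs//.
  by rewrite /g integral_nneseries// => *; rewrite lee_fin.
have aeg : {ae mu, forall x, (fun n => \sum_(k < n) h k x) @ \oo --> limn (fun n => \sum_(k < n) h k x)}.
  apply: filterS (integrable_ae measurableT ig) => x /(_ I) gx.
  suff : cvgn (series (fun k => h k x)).
    by rewrite /series/= (_ : (fun n => _) = (fun n => \sum_(k < n) h k x))//;
      apply/funext => n; rewrite big_mkord.
  apply: normed_cvg; apply: nnseries_is_cvg => //=.
  by move: gx; rewrite ge0_fin_numE.
pose f_ n x := (\sum_(k < n) h k x)%:E.
pose f x := limn_esup (f_ ^~ x).
have mf_ n : measurable_fun setT (f_ n).
  by apply/measurable_EFinP; exact: measurable_sum.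
have mf : measurable_fun setT f by exact: measurable_fun_limn_esup.
have f_f : {ae mu, forall x, (fun n => f_ n x) @ \oo --> f x}.
  apply: filterS aeg => x hx.
  have {}hx : f_ ^~ x @ \oo --> (limn (fun n => \sum_(k < n) h k x))%:E.
    exact: cvg_EFin (nearW _ _) hx.
  by rewrite /f (cvg_limn_einf_sup hx).2.
have f_g x n : (`|f_ n x| <= g x)%E.
  rewrite /f_ /g -sumEFin; apply: le_trans (lee_abs_sum _ _ _) _.
  have := @nneseries_lim_ge R (fun k => `|h k x|%:E) xpredT 0%N n.
  by rewrite big_mkord; apply.
have [||fi df _] := @dominated_convergence _ _ _ mu _ measurableT f_ f g mf_ mf _ ig.
- by apply: filterS f_f => x hx _.
- by apply: aeW => x n _.
have fK : {ae mu, forall x, (fine (f x))%:E = f x}.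
  by apply: filterS (integrable_ae measurableT fi) => x /(_ I) /fineK.
have mff : measurable_fun setT (fine \o f) by exact: measurableT_comp.
have iG : mu.-integrable setT (EFin \o (fine \o f)).
  apply/integrableP; split; first exact/measurable_EFinP.
  move/integrableP : fi => [_]; apply: le_lt_trans.
  rewrite le_eqVlt; apply/orP; left; apply/eqP/ae_eq_integral => //.
  - by apply: measurableT_comp => //; exact/measurable_EFinP.
  - exact: measurableT_comp.
  - by apply: filterS fK => x fx _; rewrite -[in RHS]fx.
exists (fine \o f); split => //.
- apply: filterS2 fK aeg => x fx hx.
  have hx' : f_ ^~ x @ \oo --> (limn (fun n => \sum_(k < n) h k x))%:E.
    exact: cvg_EFin (nearW _ _) hx.
  by rewrite /= /f (cvg_limn_einf_sup hx').2.
- rewrite [X in X @ _ --> _](_ : _ = fine \o (fun n => \int[mu]_x `|f_ n x - f x|)%E).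
    exact: fine_cvg df.
  apply/funext => n; rewrite /= /Rintegral; congr fine.
  apply: ae_eq_integral => //.
  - apply/measurable_EFinP; apply: measurableT_comp => //.
    by apply: measurable_funB => //; exact: measurable_sum.
  - by apply: measurableT_comp => //; exact: emeasurable_funB.
  - apply: filterS fK => x /= fx _.
    by rewrite -[in RHS]fx /f_ -EFinB abse_EFin distrC.
Qed.

Lemma cintegrable_L1_series (h : nat -> M -> R[i]) :
  (forall k, cintegrable mu (h k)) ->
  (\sum_(0 <= k <oo) L1norm mu (h k) < +oo)%E ->
  exists G : M -> R[i], [/\ cintegrable mu G,
    {ae mu, forall x, (fun n => normc (G x - \sum_(k < n) h k x)) @ \oo --> (0 : R)} &
    (fun n => absint mu setT (fun x => G x - \sum_(k < n) h k x)) @ \oo --> (0 : R)].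
Proof.
move=> hi hs.
have [|GR [iR aR cR]] := @real_L1_series (fun k => @complex.Re R \o h k) (fun k => (hi k).1).
  apply: le_lt_trans hs; apply: lee_nneseries => [k _ _|k _]; first exact: integral_ge0.
  apply: ge0_le_integral => //.
  - by apply/measurable_EFinP; apply: measurableT_comp => //; have [] := measurable_cintegrable (hi k).
  - exact: measurable_int (integrable_normc measurableT (hi k)).
  - by move=> x _; rewrite lee_fin normc_Re.
have [|GI [iI aI cI]] := @real_L1_series (fun k => @complex.Im R \o h k) (fun k => (hi k).2).
  apply: le_lt_trans hs; apply: lee_nneseries => [k _ _|k _]; first exact: integral_ge0.
  apply: ge0_le_integral => //.
  - by apply/measurable_EFinP; apply: measurableT_comp => //; have [] := measurable_cintegrable (hi k).
  - exact: measurable_int (integrable_normc measurableT (hi k)).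
  - by move=> x _; rewrite lee_fin normc_Im.
pose G x := (GR x +i* GI x)%C.
have iG : cintegrable mu G by [].
have ReS n x : complex.Re (\sum_(k < n) h k x) = \sum_(k < n) complex.Re (h k x).
  by apply: (big_morph (@complex.Re R)) => //; exact: ReD.
have ImS n x : complex.Im (\sum_(k < n) h k x) = \sum_(k < n) complex.Im (h k x).
  by apply: (big_morph (@complex.Im R)) => //; exact: ImD.
exists G; split => //.
- apply: filterS2 aR aI => x hR hI.
  have h0 : (fun n => `|GR x - \sum_(k < n) complex.Re (h k x)| +
      `|GI x - \sum_(k < n) complex.Im (h k x)|) @ \oo --> (0 : R).
    have := cvgD (cvg_norm (cvgB (cvg_cst (GR x)) hR)) (cvg_norm (cvgB (cvg_cst (GI x)) hI)).
    by rewrite !subrr normr0 addr0; apply.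
  apply: cvg0_le h0 => n; rewrite normc_ge0/=; apply: le_trans (normc_le_ReIm _) _.
  by rewrite ReB ImB ReS ImS.
- have h0 : (fun n => \int[mu]_x `|GR x - \sum_(k < n) complex.Re (h k x)| +
      \int[mu]_x `|GI x - \sum_(k < n) complex.Im (h k x)|) @ \oo --> (0 : R).
    by have := cvgD cR cI; rewrite addr0; apply.
  apply: cvg0_le h0 => n; rewrite absint_ge0/=.
  have [iRn iIn] := cintegrableB iG (cintegrable_sum mufin (index_enum 'I_n) hi).
  have iD : mu.-integrable setT (EFin \o (fun x => `|GR x - \sum_(k < n) complex.Re (h k x)|)).
    apply: eq_integrable (integrable_norm iRn) => // x _ /=.
    by rewrite ReB ReS.
  have iE : mu.-integrable setT (EFin \o (fun x => `|GI x - \sum_(k < n) complex.Im (h k x)|)).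
    apply: eq_integrable (integrable_norm iIn) => // x _ /=.
    by rewrite ImB ImS.
  rewrite /absint -RintegralD//; apply: le_Rintegral => //.
  + exact: (integrable_normc measurableT (conj iRn iIn)).
  + exact: eq_integrable (integrableD measurableT iD iE).
  + move=> x _; apply: le_trans (normc_le_ReIm _) _.
    by rewrite ReB ImB ReS ImS.
Qed.

End L1_series.

(** * Completeness from countable subadditivity *)

Section extended_sequences.
Context {R : realType}.

Lemma cvge0_of_le (v : nat -> \bar R) : (forall n, (0 <= v n)%E) ->
  (forall e : R, 0 < e -> exists n0, forall n, (n0 <= n)%N -> (v n <= e%:E)%E) ->
  v @ \oo --> 0%E.
Proof.
move=> v0 ve; apply/fine_cvgP; split.
  have [n0 h] := ve 1 ltr01; exists n0 => // n /= /h vn.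
  by rewrite ge0_fin_numE// (le_lt_trans vn)// ltry.
apply/cvgrPdist_le => e e0; have [n0 h] := ve e e0.
exists n0 => // n /= /h vn; rewrite sub0r normrN ger0_norm ?fine_ge0//.
by rewrite -lee_fin fineK// ge0_fin_numE// (le_lt_trans vn)// ltry.
Qed.

Lemma cvge0_ex_le (v : nat -> \bar R) : v @ \oo --> 0%E ->
  forall e : R, 0 < e -> exists n0, forall n, (n0 <= n)%N -> (v n <= e%:E)%E.
Proof.
move=> /fine_cvgP[[n0 _ h0] /cvgrPdist_le vc] e e0.
have [n1 _ h1] := vc e e0; exists (maxn n0 n1) => n; rewrite geq_max => /andP[n0n n1n].
rewrite -(fineK (h0 _ n0n)) lee_fin; apply: le_trans (h1 _ n1n).
by rewrite sub0r normrN ler_norm.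
Qed.

Lemma nneseries_half (n : nat) :
  (\sum_(0 <= k <oo) ((2 ^ (k + n.+1))%:R^-1 : R)%:E)%E = ((2 ^ n)%:R^-1)%:E.
Proof.
apply/cvg_lim => //; have := @cvg_geometric_eseries_half R 1 n.
rewrite div1r natrX; apply: cvg_trans; apply: near_eq_cvg; apply: nearW => k.
by apply: eq_bigr => i _; rewrite div1r.
Qed.

Lemma ex_half_expn (e : R) : 0 < e -> exists K, (2 ^ K)%:R^-1 <= e.
Proof.
move=> e0; exists (Num.bound e^-1); rewrite -[leRHS]invrK lef_pV2 ?posrE ?invr_gt0//.
  have h0 : 0 < e^-1 by rewrite invr_gt0.
  apply: le_trans (ltW (archi_boundP (ltW h0))) _.
  by rewrite ler_nat ltnW// ltn_expl.
Qed.

End extended_sequences.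

Section banach_criterion.
Context {d : measure_display} {R : realType} {M : borelMetricType d R}.
Variable mu : {measure set M -> \bar R}.
Hypothesis mufin : (mu setT < +oo)%E.
Variable N : (M -> R[i]) -> \bar R.
Hypothesis N0 : N (fun=> 0) = 0%E.
Hypothesis N_ge0 : forall f, (0 <= N f)%E.
Hypothesis N_ae : forall f g, cintegrable mu f -> cintegrable mu g ->
  f = g %[ae mu] -> N f = N g.
Hypothesis NZ_le : forall (z : R[i]) f, cintegrable mu f ->
  (N (fun x => z * f x)%R <= (normc z)%:E * N f)%E.
Hypothesis L1_le_N : forall f, cintegrable mu f -> (L1norm mu f <= N f)%E.
(* Countable subadditivity with respect to convergence in L^1; it implies both the
   triangle inequality and completeness. *)
Hypothesis N_series : forall f (h : nat -> M -> R[i]),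
  cintegrable mu f -> (forall k, cintegrable mu (h k)) ->
  (fun n => absint mu setT (fun x => f x - \sum_(k < n) h k x)) @ \oo --> (0 : R) ->
  (N f <= \sum_(0 <= k <oo) N (h k))%E.

(** A sum of two terms is a series whose other terms vanish. *)
Lemma normed_subadditive f g : cintegrable mu f -> cintegrable mu g ->
  (N (fun x => f x + g x)%R <= N f + N g)%E.
Proof.
move=> fi gi; pose h (k : nat) : M -> R[i] := if k is 0%N then f else if k is 1%N then g else fun=> 0.
have hi k : cintegrable mu (h k).
  by case: k => [//|[//|k]]; exact: cintegrable_cst.
have := N_series (cintegrableD fi gi) hi.
rewrite (nneseries_split 0 2)//= big_nat_recr//= big_nat1 add0n.
rewrite eseries0 ?adde0; last by case=> [|[|k]].
apply; apply/cvgrPdist_lt => e e0; exists 2%N => // -[//|[//|n]] _ /=.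
rewrite (_ : absint _ _ _ = 0) ?subrr ?normr0//.
apply: absint0 => // x; rewrite !big_ord_recl/= big1 ?addr0 ?subrr//.
Qed.

(** The inequality is applied to [z] and to [z^-1]. *)
Lemma normed_homogeneous (z : R[i]) f : cintegrable mu f ->
  N (fun x => z * f x) = ((normc z)%:E * N f)%E.
Proof.
move=> fi; apply/eqP; rewrite eq_le NZ_le//=.
have [->|z0] := eqVneq z 0; first by rewrite normc0 mul0e.
have nz0 : 0 < normc z.
  by rewrite lt_neqAle normc_ge0 andbT eq_sym; apply: contra_neq z0 => /eq0_normc.
rewrite muleC -lee_pdivlMr//.
have := NZ_le z^-1 (cintegrableZ z fi).
rewrite normcV muleC; under [X in N X]eq_fun do rewrite mulKf//.
by rewrite muleC.
Qed.

Lemma normed_opp f : cintegrable mu f -> N (fun x => - f x) = N f.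
Proof.
move=> fi; have := normed_homogeneous (-1) fi.
under [X in N X]eq_fun do rewrite mulN1r.
by rewrite normcN normc1 mul1e.
Qed.

Lemma normed_distC f g : cintegrable mu f -> cintegrable mu g ->
  N (fun x => f x - g x) = N (fun x => g x - f x).
Proof.
move=> fi gi; rewrite -(normed_opp (cintegrableB gi fi)).
by congr N; apply/funext => x; rewrite opprB.
Qed.

(** A sequence that is Cauchy for [N] is Cauchy in L^1; along a rapidly Cauchy
    subsequence the increments form a series converging in L^1, and countable
    subadditivity bounds [N] of the remainders of that series. *)
Lemma normed_complete (u : nat -> M -> R[i]) :
  (forall n, cintegrable mu (u n) /\ (N (u n) < +oo)%E) ->
  (forall e : R, 0 < e -> exists n0 : nat, forall m n : nat,
    (n0 <= m)%N -> (n0 <= n)%N -> (N (fun x => u m x - u n x)%R <= e%:E)%E) ->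
  exists2 f, cintegrable mu f /\ (N f < +oo)%E &
    (fun n => N (fun x => u n x - f x)) @ \oo --> 0%E.
Proof.
move=> uV uC.
have ui n : cintegrable mu (u n) by have [] := uV n.
have e0 k : 0 < (2 ^ k.+1)%:R^-1 :> R by rewrite invr_gt0 ltr0n expn_gt0.
have [phi phiP] := choice (fun k => uC _ (e0 k)).
pose psi k := (\sum_(i < k.+1) phi i)%N.
have psiS k : (psi k <= psi k.+1)%N by rewrite /psi [leqRHS]big_ord_recr leq_addr.
have psi_phi k : (phi k <= psi k)%N by rewrite /psi big_ord_recr leq_addl.
pose g k x := u (psi k.+1) x - u (psi k) x.
have gi k : cintegrable mu (g k) by exact: cintegrableB.
have Ng k : (N (g k) <= ((2 ^ k.+1)%:R^-1)%:E)%E.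
  by apply: phiP; rewrite ?(leq_trans (psi_phi k)).
have [|G [Gi _ GL]] := cintegrable_L1_series mufin gi.
  have := @nneseries_half R 0; rewrite expn0 invr1 => h.
  apply: le_lt_trans (ltry 1); rewrite -h; apply: lee_nneseries => k _.
    by rewrite L1normE// lee_fin absint_ge0.
  by rewrite addn1; apply: le_trans (L1_le_N (gi k)) (Ng k).
pose f x := u (psi 0%N) x + G x.
have fi : cintegrable mu f by exact: cintegrableD.
have tele K x : \sum_(k < K) g k x = u (psi K) x - u (psi 0%N) x.
  elim: K => [|K IH]; first by rewrite big_ord0 subrr.
  by rewrite big_ord_recr/= IH /g addrC subrKA.
have tail K : (N (fun x => f x - u (psi K) x)%R <= ((2 ^ K)%:R^-1)%:E)%E.
  have gKi k : cintegrable mu (g (k + K)%N) by [].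
  have := N_series (cintegrableB fi (ui (psi K))) gKi.
  have cL : (fun n => absint mu setT (fun x => f x - u (psi K) x -
      \sum_(k < n) g (k + K)%N x)) @ \oo --> (0 : R).
    have : (fun n => absint mu setT (fun x => G x - \sum_(k < n + K) g k x)) @ \oo --> (0 : R).
      by rewrite (cvg_shiftn K (fun n => absint mu setT (fun x => G x - \sum_(k < n) g k x))).
    apply: cvg_trans; apply: near_eq_cvg; apply: nearW => n.
    apply: eq_Rintegral => x _; congr normc.
    rewrite tele /f.
    have -> : \sum_(k < n) g (k + K)%N x = u (psi (n + K)%N) x - u (psi K) x.
      elim: n => [|n IH]; first by rewrite big_ord0 subrr.
      by rewrite big_ord_recr/= IH /g addrC subrKA.
    by ring.
  move=> /(_ cL) /le_trans; apply; rewrite -nneseries_half.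
  by apply: lee_nneseries => k _ //; rewrite addnS.
have dist K m : (phi K <= m)%N ->
    (N (fun x => u m x - f x)%R <= (2 * (2 ^ K)%:R^-1)%:E)%E.
  move=> Km.
  have -> : (fun x => u m x - f x) =
      (fun x => (u m x - u (psi K) x) + (u (psi K) x - f x)).
    by apply/funext => x; rewrite subrKA.
  apply: le_trans (normed_subadditive (cintegrableB (ui m) (ui _)) (cintegrableB (ui _) fi)) _.
  rewrite mulr_natl mulr2n EFinD; apply: leeD; last by rewrite normed_distC.
  apply: le_trans (phiP K _ _ Km (psi_phi K)) _.
  by rewrite lee_fin lef_pV2 ?posrE ?ltr0n ?expn_gt0// ler_nat leq_exp2l.
exists f.
  split=> //; have -> : f = (fun x => (f x - u (psi 0%N) x) + u (psi 0%N) x).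
    by apply/funext => x; rewrite subrK.
  apply: le_lt_trans (normed_subadditive (cintegrableB fi (ui _)) (ui _)) _.
  apply: lte_add_pinfty; last by have [] := uV (psi 0%N).
  by apply: le_lt_trans (tail 0%N) _; exact: ltry.
apply: cvge0_of_le => // e e_gt0.
have [K hK] := @ex_half_expn R (e / 2) (divr_gt0 e_gt0 (ltr0n _ 2)).
exists (phi K) => n /dist /le_trans; apply.
by rewrite lee_fin mulrC -ler_pdivlMr.
Qed.

Lemma L1_banach_space_of_norm :
  L1_banach_space mu [set f | cintegrable mu f /\ (N f < +oo)%E] N.
Proof.
split.
- by move=> f [].
- by move=> f g [fi Nf] gi fg; rewrite /= -(N_ae fi gi fg).
- by split; [exact: cintegrable_cst|rewrite N0].
- move=> l f g [fi Nf] [gi Ng]; split.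
    by apply: cintegrableD => //; exact: cintegrableZ.
  apply: le_lt_trans (normed_subadditive (cintegrableZ l fi) gi) _.
  apply: lte_add_pinfty => //; apply: le_lt_trans (NZ_le l fi) _.
  by apply: lte_mul_pinfty; rewrite ?lee_fin ?normc_ge0.
- by move=> f [_ Nf]; rewrite N_ge0.
- move=> f [fi _] Nf0; apply: (absint_eq0 fi); apply/eqP.
  by have := L1_le_N fi; rewrite Nf0 L1normE// lee_fin eq_le absint_ge0 andbT.
- by move=> l f [fi _]; exact: normed_homogeneous.
- by move=> f g [fi _] [gi _]; exact: normed_subadditive.
- exact: normed_complete.
Qed.

End banach_criterion.

(** * Power means *)

Section power_means.
Context {d : measure_display} {R : realType} {M : borelMetricType d R}.
Variable mu : {measure set M -> \bar R}.
Hypothesis mufin : (mu setT < +oo)%E.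
Implicit Types (f g : M -> R[i]) (A B : set M) (p c : R).
Local Notation mass := (mass mu).
Local Notation absint := (absint mu).

Lemma measurable_normc_powR f p : cintegrable mu f ->
  measurable_fun setT (fun x => (normc (f x) `^ p)%:E).
Proof.
move=> fi; apply/measurable_EFinP.
apply: (measurableT_comp (f := fun t : R => t `^ p)); first exact: measurable_powR.
exact: measurable_normcT fi.
Qed.

Lemma measurable_normc_powRS f p A : cintegrable mu f ->
  measurable_fun A (fun x => (normc (f x) `^ p)%:E).
Proof. by move=> fi; apply: measurable_funTS; exact: measurable_normc_powR. Qed.

Lemma power_mean_ge0 p B f : (0 <= power_mean mu p B f)%E.
Proof. exact: poweR_ge0. Qed.

(** With this form of an upper bound, no root of an integral remains. *)
Lemma power_mean_leP p B f c : 0 < p -> 0 <= c -> 0 < mass B ->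
  (power_mean mu p B f <= c%:E)%E =
  (\int[mu]_(x in B) (normc (f x) `^ p)%:E <= (mass B * c `^ p)%:E)%E.
Proof.
move=> p0 c0 B0; rewrite /power_mean -/(mass B).
set I := (\int[mu]_(x in B) _)%E.
have : (0 <= I)%E by apply: integral_ge0 => x _; rewrite lee_fin powR_ge0.
case: I => [I| |//] I0; last first.
  rewrite mulry gtr0_sg ?invr_gt0// mul1e poweRyr ?invr_eq0 ?gt_eqF//.
rewrite -EFinM poweR_EFin !lee_fin; rewrite lee_fin in I0.
have a0 : 0 <= (mass B)^-1 * I by rewrite mulr_ge0// invr_ge0 ltW.
rewrite -ler_pdivrMl//.
apply/idP/idP => h.
- have := ge0_ler_powR (ltW p0) (powR_ge0 _ _) c0 h.
  by rewrite -powRrM mulVf ?gt_eqF// powRr1.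
- have p'0 : 0 <= p^-1 by rewrite invr_ge0 ltW.
  have := ge0_ler_powR p'0 a0 (powR_ge0 _ _) h.
  by rewrite -[in X in _ <= X -> _]powRrM divff ?gt_eqF// powRr1.
Qed.

(** This is how Minkowski's inequality for [Lnorm] passes to power means. *)
Lemma power_mean_Lnorm p B f : 1 <= p -> measurable B -> cintegrable mu f ->
  (power_mean mu p B f = (((mass B)^-1) `^ p^-1)%:E *
    Lnorm mu p%:E (EFin \o (fun x => \1_B x * normc (f x))%R))%E.
Proof.
move=> p1 mB fi; have p0 : p != 0 by rewrite gt_eqF// (lt_le_trans ltr01).
rewrite /power_mean poweRM ?lee_fin ?invr_ge0 ?fine_ge0//; last first.
  by apply: integral_ge0 => x _; rewrite lee_fin powR_ge0.
rewrite poweR_EFin; congr (_ * _)%E; rewrite unlock /=; congr (_ `^ _)%E.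
rewrite integral_mkcond; apply: eq_integral => x _.
rewrite patchE indicE; case: ifPn => xB.
  by rewrite mul1r ger0_norm ?normc_ge0.
by rewrite mul0r normr0 powR0.
Qed.

Lemma power_meanD p B f g : 1 <= p -> measurable B ->
  cintegrable mu f -> cintegrable mu g ->
  (power_mean mu p B (fun x => f x + g x)%R <=
   power_mean mu p B f + power_mean mu p B g)%E.
Proof.
move=> p1 mB fi gi; have p0 : p != 0 by rewrite gt_eqF// (lt_le_trans ltr01).
rewrite !power_mean_Lnorm//; last exact: cintegrableD.
rewrite -ge0_muleDr ?Lnorm_ge0//; apply: lee_wpmul2l; first by rewrite lee_fin powR_ge0.
have mI h : cintegrable mu h -> measurable_fun setT (fun x => \1_B x * normc (h x)).
  move=> hi; apply: measurable_funM; first exact: measurable_indic.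
  exact: measurable_normcT hi.
apply: (le_trans _ (minkowski_EFin mu (mI _ fi) (mI _ gi) p1)).
have I0 (u : M -> R) : (0 <= \int[mu]_x `|(EFin \o u) x| `^ p)%E.
  by apply: integral_ge0 => x _; exact: poweR_ge0.
have mE (u : M -> R) : measurable_fun setT u -> measurable_fun setT (fun x => `|(EFin \o u) x| `^ p)%E.
  move=> mu'; apply/measurable_EFinP.
  apply: (measurableT_comp (f := fun t : R => t `^ p)); first exact: measurable_powR.
  exact: measurableT_comp.
rewrite unlock; apply: gt0_ler_poweR.
- by rewrite invr_ge0 (le_trans ler01).
- by rewrite in_itv/= I0 leey.
- by rewrite in_itv/= I0 leey.
apply: ge0_le_integral => //.
- by move=> x _; exact: poweR_ge0.
- exact: mE (mI _ (cintegrableD fi gi)).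
- exact: mE (measurable_funD (mI _ fi) (mI _ gi)).
- move=> x _; rewrite /= lee_fin; apply: ge0_ler_powR.
  + by rewrite (le_trans ler01).
  + by rewrite nnegrE.
  + by rewrite nnegrE.
  rewrite -mulrDr !normrM ler_wpM2l// !ger0_norm ?addr_ge0 ?normc_ge0//.
  exact: le_normcD.
Qed.

Lemma power_meanZ p B (z : R[i]) f : 1 <= p -> measurable B -> cintegrable mu f ->
  (power_mean mu p B (fun x => z * f x)%R = (normc z)%:E * power_mean mu p B f)%E.
Proof.
move=> p1 mB fi; have p0 : 0 < p by rewrite (lt_le_trans ltr01).
rewrite /power_mean.
have -> : (\int[mu]_(x in B) (normc (z * f x) `^ p)%:E =
    (normc z `^ p)%:E * \int[mu]_(x in B) (normc (f x) `^ p)%:E)%E.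
  rewrite -ge0_integralZl_EFin ?powR_ge0//.
  - by apply: eq_integral => x _; rewrite normcM powRM ?normc_ge0// EFinM.
  - by move=> x _; rewrite lee_fin powR_ge0.
  - exact: measurable_normc_powRS.
rewrite muleCA poweRM ?lee_fin ?powR_ge0//; last first.
  rewrite mule_ge0 ?lee_fin ?invr_ge0 ?fine_ge0//.
  by apply: integral_ge0 => x _; rewrite lee_fin powR_ge0.
by rewrite poweR_EFin -powRrM divff ?gt_eqF// powRr1 ?normc_ge0.
Qed.

Lemma power_mean_ae p B f g : measurable B -> cintegrable mu f -> cintegrable mu g ->
  f = g %[ae mu] -> power_mean mu p B f = power_mean mu p B g.
Proof.
move=> mB fi gi fg; rewrite /power_mean; suff -> : (\int[mu]_(x in B) (normc (f x) `^ p)%:E =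
  \int[mu]_(x in B) (normc (g x) `^ p)%:E)%E by [].
apply: ae_eq_integral => //.
- exact: measurable_normc_powRS.
- exact: measurable_normc_powRS.
- by apply: filterS fg => x fgx _; rewrite fgx.
Qed.

Lemma power_mean_cst p B (z : R[i]) : 0 < p -> measurable B -> 0 < mass B ->
  (power_mean mu p B (fun=> z) <= (normc z)%:E)%E.
Proof.
move=> p0 mB B0; rewrite power_mean_leP ?normc_ge0//.
by rewrite integral_cst//= massE// -EFinM mulrC.
Qed.

Lemma power_mean1 B f : measurable B -> cintegrable mu f ->
  power_mean mu 1 B f = ((mass B)^-1 * absint B f)%:E.
Proof.
move=> mB fi; rewrite /power_mean invr1 poweRe1; last first.
  rewrite mule_ge0 ?lee_fin ?invr_ge0 ?fine_ge0//.
  by apply: integral_ge0 => x _; rewrite lee_fin powR_ge0.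
rewrite EFinM -absintE//; congr (_ * _)%E.
by apply: eq_integral => x _; rewrite powRr1 ?normc_ge0.
Qed.

(** Young's inequality bounds [t] by an affine function of [t ^ p] that agrees
    with [t] at [t = c], so that integrating it loses nothing; [c = 0] is reached as
    a limit. *)
Lemma power_mean_L1_le p B f c : 1 <= p -> measurable B -> 0 < mass B ->
  cintegrable mu f -> 0 <= c -> (power_mean mu p B f <= c%:E)%E ->
  absint B f <= mass B * c.
Proof.
move=> p1 mB B0 fi.
have p0 : 0 < p by rewrite (lt_le_trans ltr01).
have main e : 0 < e -> (power_mean mu p B f <= e%:E)%E -> absint B f <= mass B * e.
  move=> e0; rewrite (power_mean_leP _ p0 (ltW e0) B0) => h.
  have [pE|pn1] := eqVneq p 1.
    move: h; rewrite pE (powRr1 (ltW e0)).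
    under eq_integral do rewrite powRr1 ?normc_ge0//.
    by rewrite absintE// lee_fin.
  have {}p1 : 1 < p by rewrite lt_neqAle eq_sym pn1.
  have q0 : 0 < (1 - p^-1)^-1 by rewrite invr_gt0 subr_gt0 invf_lt1.
  pose K1 := e / p / e `^ p; pose K2 := e * (1 - p^-1).
  have K10 : 0 <= K1 by rewrite !divr_ge0 ?powR_ge0// ltW.
  have K20 : 0 <= K2 by rewrite mulr_ge0 ?(ltW e0)// subr_ge0 invf_le1// ltW.
  have ineq t : 0 <= t -> t <= K1 * t `^ p + K2.
    move=> t0; have te : 0 <= t / e by rewrite divr_ge0// ltW.
    have := @conjugate_powR _ (t / e) 1 p _ te ler01 p0 q0.
    rewrite invrK addrCA subrr addr0 powR1 mul1r mulr1 => /(_ erefl).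
    have -> : t `^ p = (t / e) `^ p * e `^ p.
      by rewrite -powRM ?(ltW e0)// divfK// gt_eqF.
    rewrite ler_pdivrMr// => /le_trans; apply.
    rewrite /K1 /K2 mulrDl [(1 - _) * e]mulrC lerD2r.
    have ep : e `^ p != 0 by rewrite gt_eqF// powR_gt0.
    by rewrite le_eqVlt; apply/orP; left; apply/eqP; field; rewrite ep gt_eqF.
  have mp := @measurable_normc_powRS f p B fi.
  have J0 : (0 <= \int[mu]_(x in B) (normc (f x) `^ p)%:E)%E.
    by apply: integral_ge0 => x _; rewrite lee_fin powR_ge0.
  rewrite -lee_fin -absintE//.
  apply: (@le_trans _ _ (\int[mu]_(x in B) (K1%:E * (normc (f x) `^ p)%:E + K2%:E))%E).
    apply: ge0_le_integral => //.
    - by move=> x _; rewrite lee_fin normc_ge0.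
    - exact/measurable_EFinP/measurable_funTS/(measurable_normcT fi).
    - by apply: emeasurable_funD => //; exact: measurable_funeM.
    - by move=> x _; rewrite -EFinM -EFinD lee_fin; apply: ineq; exact: normc_ge0.
  have D1 x : B x -> (0 <= K1%:E * (normc (f x) `^ p)%:E)%E.
    by move=> _; rewrite -EFinM lee_fin mulr_ge0 ?powR_ge0.
  have D2 : measurable_fun B (fun x => K1%:E * (normc (f x) `^ p)%:E)%E.
    exact: measurable_funeM.
  rewrite ge0_integralD//.
  rewrite ge0_integralZl_EFin//; last by move=> x _; rewrite lee_fin powR_ge0.
  rewrite integral_cst//= massE//.
  have := lee_wpmul2l (_ : 0 <= K1%:E)%E h; rewrite lee_fin => /(_ K10) h1.
  apply: le_trans (leeD h1 (lexx _)) _.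
  rewrite -EFinM -EFinM -EFinD lee_fin /K1 /K2 le_eqVlt; apply/orP; left; apply/eqP.
  have ep : e `^ p != 0 by rewrite gt_eqF// powR_gt0.
  by field; rewrite ep gt_eqF.
move=> c0 h; apply/ler_addgt0Pr => e e0.
have eB0 : 0 < e / mass B by rewrite divr_gt0.
apply: le_trans (main (c + e / mass B) _ _) _.
- by rewrite ltr_wpDl.
- by apply: le_trans h _; rewrite lee_fin lerDl ltW.
- by rewrite mulrDr mulrCA divff ?gt_eqF// mulr1.
Qed.

Lemma le_integral_cover (I : eqType) (s : seq I) (A : I -> set M) B (g : M -> \bar R) :
  measurable B -> (forall i, measurable (A i)) -> measurable_fun setT g ->
  (forall x, (0 <= g x)%E) ->
  (forall x, B x -> exists2 i, i \in s & A i x) ->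
  (\int[mu]_(x in B) g x <= \sum_(i <- s) \int[mu]_(x in A i) g x)%E.
Proof.
move=> + mA mg g0; elim: s B => [|i s IH] B mB BA.
  rewrite big_nil (_ : B = set0) ?integral_set0//.
  by apply/seteqP; split => // x /BA[].
rewrite big_cons -(setUIDK B (A i)) ge0_integral_setU//; first last.
- by apply/disj_setPS => x [[_ Ax] [_ nAx]].
- exact: measurable_funTS.
- exact: measurableD.
- exact: measurableI.
apply: leeD.
  apply: ge0_subset_integral => //; first exact: measurableI.
  exact: measurable_funTS.
apply: IH; first exact: measurableD.
by move=> x [/BA[j]]; rewrite inE => /predU1P[->//|js] Ax nAx; exists j.
Qed.

(** The integral over [B] is at most the sum of those over the cover. The
    [p]-th root of the resulting factor [L * size s] is bounded by the factor, which is
    at least 1; hence the bound is uniform in [p]. *)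
Lemma power_mean_cover p B f (s : seq M) (t L v : R) : 1 <= p ->
  measurable B -> 0 < mass B -> cintegrable mu f ->
  0 <= v -> 0 <= L -> 1 <= L * (size s)%:R ->
  (forall x, B x -> exists2 y, y \in s & ball y t x) ->
  (forall y, y \in s -> 0 < mass (ball y t) <= L * mass B) ->
  (forall y, y \in s -> (power_mean mu p (ball y t) f <= v%:E)%E) ->
  (power_mean mu p B f <= (L * (size s)%:R * v)%:E)%E.
Proof.
move=> p1 mB B0 fi v0 L0 Ls cov ms pms.
have p0 : 0 < p by rewrite (lt_le_trans ltr01).
have LS0 : 0 <= L * (size s)%:R by rewrite mulr_ge0.
rewrite (power_mean_leP _ p0 (mulr_ge0 LS0 v0) B0).
apply: le_trans (le_integral_cover (A := fun y => ball y t) mB _ (measurable_normc_powR p fi) _ cov) _ => //.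
  by move=> x; rewrite lee_fin powR_ge0.
apply: (@le_trans _ _ (\sum_(y <- s) (L * mass B * v `^ p)%:E)%E).
  rewrite big_seq [leRHS]big_seq; apply: lee_sum => y ys.
  have /andP[my0 myL] := ms y ys.
  have := pms y ys; rewrite (power_mean_leP _ p0 v0 my0) => /le_trans; apply.
  by rewrite lee_fin ler_wpM2r ?powR_ge0.
rewrite sumEFin lee_fin big_const_seq count_predT iter_addr_0.
rewrite powRM// mulrA -mulr_natr [leLHS](_ : _ = mass B * (L * (size s)%:R) * v `^ p); last by ring.
rewrite ler_wpM2r ?powR_ge0// ler_wpM2l ?mass_ge0//.
by rewrite mul1r -[leLHS]powRr1//; exact: ler_powR.
Qed.

(** Fatou's lemma, with the continuity of [t ^ p] at the positive values of
    the modulus of [f]; the points where [f] vanishes contribute nothing. *)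
Lemma power_mean_fatou p B f (S : nat -> M -> R[i]) (v : \bar R) : 1 <= p ->
  measurable B -> 0 < mass B -> cintegrable mu f -> (forall n, cintegrable mu (S n)) ->
  {ae mu, forall x, (fun n => normc (f x - S n x)) @ \oo --> (0 : R)} ->
  (forall n, (power_mean mu p B (S n) <= v)%E) ->
  (power_mean mu p B f <= v)%E.
Proof.
move=> p1 mB B0 fi Si aeS pmS; have p0 : 0 < p by rewrite (lt_le_trans ltr01).
have v0 : (0 <= v)%E by apply: le_trans (pmS 0%N); exact: power_mean_ge0.
case: v v0 pmS => [v v0 pmS|_ _|//]; last exact: leey.
rewrite lee_fin in v0; rewrite power_mean_leP//.
have h n : (\int[mu]_(x in B) (normc (S n x) `^ p)%:E <= (mass B * v `^ p)%:E)%E.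
  by rewrite -power_mean_leP.
have mS n := @measurable_normc_powRS (S n) p B (Si n).
pose li x := limn_einf (fun n => (normc (S n x) `^ p)%:E).
have mli : measurable_fun B li.
  rewrite /li /limn_einf; apply: (measurableT_comp (f := -%E)) => //.
  apply: measurable_fun_limn_esup => n.
  by apply: (measurableT_comp (f := -%E)) => //.
have li0 x : (0 <= li x)%E.
  rewrite /li limn_einf_lim; apply: lime_ge; first exact: is_cvg_einfs.
  apply: nearW => n; apply: le_ereal_inf_tmp => _ /= [k _ <-].
  by rewrite lee_fin powR_ge0.
apply: (@le_trans _ _ (\int[mu]_(x in B) li x)%E).
  apply: ae_ge0_le_integral => //.
  - by move=> x _; rewrite lee_fin powR_ge0.
  - exact: measurable_normc_powRS.
  - apply: filterS aeS => x hx _.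
    have [fx0|fx0] := eqVneq (normc (f x)) 0; first by rewrite fx0 powR0 ?gt_eqF.
    have {}fx0 : 0 < normc (f x) by rewrite lt_neqAle eq_sym fx0 normc_ge0.
    suff -> : li x = (normc (f x) `^ p)%:E by [].
    have cS : (fun n => normc (S n x)) @ \oo --> normc (f x).
      apply/cvgrPdist_le => e e0; move/cvgrPdist_le : hx => /(_ e e0).
      apply: filterS => n; rewrite sub0r normrN (ger0_norm (normc_ge0 _)); apply: le_trans.
      exact: normc_lerB.
    apply: (cvg_limn_einf_sup _).1; apply: cvg_EFin; first exact: nearW.
    have dp : {for normc (f x), continuous (fun t : R => t `^ p)}.
      apply/differentiable_continuous/derivable1_diffP/derivable_powR.
      by rewrite in_itv/= fx0.
    exact: (cvg_comp _ _ cS dp).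
apply: le_trans (fatou mu mB mS _) _.
  by move=> n x _; rewrite lee_fin powR_ge0.
rewrite limn_einf_lim; apply: lime_le; first exact: is_cvg_einfs.
apply: nearW => n; apply: le_trans (h n).
by rewrite /einfs; apply: ereal_inf_lbound; exists n => /=.
Qed.

End power_means.

(** * Averages and limits in L^1 *)

Section averages.
Context {d : measure_display} {R : realType} {M : borelMetricType d R}.
Variable mu : {measure set M -> \bar R}.
Hypothesis mufin : (mu setT < +oo)%E.
Implicit Types (f g : M -> R[i]) (A B : set M) (z : R[i]).
Local Notation mass := (mass mu).
Local Notation absint := (absint mu).
Local Notation avg := (average mu).

Lemma averageD B f g : measurable B -> cintegrable mu f -> cintegrable mu g ->
  avg B (fun x => f x + g x) = avg B f + avg B g.
Proof. by move=> mB fi gi; rewrite /average cintegralD// mulrDr. Qed.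

Lemma averageZ B z f : measurable B -> cintegrable mu f ->
  avg B (fun x => z * f x) = z * avg B f.
Proof. by move=> mB fi; rewrite /average cintegralZ// mulrCA. Qed.

Lemma average_cst B z : measurable B -> 0 < mass B -> avg B (fun=> z) = z.
Proof.
move=> mB B0; rewrite /average cintegral_cst// mulrA -rmorphM/= mulVf ?gt_eqF//.
by rewrite mul1r.
Qed.

Lemma averageB B f g : measurable B -> cintegrable mu f -> cintegrable mu g ->
  avg B (fun x => f x - g x) = avg B f - avg B g.
Proof.
move=> mB fi gi; rewrite -mulN1r -averageZ// -averageD//; last exact: cintegrableZ.
by congr average; apply/funext => x; rewrite mulN1r.
Qed.

Lemma average_ae B f g : measurable B -> cintegrable mu f -> cintegrable mu g ->
  f = g %[ae mu] -> avg B f = avg B g.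
Proof.
move=> mB fi gi fg; rewrite /average /cintegral; congr (_ * (fine _ +i* fine _)%C).
- apply: ae_eq_integral => //.
  + exact: measurable_int (integrable_ReS mB fi).
  + exact: measurable_int (integrable_ReS mB gi).
  + by apply: filterS fg => x fgx _; rewrite fgx.
- apply: ae_eq_integral => //.
  + exact: measurable_int (integrable_ImS mB fi).
  + exact: measurable_int (integrable_ImS mB gi).
  + by apply: filterS fg => x fgx _; rewrite fgx.
Qed.

Lemma normc_average_le B f : measurable B -> cintegrable mu f ->
  normc (avg B f) <= (mass B)^-1 * absint B f.
Proof.
move=> mB fi; rewrite /average normcM normc_real ger0_norm ?invr_ge0 ?fine_ge0//.
by rewrite ler_wpM2l ?invr_ge0 ?fine_ge0// normc_cintegral_le.
Qed.

Lemma average_dist_le B f z : measurable B -> 0 < mass B -> cintegrable mu f ->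
  normc (avg B f - z) <= (mass B)^-1 * absint B (fun x => f x - z).
Proof.
move=> mB B0 fi; have zi := cintegrable_cst mufin z.
apply: le_trans (normc_average_le mB (cintegrableB fi zi)).
by rewrite averageB// average_cst.
Qed.

End averages.

Section L1_limits.
Context {d : measure_display} {R : realType} {M : borelMetricType d R}.
Variable mu : {measure set M -> \bar R}.
Hypothesis mufin : (mu setT < +oo)%E.
Variables (f : M -> R[i]) (h : nat -> M -> R[i]).
Hypotheses (fi : cintegrable mu f) (hi : forall k, cintegrable mu (h k)).
Hypothesis cvL1 :
  (fun n => absint mu setT (fun x => f x - \sum_(k < n) h k x)) @ \oo --> (0 : R).

Lemma cintegrable_partial_sum n : cintegrable mu (fun x => \sum_(k < n) h k x).
Proof. exact: cintegrable_sum. Qed.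

(** The series converges both almost everywhere and in L^1 to one function,
    which is [f] by uniqueness of limits in L^1. *)
Lemma L1_limit_ae : (\sum_(0 <= k <oo) L1norm mu (h k) < +oo)%E ->
  {ae mu, forall x, (fun n => normc (f x - \sum_(k < n) h k x)) @ \oo --> (0 : R)}.
Proof.
move=> hs; have [G [Gi aG GL]] := cintegrable_L1_series mufin hi hs.
have fG : f = G %[ae mu].
  have : (fun x => f x - G x) = (fun=> 0) %[ae mu].
    apply: absint_eq0; first exact: cintegrableB.
    apply/eqP; rewrite eq_le absint_ge0 andbT.
    apply/ler_addgt0Pr => e e0; rewrite add0r.
    have e20 : 0 < e / 2 by rewrite divr_gt0.
    move/cvgrPdist_le : cvL1 => /(_ _ e20)[n1 _ h1].
    move/cvgrPdist_le : GL => /(_ _ e20)[n2 _ h2].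
    have Si := cintegrable_partial_sum (maxn n1 n2).
    apply: le_trans (absint_triangle measurableT fi Si Gi) _.
    rewrite [e in leRHS](splitr e); apply: lerD.
      have := h1 _ (leq_maxl n1 n2); rewrite sub0r normrN; apply: le_trans.
      exact: ler_norm.
    have := h2 _ (leq_maxr n1 n2); rewrite sub0r normrN; apply: le_trans.
    rewrite absint_distC; exact: ler_norm.
  by apply: filterS => x fGx xT; apply/eqP; rewrite -subr_eq0; apply/eqP/fGx.
by apply: filterS2 fG aG => x ->.
Qed.

Lemma L1norm_series_le : (L1norm mu f <= \sum_(0 <= k <oo) L1norm mu (h k))%E.
Proof.
rewrite L1normE//; set S := (\sum_(0 <= k <oo) _)%E.
have pS n : ((\sum_(k < n) absint mu setT (h k))%:E <= S)%E.
  have := @nneseries_lim_ge R (fun k => L1norm mu (h k)) xpredT 0%N n.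
  rewrite big_mkord -sumEFin; under eq_bigr do rewrite L1normE//; apply.
  by move=> k _ _; rewrite L1normE// lee_fin absint_ge0.
have S0 : (0 <= S)%E by apply: nneseries_ge0 => k _ _; rewrite L1normE// lee_fin absint_ge0.
case: S S0 pS => [S|_ _|//]; last by rewrite leey.
rewrite lee_fin => S0 pS; rewrite lee_fin; apply/ler_addgt0Pr => e e0.
move/cvgrPdist_le : cvL1 => /(_ _ e0)[n _ /(_ n (leqnn n)) h1].
have Si := cintegrable_partial_sum n.
have -> : absint mu setT f = absint mu setT (fun x => (f x - \sum_(k < n) h k x) + \sum_(k < n) h k x).
  by apply: eq_Rintegral => x _; rewrite subrK.
apply: le_trans (absintD measurableT (cintegrableB fi Si) Si) _.
rewrite addrC; apply: lerD.
  apply: le_trans (absint_sum mufin (index_enum 'I_n) measurableT (fun k : 'I_n => hi k)) _.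
  by rewrite -lee_fin; exact: pS.
by move: h1; rewrite sub0r normrN; apply: le_trans; exact: ler_norm.
Qed.

Lemma average_L1_limit B : measurable B -> 0 < mass mu B ->
  (fun n => normc (average mu B f - average mu B (fun x => \sum_(k < n) h k x)))
    @ \oo --> (0 : R).
Proof.
move=> mB B0.
have h0 : (fun n => (mass mu B)^-1 * absint mu setT (fun x => f x - \sum_(k < n) h k x))
    @ \oo --> (0 : R).
  by have := cvgM (cvg_cst (mass mu B)^-1) cvL1; rewrite mulr0; apply.
apply: cvg0_le h0 => n; rewrite normc_ge0 andTb.
have Si := cintegrable_partial_sum n; have D := cintegrableB fi Si.
rewrite -averageB//; apply: le_trans (normc_average_le mB D) _.
by rewrite ler_wpM2l ?invr_ge0 ?fine_ge0// absint_mono.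
Qed.

End L1_limits.

(** * The spaces BMO *)

Section BMO_space.
Context {d : measure_display} {R : realType} {M : borelMetricType d R}.
Variable mu : {measure set M -> \bar R}.
Hypothesis mufin : (mu setT < +oo)%E.
Hypothesis ball_mass_gt0 : forall (x : M) (t : R), 0 < t -> 0 < mass mu (ball x t).
Implicit Types (f g : M -> R[i]) (b q : R).

Definition osc q (B : set M) f : \bar R :=
  power_mean mu q B (fun y => f y - average mu B f).

Lemma osc_le_seminorm b q f x t : 0 < t <= b ->
  (osc q (ball x t) f <= BMO_seminorm mu b q f)%E.
Proof. by move=> tb; apply: ereal_sup_ubound; exists x, t. Qed.

Lemma seminorm_le b q f (v : \bar R) :
  (forall x t, 0 < t <= b -> (osc q (ball x t) f <= v)%E) ->
  (BMO_seminorm mu b q f <= v)%E.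
Proof. by move=> h; apply: ge_ereal_sup => _ [x [t [tb ->]]]; exact: h. Qed.

Lemma seminorm_ge0 b q f : 0 < b -> (0 <= BMO_seminorm mu b q f)%E.
Proof.
move=> b0; apply: le_trans (osc_le_seminorm q f point (_ : 0 < b <= b)).
  exact: power_mean_ge0.
by rewrite b0 lexx.
Qed.

Lemma cintegrable_osc B f : cintegrable mu f ->
  cintegrable mu (fun y => f y - average mu B f).
Proof. by move=> fi; apply: cintegrableB => //; exact: cintegrable_cst. Qed.

Lemma oscD q x t f g : 1 <= q -> cintegrable mu f -> cintegrable mu g ->
  (osc q (ball x t) (fun x => f x + g x)%R <= osc q (ball x t) f + osc q (ball x t) g)%E.
Proof.
move=> q1 fi gi; rewrite {1}/osc.
have -> : (fun y => f y + g y - average mu (ball x t) (fun x => f x + g x)) =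
    (fun y => (f y - average mu (ball x t) f) + (g y - average mu (ball x t) g)).
  by apply/funext => y; rewrite averageD// opprD addrACA.
by apply: power_meanD => //; exact: cintegrable_osc.
Qed.

Lemma osc_ae q x t f g : cintegrable mu f -> cintegrable mu g ->
  f = g %[ae mu] -> osc q (ball x t) f = osc q (ball x t) g.
Proof.
move=> fi gi fg; rewrite /osc (average_ae (measurable_metric_ball x t) fi gi fg).
have ci := cintegrable_cst mufin (average mu (ball x t) g).
apply: power_mean_ae => //; [exact: cintegrableB|exact: cintegrableB|].
by apply: filterS fg => y fgy yT; rewrite fgy.
Qed.

Lemma osc0 q x t : 1 <= q -> 0 < t -> (osc q (ball x t) (fun=> 0%R) <= 0)%E.
Proof.
move=> q1 t0; rewrite /osc average_cst ?ball_mass_gt0// subrr.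
have := @power_mean_cst _ _ _ mu mufin q (ball x t) 0.
by rewrite normc0; apply; rewrite ?ball_mass_gt0// (lt_le_trans ltr01).
Qed.

Lemma osc_sum q x t (h : nat -> M -> R[i]) n : 1 <= q -> 0 < t ->
  (forall k, cintegrable mu (h k)) ->
  (osc q (ball x t) (fun x => \sum_(k < n) h k x)%R <= \sum_(k < n) osc q (ball x t) (h k))%E.
Proof.
move=> q1 t0 hi; elim: n => [|n IH].
  rewrite big_ord0 (_ : (fun x => \sum_(k < 0) h k x) = (fun=> 0)); first exact: osc0.
  by apply/funext => y; rewrite big_ord0.
rewrite big_ord_recr/=; under eq_fun do rewrite big_ord_recr/=.
apply: le_trans (oscD _ _ q1 (cintegrable_sum mufin _ (fun k => hi _)) (hi n)) _.
exact: leeD.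
Qed.

(** Fatou's lemma on each ball: the partial sums minus their averages converge
    almost everywhere to [f] minus its average. *)
Lemma BMO_norm_series b q f (h : nat -> M -> R[i]) : 0 < b -> 1 <= q ->
  cintegrable mu f -> (forall k, cintegrable mu (h k)) ->
  (fun n => absint mu setT (fun x => f x - \sum_(k < n) h k x)) @ \oo --> (0 : R) ->
  (BMO_norm mu b q f <= \sum_(0 <= k <oo) BMO_norm mu b q (h k))%E.
Proof.
move=> b0 q1 fi hi cv; rewrite /BMO_norm.
have L0 k : (0 <= L1norm mu (h k))%E by rewrite L1normE// lee_fin absint_ge0.
have s0 k : (0 <= BMO_seminorm mu b q (h k))%E by exact: seminorm_ge0.
rewrite nneseriesD//; have hL := L1norm_series_le mufin fi hi cv.
have [->|Ly] := eqVneq (\sum_(0 <= k <oo) L1norm mu (h k))%E +oo%E.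
  by rewrite addye ?leey// -ltNye (lt_le_trans _ (nneseries_ge0 _)).
apply: leeD => //; apply: seminorm_le => x t tb; have /andP[t0 _] := tb.
have Bm := ball_mass_gt0 x t0; have mB := measurable_metric_ball x t.
have Lfin : (\sum_(0 <= k <oo) L1norm mu (h k) < +oo)%E by rewrite ltey.
have aeS := L1_limit_ae mufin fi hi cv Lfin.
have cA := average_L1_limit mufin fi hi cv mB Bm.
pose S n (x : M) := \sum_(k < n) h k x.
have Si n : cintegrable mu (S n) by exact: cintegrable_sum.
rewrite /osc; refine (@power_mean_fatou _ _ _ mu q (ball x t) (fun y => f y - average mu (ball x t) f) (fun n y => S n y - average mu (ball x t) (S n)) _ q1 mB Bm _ _ _ _).
- exact: cintegrable_osc.
- by move=> n; exact: cintegrable_osc.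
- apply: filterS aeS => y hy.
  have h0 : (fun n => normc (f y - S n y) + normc (average mu (ball x t) f - average mu (ball x t) (S n))) @ \oo --> (0 : R).
    by have := cvgD hy cA; rewrite addr0; apply.
  apply: cvg0_le h0 => n; rewrite normc_ge0/=.
  rewrite [X in normc X](_ : _ = (f y - S n y) - (average mu (ball x t) f - average mu (ball x t) (S n))); last by ring.
  by apply: le_trans (le_normcD _ _) _; rewrite normcN.
- move=> n; apply: le_trans (osc_sum x n q1 t0 hi) _.
  apply: (@le_trans _ _ (\sum_(k < n) BMO_seminorm mu b q (h k))%E).
    by apply: lee_sum => k _; exact: osc_le_seminorm.
  have := @nneseries_lim_ge R (fun k => BMO_seminorm mu b q (h k)) xpredT 0%N n.
  by rewrite big_mkord; apply.
Qed.

Lemma BMOE b q : 0 < b -> BMO mu b q =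
  [set f | cintegrable mu f /\ (BMO_norm mu b q f < +oo)%E].
Proof.
move=> b0; apply/seteqP; split => f [fi h]; split => //.
  by rewrite /BMO_norm lte_add_pinfty// L1normE// ltry.
by apply: le_lt_trans h; rewrite /BMO_norm leeDr// L1normE// lee_fin absint_ge0.
Qed.

Lemma BMO_banach b q : 0 < b -> 1 <= q ->
  L1_banach_space mu (BMO mu b q) (BMO_norm mu b q).
Proof.
move=> b0 q1; have q0 : 0 < q by rewrite (lt_le_trans ltr01).
rewrite (@BMOE b q b0).
refine (@L1_banach_space_of_norm _ _ _ mu mufin (BMO_norm mu b q) _ _ _ _ _ _).
- rewrite /BMO_norm L1normE//; last exact: cintegrable_cst.
  rewrite absint0// add0e; apply/eqP; rewrite eq_le seminorm_ge0// andbT.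
  by apply: seminorm_le => x t /andP[t0 _]; exact: osc0.
- by move=> f; rewrite adde_ge0 ?seminorm_ge0//; apply: integral_ge0 => x _; rewrite lee_fin normc_ge0.
- move=> f g fi gi fg; rewrite /BMO_norm.
  have -> : L1norm mu f = L1norm mu g.
    by rewrite !L1normE// (eq_ae_absint measurableT fi gi fg).
  suff -> : BMO_seminorm mu b q f = BMO_seminorm mu b q g by [].
  apply/eqP; rewrite eq_le; apply/andP; split; apply: seminorm_le => x t tb.
    by rewrite (osc_ae q x t fi gi fg); exact: osc_le_seminorm.
  by rewrite -(osc_ae q x t fi gi fg); exact: osc_le_seminorm.
- move=> z f fi; rewrite /BMO_norm ge0_muleDr ?seminorm_ge0//; last first.
    by rewrite L1normE// lee_fin absint_ge0.
  apply: leeD.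
    by rewrite !L1normE ?absintZ//; exact: cintegrableZ.
  apply: seminorm_le => x t tb; rewrite /osc averageZ//.
  under [X in power_mean _ _ _ X]eq_fun do rewrite -mulrBr.
  rewrite power_meanZ//; last exact: cintegrable_osc.
  by apply: lee_wpmul2l; rewrite ?lee_fin ?normc_ge0//; exact: osc_le_seminorm.
- by move=> f fi; rewrite leeDl// seminorm_ge0.
- by move=> f h fi hi; exact: BMO_norm_series.
Qed.

End BMO_space.

(** * Doubling and packing *)

Section doubling.
Context {d : measure_display} {R : realType} {M : borelMetricType d R}.
Variable mu : {measure set M -> \bar R}.
Hypothesis mufin : (mu setT < +oo)%E.
Local Notation mass := (mass mu).

(** A ball of measure zero would, by doubling, have all its dilates of measure
    zero, and these exhaust the space. *)
Lemma doubling_ball_mass_gt0 : locally_doubling mu -> (0 < mu setT)%E ->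
  forall (x : M) (t : R), 0 < t -> 0 < mass (ball x t).
Proof.
move=> LD mu0 x t t0; rewrite lt_neqAle mass_ge0 andbT eq_sym; apply/negP => /eqP m0.
have dil k : mu (ball x (2 ^+ k * t)) = 0%E.
  elim: k => [|k IH]; first by rewrite expr0 mul1r (massE mufin)// m0.
  have kt : 0 < 2 ^+ k * t by rewrite mulr_gt0// exprn_gt0.
  have [D /(_ x (2 ^+ k * t))] := LD _ kt.
  rewrite kt lexx mulrA -exprS => /(_ isT); rewrite IH mule0 => h.
  by apply/eqP; rewrite eq_le h measure_ge0.
suff : (mu setT <= 0)%E by rewrite leNgt mu0.
have -> : setT = \bigcup_k ball x (2 ^+ k * t) :> set M.
  apply/seteqP; split => // y _.
  have [K hK] := @ex_half_expn R (t / (mdist x y + 1)) (divr_gt0 t0 (ltr_wpDl (mdist_ge0 _ _) ltr01)).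
  exists K => //; rewrite in_ballE; apply: (@lt_le_trans _ _ (mdist x y + 1)); first by rewrite ltrDl.
  have d1 : 0 < mdist x y + 1 by rewrite ltr_wpDl ?mdist_ge0.
  move: hK; rewrite ler_pdivlMr// mulrC -ler_pdivlMr; last by rewrite invr_gt0 ltr0n expn_gt0.
  by rewrite invrK natrX mulrC.
suff -> : mu (\bigcup_k ball x (2 ^+ k * t)) = 0%E by [].
apply: measure_negligible; first exact: bigcup_measurable.
apply: negligible_bigcup => k; exists (ball x (2 ^+ k * t)); split => //; exact: dil.
Qed.

Definition doubling_upto (D b : R) := forall (x : M) (t : R), 0 < t <= b ->
  mass (ball x (2 * t)) <= D * mass (ball x t).

Lemma ex_doubling_upto b : locally_doubling mu -> 0 < b ->
  exists2 D, 1 <= D & doubling_upto D b.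
Proof.
move=> LD b0; have [D hD] := LD b b0; exists (Num.max 1 D); first by rewrite le_max lexx.
move=> x t tb; have := hD x t tb; rewrite !(massE mufin)// lee_fin => /le_trans; apply.
by rewrite ler_wpM2r ?mass_ge0// le_max lexx orbT.
Qed.

Variables (D b : R).
Hypothesis D1 : 1 <= D.
Hypothesis Db : doubling_upto D b.

Lemma doubling_iter k (x : M) (t : R) : 0 < t -> 2 ^+ k * t <= 2 * b ->
  mass (ball x (2 ^+ k * t)) <= D ^+ k * mass (ball x t).
Proof.
move=> t0; elim: k => [|k IH] kb; first by rewrite !expr0 !mul1r.
rewrite exprS -mulrA in kb *; move: kb; rewrite ler_pM2l// => kb.
have k0 : 0 < 2 ^+ k * t by rewrite mulr_gt0// exprn_gt0.
have b0 : 0 <= b by rewrite (le_trans (ltW k0)).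
apply: le_trans (Db _ _) _; first by rewrite k0.
rewrite exprS -mulrA ler_wpM2l ?(le_trans ler01)//; apply: IH.
by apply: le_trans kb _; rewrite ler_peMl// ler1n.
Qed.

End doubling.

(** * Separated families of balls *)

Section separated_balls.
Context {d : measure_display} {R : realType} {M : borelMetricType d R}.
Implicit Types (p : M * R) (s : seq (M * R)).

Definition ball_of p : set M := ball p.1 p.2.

#[local] Hint Extern 0 (measurable (ball_of _)) => exact: measurable_metric_ball : core.

(** Stronger than the disjointness of the balls, but boolean, so that [pairwise]
    applies to it. *)
Definition separated p1 p2 := p1.2 + p2.2 <= mdist p1.1 p2.1.

Lemma separated_disjoint p1 p2 x : separated p1 p2 -> ball_of p1 x -> ~ ball_of p2 x.
Proof.
rewrite /separated /ball_of !in_ballE => h h1 h2.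
have := metric_triangle p1.1 x p2.1; rewrite (metric_sym x p2.1).
by apply/negP; rewrite -ltNge (lt_le_trans _ h)// ltrD.
Qed.

Variable mu : {measure set M -> \bar R}.

Lemma sum_integral_separated s (A : set M) (g : M -> \bar R) :
  measurable A -> measurable_fun setT g -> (forall x, (0 <= g x)%E) ->
  pairwise separated s -> (forall p, p \in s -> ball_of p `<=` A) ->
  (\sum_(p <- s) \int[mu]_(x in ball_of p) g x <= \int[mu]_(x in A) g x)%E.
Proof.
move=> + mg g0; elim: s A => [|p s IH] A mA; first by rewrite big_nil integral_ge0.
rewrite /= big_cons => /andP[/allP ps sep] sA.
have pA : ball_of p `<=` A by apply: sA; rewrite mem_head.
rewrite -[in leRHS](setDUK pA) ge0_integral_setU//; first last.
- by apply/disj_setPS => x [px [_]].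
- exact: measurable_funTS.
- exact: measurableD.
apply: leeD => //; apply: IH => //.
  by apply: measurableD => //; exact: measurable_metric_ball.
move=> p' p's x p'x; split; first by apply: sA p'x; rewrite inE p's orbT.
by move=> px; exact: separated_disjoint (ps _ p's) px p'x.
Qed.

Hypothesis mufin : (mu setT < +oo)%E.

Lemma sum_absint_separated s (A : set M) f : measurable A -> cintegrable mu f ->
  pairwise separated s -> (forall p, p \in s -> ball_of p `<=` A) ->
  \sum_(p <- s) absint mu (ball_of p) f <= absint mu A f.
Proof.
move=> mA fi sep sA; rewrite -lee_fin -sumEFin.
under eq_bigr => p _ do rewrite -(absintE (measurable_metric_ball p.1 p.2) fi).
rewrite -absintE//; apply: sum_integral_separated => //.
- exact: measurable_int (integrable_normc measurableT fi).
- by move=> x; rewrite lee_fin normc_ge0.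
Qed.

Lemma sum_mass_separated s (A : set M) : measurable A ->
  pairwise separated s -> (forall p, p \in s -> ball_of p `<=` A) ->
  \sum_(p <- s) mass mu (ball_of p) <= mass mu A.
Proof.
move=> mA sep sA.
have := sum_absint_separated mA (cintegrable_cst mufin 1) sep sA.
rewrite absint_cst// normc1 mul1r; apply: le_trans.
rewrite le_eqVlt; apply/orP; left; apply/eqP; apply: eq_bigr => p _.
by rewrite absint_cst ?normc1 ?mul1r//; exact: measurable_metric_ball.
Qed.

Variables (D b : R).
Hypothesis D1 : 1 <= D.
Hypothesis Db : doubling_upto mu D b.
Hypothesis ball_mass_gt0 : forall (x : M) (t : R), 0 < t -> 0 < mass mu (ball x t).

(** The balls are disjoint and contained in [ball x (2 * t)], and by doubling
    each of them has at least the fraction [D ^- k] of its measure. *)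
Lemma packing s (x : M) (t rho : R) k : 0 < rho -> 0 < t ->
  3 * t <= 2 ^+ k * rho -> 2 ^+ k * rho <= 2 * b ->
  pairwise separated s ->
  (forall p, p \in s -> ball x t p.1 /\ rho <= p.2 <= t) ->
  (size s)%:R <= D ^+ k.
Proof.
move=> rho0 t0 kt kb sep sx.
have V0 : 0 < mass mu (ball x (2 * t)) by rewrite ball_mass_gt0// mulr_gt0.
have Dk : 0 < D ^+ k by rewrite exprn_gt0// (lt_le_trans ltr01).
have sub p : p \in s -> ball_of p `<=` ball x (2 * t).
  move=> /sx[]; rewrite in_ballE => xp /andP[_ pt]; apply: sub_ball; lra.
have := sum_mass_separated (measurable_metric_ball x (2 * t)) sep sub.
move=> h; have {h} : (size s)%:R * ((D ^+ k)^-1 * mass mu (ball x (2 * t))) <= mass mu (ball x (2 * t)).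
  apply: le_trans h; rewrite mulr_natl -iter_addr_0 -count_predT -big_const_seq.
  rewrite big_seq [leRHS]big_seq; apply: ler_sum => p /sx[xp /andP[rp pt]].
  rewrite -ler_pdivlMl ?invr_gt0// invrK.
  apply: le_trans (ler_wpM2l (ltW Dk) (le_mass mufin _ _ (_ : ball p.1 rho `<=` _))) => //; last first.
    by apply: sub_ball; rewrite mdistxx add0r.
  apply: le_trans (doubling_iter D1 Db _ rho0 kb).
  apply: le_mass => //; apply: sub_ball; rewrite metric_sym; move: xp; rewrite in_ballE; lra.
by rewrite mulrA -ler_pdivlMr// divff ?gt_eqF// ler_pdivrMr// mul1r.
Qed.

End separated_balls.

(** A sequence of greatest length has the required property. *)
Lemma maximal_seq (T : Type) (P : seq T -> Prop) n : P [::] ->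
  (forall s, P s -> (size s <= n)%N) ->
  exists2 s, P s & forall y, ~ P (y :: s).
Proof.
move=> P0 Pn.
pose Q k := `[< exists2 s, P s & size s = k >].
have exQ : exists k, Q k by exists 0%N; apply/asboolP; exists [::].
have ubQ k : Q k -> (k <= n)%N by move=> /asboolP[s /Pn + <-].
case: (ex_maxnP exQ ubQ) => k /asboolP[s Ps sk] kmax; exists s => // y Py.
have : (k.+1 <= k)%N by apply: kmax; apply/asboolP; exists (y :: s); rewrite //= sk.
by rewrite ltnn.
Qed.

(** * Nets and chains *)

Section nets.
Context {d : measure_display} {R : realType} {M : borelMetricType d R}.
Variable mu : {measure set M -> \bar R}.
Hypothesis mufin : (mu setT < +oo)%E.
Hypothesis LD : locally_doubling mu.
Hypothesis ball_mass_gt0 : forall (x : M) (t : R), 0 < t -> 0 < mass mu (ball x t).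
Implicit Types (x y : M) (s : seq M).

Definition net_sep (e : R) : rel M := fun x y => e <= mdist x y.

Lemma net_sep_separated e s : pairwise (net_sep e) s =
  pairwise separated [seq (y, e / 2) | y <- s].
Proof.
rewrite pairwise_map; apply: eq_pairwise => x y.
by rewrite /separated /net_sep /= -splitr.
Qed.

Lemma ex_pow_ge (a e : R) : 0 < e -> exists k, a <= 2 ^+ k * e.
Proof.
move=> e0; have [a0|a0] := leP a 0.
  by exists 0%N; rewrite expr0 mul1r (le_trans a0)// ltW.
have [K hK] := @ex_half_expn R (e / a) (divr_gt0 e0 a0); exists K.
move: hK; rewrite ler_pdivlMr// mulrC -ler_pdivlMr; last by rewrite invr_gt0 ltr0n expn_gt0.
by rewrite invrK natrX mulrC.
Qed.

(** The balls of radius [e / 2] about the points of [s] are separated, so that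
    [packing] applies. *)
Lemma net_size (b e : R) : 0 < e -> 0 < b -> exists N0 : nat,
  forall x t s, e <= t <= b ->
  pairwise (net_sep e) s -> (forall y, y \in s -> ball x t y) -> (size s <= N0)%N.
Proof.
move=> e0 b0; have e20 : 0 < e / 2 by rewrite divr_gt0.
have [k hk] := @ex_pow_ge (3 * b) (e / 2) e20.
have k0 : 0 < 2 ^+ k * (e / 2) by rewrite mulr_gt0// exprn_gt0.
have [D D1 Db] := ex_doubling_upto mufin LD k0.
exists (Num.truncn (D ^+ k)) => x t s /andP[et tb] sep sx.
have t0 : 0 < t by apply: lt_le_trans et.
rewrite -(size_map (fun y => (y, e / 2))) truncn_ge_nat; last by rewrite exprn_ge0// (le_trans ler01).
apply: (packing mufin D1 Db ball_mass_gt0 (x := x) (t := t) (rho := e / 2)) => //.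
- by apply: le_trans hk; rewrite ler_wpM2l.
- lra.
- by rewrite -net_sep_separated.
- move=> p /mapP[y ys ->]; split; first exact: sx.
  by rewrite /= lexx/=; lra.
Qed.

(** A maximal separated family in the ball covers it. *)
Lemma ex_net (b e : R) : 0 < e -> 0 < b -> exists N0 : nat,
  forall x t, e <= t <= b -> exists s, [/\ (size s <= N0)%N,
    pairwise (net_sep e) s, (forall y, y \in s -> ball x t y) &
    forall z, ball x t z -> exists2 y, y \in s & ball y e z].
Proof.
move=> e0 b0; have [N0 hN] := net_size e0 b0; exists N0 => x t etb.
pose P s := pairwise (net_sep e) s /\ forall y, y \in s -> ball x t y.
have [||s [sep sx] smax] := @maximal_seq _ P N0; first by split.
  by move=> s [sep sx]; exact: hN etb sep sx.
exists s; split => //; first exact: hN etb sep sx.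
move=> z xz; have [/hasP[y ys zy]|/hasPn nz] := boolP (has (fun y => mdist z y < e) s).
  by exists y => //; rewrite in_ballE metric_sym.
exfalso; apply: (smax z); split.
  by rewrite /= sep andbT; apply/allP => y /nz; rewrite -leNgt.
by move=> y; rewrite inE => /predU1P[->//|/sx].
Qed.

(** The points of [s] at distance less than [e] from [y] are packed in a ball of
    radius [e]; only balls of radii comparable with [e] are involved, and the bound
    does not depend on [e]. *)
Lemma net_overlap (b : R) : 0 < b -> exists N0 : nat,
  forall e s y, 0 < e <= b -> pairwise (net_sep e) s ->
  (count (fun z => `[< ball z e y >]) s <= N0)%N.
Proof.
move=> b0; have b20 : 0 < 2 * b by rewrite mulr_gt0.
have [D D1 Db] := ex_doubling_upto mufin LD b20.
exists (Num.truncn (D ^+ 3)) => e s y /andP[e0 eb] sep.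
rewrite -size_filter -(size_map (fun y => (y, e / 2))) truncn_ge_nat; last by rewrite exprn_ge0// (le_trans ler01).
apply: (packing mufin D1 Db ball_mass_gt0 (x := y) (t := e) (rho := e / 2)) => //.
- by rewrite divr_gt0.
- rewrite exprS expr2; lra.
- rewrite exprS expr2; lra.
- by rewrite -net_sep_separated; apply: subseq_pairwise sep; exact: filter_subseq.
- move=> p /mapP[z + ->]; rewrite mem_filter => /andP[/asboolP yz _]; split.
    by apply: ball_sym.
  by rewrite /= lexx/=; lra.
Qed.

(** Approximate midpoints join two points at distance at most [b] by a chain of
    [2 ^ n] steps of length at most [c / 2]. A function satisfying the triangle
    inequality and bounded on such steps is therefore bounded on pairs of points at
    distance at most [b]. *)
Lemma chain_bound (R0 beta b c : R) : approx_midpoint M R0 beta ->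
  R0 / (1 - beta) < c -> 0 < c -> exists n : nat,
  forall (Phi : M -> M -> \bar R) (K : R), 0 <= K ->
    (forall x y z, (Phi x z <= Phi x y + Phi y z)%E) ->
    (forall x y, mdist x y <= c / 2 -> (Phi x y <= K%:E)%E) ->
    forall x y, mdist x y <= b -> (Phi x y <= (2 ^+ n * K)%:E)%E.
Proof.
move=> [R00 /andP[beta2 beta1] AM] Rc c0.
have R0c : R0 <= c / 2.
  have : R0 < c * (1 - beta) by rewrite -ltr_pdivrMr// subr_gt0.
  move=> /ltW /le_trans; apply; rewrite ler_wpM2l ?(ltW c0)//; lra.
have beta0 : 0 < beta by apply: lt_trans beta2.
have [n hn] : exists n, beta ^+ n * b <= c / 2.
  have [b0|b0] := leP b 0.
    by exists 0%N; rewrite expr0 mul1r (le_trans b0)// divr_ge0// ltW.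
  have e0 : 0 < c / 2 / b by rewrite !divr_gt0.
  have /cvgrPdist_lt/(_ _ e0)[n _ h] := @cvg_expr R beta (ltac:(by rewrite gtr0_norm)).
  exists n; have := h n (leqnn n); rewrite sub0r normrN => hn.
  by rewrite -ler_pdivlMr// (le_trans (ler_norm _))// ltW.
exists n => Phi K K0 tri step x y xyb.
have : beta ^+ n * mdist x y <= c / 2.
  by apply: le_trans hn; rewrite ler_wpM2l// exprn_ge0// ltW.
elim: n x y {hn xyb} => [|n IH] x y.
  by rewrite !expr0 !mul1r; exact: step.
move=> h; have [xyR|xyR] := leP (mdist x y) R0.
  apply: le_trans (step _ _ (le_trans xyR R0c)) _.
  by rewrite lee_fin ler_peMl// exprn_ege1// ler1n.
have [z [xz yz]] := AM x y xyR.
apply: le_trans (tri x z y) _; rewrite exprS -mulrA mulr_natl mulr2n EFinD.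
have bn : 0 <= beta ^+ n by rewrite exprn_ge0// ltW.
apply: leeD; apply: IH.
  by apply: le_trans h; rewrite exprSr -mulrA ler_wpM2l// ltW.
by rewrite metric_sym; apply: le_trans h; rewrite exprSr -mulrA ler_wpM2l// ltW.
Qed.

End nets.

(** * Comparison of the BMO seminorms at two scales *)

Section BMO_scales.
Context {d : measure_display} {R : realType} {M : borelMetricType d R}.
Variable mu : {measure set M -> \bar R}.
Hypothesis mufin : (mu setT < +oo)%E.
Implicit Types (f : M -> R[i]) (q v : R).
Local Notation mass := (mass mu).
Local Notation absint := (absint mu).
Local Notation avg := (average mu).
Local Notation osc := (osc mu).

Lemma average_nested (A B : set M) f (L v : R) : measurable A -> measurable B ->
  A `<=` B -> 0 < mass A -> mass B <= L * mass A -> 0 <= v -> cintegrable mu f ->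
  absint B (fun x => f x - avg B f) <= mass B * v ->
  normc (avg A f - avg B f) <= L * v.
Proof.
move=> mA mB AB A0 BA v0 fi fB.
apply: le_trans (average_dist_le mufin _ mA A0 fi) _.
rewrite ler_pdivrMl// (le_trans (absint_mono mA mB AB (cintegrable_osc mufin B fi)))//.
by apply: le_trans fB _; rewrite mulrCA mulrA ler_wpM2r.
Qed.

Lemma power_mean_recenter q (B : set M) f (z w : R[i]) : 1 <= q -> measurable B -> 0 < mass B ->
  cintegrable mu f ->
  (power_mean mu q B (fun y => f y - z)%R <=
   power_mean mu q B (fun y => f y - w)%R + (normc (w - z))%:E)%E.
Proof.
move=> q1 mB B0 fi; have q0 : 0 < q by rewrite (lt_le_trans ltr01).
have ci (u : R[i]) := cintegrable_cst mufin u.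
have -> : (fun y => f y - z) = (fun y => (f y - w) + (w - z)).
  by apply/funext => y; rewrite subrKA.
apply: le_trans (power_meanD q1 mB (cintegrableB fi (ci w)) (ci _)) _.
by apply: leeD => //; exact: power_mean_cst.
Qed.

(** The average is, up to a factor 2, the constant that best approximates
    [f] on [B]. *)
Lemma osc_recenter q (B : set M) f (z : R[i]) v : 1 <= q -> measurable B -> 0 < mass B ->
  cintegrable mu f -> 0 <= v -> (power_mean mu q B (fun y => f y - z)%R <= v%:E)%E ->
  (osc q B f <= (2 * v)%:E)%E.
Proof.
move=> q1 mB B0 fi v0 h.
apply: le_trans (power_mean_recenter _ z q1 mB B0 fi) _.
rewrite mulr_natl mulr2n EFinD; apply: leeD => //; rewrite lee_fin normc_distC.
apply: le_trans (average_dist_le mufin z mB B0 fi) _.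
rewrite ler_pdivrMl//; apply: (power_mean_L1_le mufin q1 mB B0 _ v0 h).
by apply: cintegrableB => //; exact: cintegrable_cst.
Qed.

Hypothesis LD : locally_doubling mu.
Hypothesis ball_mass_gt0 : forall (x : M) (t : R), 0 < t -> 0 < mass (ball x t).

(** Overlapping balls of the same radius contain a common ball of comparable
    measure, hence the averages over them are close. *)
Lemma average_shift (c D : R) f v x y : 0 < c -> 1 <= D -> doubling_upto mu D c ->
  cintegrable mu f -> 0 <= v ->
  (forall z, absint (ball z c) (fun x => f x - avg (ball z c) f) <= mass (ball z c) * v) ->
  mdist x y <= c / 2 ->
  normc (avg (ball x c) f - avg (ball y c) f) <= (D + D ^+ 2) * v.
Proof.
move=> c0 D1 Dc fi v0 fv xy.
have c20 : 0 < c / 2 by rewrite divr_gt0.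
have m0 := ball_mass_gt0 x c20.
have near z : mdist z x <= c / 2 -> ball x (c / 2) `<=` ball z c.
  by move=> zx; apply: sub_ball; lra.
have d1 : mass (ball x c) <= D * mass (ball x (c / 2)).
  have := doubling_iter (k := 1) (t := c / 2) D1 Dc x c20.
  by rewrite !expr1 mulrCA divff// mulr1; apply; lra.
have d2 : mass (ball y c) <= D ^+ 2 * mass (ball x (c / 2)).
  apply: le_trans (doubling_iter (k := 2) D1 Dc x c20 _); last by rewrite expr2; lra.
  by apply: le_mass => //; apply: sub_ball; rewrite expr2; lra.
apply: le_trans (normc_triangle _ (avg (ball x (c / 2)) f) _) _.
rewrite mulrDl normc_distC; apply: lerD.
  apply: (average_nested _ _ (near _ _) m0 d1 v0 fi (fv x)) => //.
  by rewrite mdistxx ltW.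
by apply: (average_nested _ _ (near _ _) m0 d2 v0 fi (fv y)) => //; rewrite metric_sym.
Qed.

Variables (R0 beta : R).
Hypothesis AM : approx_midpoint M R0 beta.

(** A ball of radius between [c] and [b] is covered by boundedly many balls of
    radius [c], which are joined to the centre by chains of bounded length. *)
Lemma osc_larger_ball (b c : R) : R0 / (1 - beta) < c -> 0 < c -> c < b ->
  exists2 K : R, 1 <= K & forall q f v, 1 <= q -> cintegrable mu f -> 0 <= v ->
    (forall x t, 0 < t <= c -> (osc q (ball x t) f <= v%:E)%E) ->
    forall x t, 0 < t <= b -> (osc q (ball x t) f <= (K * v)%:E)%E.
Proof.
move=> Rc c0 cb; have b0 := lt_trans c0 cb.
have [n chain] := chain_bound b AM Rc c0.
have [D D1 Dc] := ex_doubling_upto mufin LD c0.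
have [L L1 Lb] := ex_doubling_upto mufin LD b0.
have [N0 net] := ex_net mufin LD ball_mass_gt0 c0 b0.
pose K0 := 1 + 2 ^+ n * (D + D ^+ 2).
have K01 : 1 <= K0.
  by rewrite lerDl mulr_ge0 ?exprn_ge0// addr_ge0 ?exprn_ge0// (le_trans ler01).
exists (1 + 2 * (L * N0%:R * K0)).
  by rewrite lerDl !mulr_ge0// ?(le_trans ler01).
move=> q f v q1 fi v0 fv x t /andP[t0 tb].
have [tc|ct] := leP t c.
  apply: le_trans (fv x t _) _; first by rewrite t0.
  by rewrite lee_fin ler_peMl// lerDl !mulr_ge0// ?(le_trans ler01).
have fv1 z : absint (ball z c) (fun x => f x - avg (ball z c) f) <= mass (ball z c) * v.
  apply: (power_mean_L1_le mufin q1 _ _ _ v0 (fv z c _)) => //.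
  - exact: ball_mass_gt0.
  - exact: cintegrable_osc.
  - by rewrite c0 lexx.
have [s [sN ssep sx cov]] := net x t (ltac:(by rewrite (ltW ct))).
have B0 := ball_mass_gt0 x t0.
have L0 : 0 <= L by rewrite (le_trans ler01).
have size1 : 1 <= (size s)%:R :> R.
  have [y ys _] := cov x (ltac:(by rewrite in_ballE mdistxx)).
  by rewrite ler1n; case: s ys {sN ssep sx cov}.
have avgd y : y \in s -> normc (avg (ball y c) f - avg (ball x c) f) <= 2 ^+ n * ((D + D ^+ 2) * v).
  move=> ys; rewrite -lee_fin.
  apply: (chain (fun y z => (normc (avg (ball y c) f - avg (ball z c) f))%:E)).
  - by rewrite mulr_ge0// addr_ge0 ?exprn_ge0// (le_trans ler01).
  - by move=> y1 y2 y3; rewrite -EFinD lee_fin normc_triangle.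
  - by move=> y1 y2 h; rewrite lee_fin; exact: average_shift.
  - by have := sx y ys; rewrite in_ballE metric_sym => /ltW /le_trans; apply.
have K0v : 0 <= K0 * v by rewrite mulr_ge0// (le_trans ler01).
have pmc : (power_mean mu q (ball x t) (fun y => f y - avg (ball x c) f)%R <=
    (L * (size s)%:R * (K0 * v))%:E)%E.
  apply: (power_mean_cover (t := c) q1 _ B0 _ K0v L0 _ cov) => //.
  - by apply: cintegrableB => //; exact: cintegrable_cst.
  - by apply: le_trans size1 _; rewrite ler_peMl.
  - move=> y ys; rewrite ball_mass_gt0//=.
    apply: le_trans (Lb _ _ _); last by rewrite t0.
    by apply: le_mass => //; apply: sub_ball; have := sx y ys; rewrite in_ballE; lra.
  - move=> y ys.
    apply: le_trans (power_mean_recenter _ (avg (ball y c) f) q1 _ (ball_mass_gt0 y c0) fi) _ => //.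
    rewrite /K0 mulrDl mul1r EFinD; apply: leeD; first by apply: fv; rewrite c0 lexx.
    by rewrite lee_fin -mulrA avgd.
have pm0 : 0 <= L * (size s)%:R * (K0 * v) by rewrite mulr_ge0 // mulr_ge0.
apply: le_trans (osc_recenter q1 _ B0 fi pm0 pmc) _ => //.
rewrite lee_fin; apply: (@le_trans _ _ (2 * (L * N0%:R * (K0 * v)))).
  by rewrite ler_wpM2l// ler_wpM2r// ler_wpM2l// ler_nat.
clearbody K0; have -> : (1 + 2 * (L * N0%:R * K0)) * v = 2 * (L * N0%:R * (K0 * v)) + v by ring.
by rewrite lerDl.
Qed.

Lemma BMO_seminorm_scale (b c : R) : R0 / (1 - beta) < c -> 0 < c -> c < b ->
  exists2 K : R, 1 <= K & forall q f, 1 <= q -> cintegrable mu f ->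
    (BMO_seminorm mu b q f <= K%:E * BMO_seminorm mu c q f)%E.
Proof.
move=> Rc c0 cb; have [K K1 hK] := osc_larger_ball Rc c0 cb; exists K => // q f q1 fi.
have K0 : 0 < K by rewrite (lt_le_trans ltr01).
have := @seminorm_ge0 _ _ _ mu c q f c0.
case E : (BMO_seminorm mu c q f) => [v| |]// v0.
  rewrite lee_fin in v0; apply: seminorm_le => x t tb.
  apply: hK => // y u uc; rewrite -E; exact: osc_le_seminorm.
by rewrite gt0_muley ?lte_fin// leey.
Qed.

Lemma BMO_seminorm_mono (b c q : R) f : c <= b ->
  (BMO_seminorm mu c q f <= BMO_seminorm mu b q f)%E.
Proof.
move=> cb; apply: seminorm_le => x t /andP[t0 tc]; apply: osc_le_seminorm.
by rewrite t0 (le_trans tc).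
Qed.

Lemma BMO_id_isomorphism (b c q : R) : R0 / (1 - beta) < c -> 0 < c -> c < b -> 1 <= q ->
  id_banach_isomorphism mu (BMO mu b q) (BMO_norm mu b q) (BMO mu c q) (BMO_norm mu c q).
Proof.
move=> Rc c0 cb q1; have b0 := lt_trans c0 cb.
have [K K1 hK] := BMO_seminorm_scale Rc c0 cb.
have K0 : 0 < K by rewrite (lt_le_trans ltr01).
have s0 f : (0 <= BMO_seminorm mu c q f)%E by exact: seminorm_ge0.
have eqV : BMO mu b q = BMO mu c q.
  apply/seteqP; split => f [fi h]; split => //.
    by apply: le_lt_trans h; exact: BMO_seminorm_mono (ltW cb).
  apply: le_lt_trans (hK q f q1 fi) _.
  by apply: lte_mul_pinfty => //; rewrite lee_fin ltW.
split; [exact: BMO_banach|exact: BMO_banach|exact: eqV|].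
exists K => // f [fi _].
have L0 : (0 <= L1norm mu f)%E by rewrite L1normE// lee_fin absint_ge0.
have LK : (L1norm mu f <= K%:E * L1norm mu f)%E.
  by rewrite L1normE// -EFinM lee_fin ler_peMl// absint_ge0.
have sb0 : (0 <= BMO_seminorm mu b q f)%E by exact: seminorm_ge0.
rewrite /BMO_norm (ge0_muleDr _ L0 (s0 f)) (ge0_muleDr _ L0 sb0).
split; apply: leeD => //; last exact: hK.
apply: le_trans (BMO_seminorm_mono _ _ (ltW cb)) _.
by rewrite -[leLHS]mul1e; apply: lee_wpmul2r; rewrite ?seminorm_ge0// lee_fin.
Qed.

End BMO_scales.

(** * Double series *)

Lemma seq_ltn_bound (T : eqType) (F : T -> nat) (s : seq T) :
  exists B, forall p, p \in s -> (F p < B)%N.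
Proof.
elim: s => [|p s [B hB]]; first by exists 0%N.
exists (maxn (F p).+1 B) => p'; rewrite inE leq_max => /predU1P[->|/hB ->].
  by rewrite ltnSn.
by rewrite orbT.
Qed.

Lemma big_uniq_sub (T : eqType) (V : nmodType) (s1 s2 : seq T) (F : T -> V) :
  uniq s1 -> uniq s2 -> {subset s1 <= s2} ->
  \sum_(p <- s2) F p = \sum_(p <- s1) F p + \sum_(p <- s2 | p \notin s1) F p.
Proof.
move=> u1 u2 s12; rewrite -[X in _ + X]big_filter -big_cat; apply: perm_big.
apply: uniq_perm => //.
  rewrite cat_uniq u1 filter_uniq// andbT; apply/hasPn => p.
  by rewrite mem_filter => /andP[].
move=> p; rewrite mem_cat mem_filter; case: (boolP (p \in s1)) => //= ps1.
exact: s12.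
Qed.

Lemma big_iota0 (V : nmodType) n (F : nat -> V) :
  \sum_(k <- iota 0 n) F k = \sum_(k < n) F k.
Proof. by rewrite -(big_mkord xpredT) /index_iota subn0. Qed.

Section double_series.
Context {d : measure_display} {R : realType} {M : borelMetricType d R}.
Variable mu : {measure set M -> \bar R}.
Hypothesis mufin : (mu setT < +oo)%E.
Variables (f : M -> R[i]) (h : nat -> M -> R[i]) (g : nat * nat -> M -> R[i]).
Variables (w : nat * nat -> R) (T : R).
Hypotheses (fi : cintegrable mu f) (hi : forall j, cintegrable mu (h j))
  (gi : forall p, cintegrable mu (g p)).
Hypothesis gw : forall p, absint mu setT (g p) <= w p.
Hypothesis wT : forall J K, \sum_(j < J) \sum_(k < K) w (nat_of_ord j, nat_of_ord k) <= T.
Hypothesis fh : (fun n => absint mu setT (fun x => f x - \sum_(j < n) h j x)) @ \oo --> (0 : R).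
Hypothesis hg : forall j,
  (fun n => absint mu setT (fun x => h j x - \sum_(k < n) g (j, nat_of_ord k) x)) @ \oo --> (0 : R).

(** The values of [F] along the enumeration of the pairs by [pickle], with 0 at
    the numbers that encode no pair. *)
Definition enum_pairs (V : nmodType) (F : nat * nat -> V) (n : nat) : V :=
  oapp F 0 (pickle_inv (T := (nat * nat)%type) n).

Let s n := pmap (pickle_inv (T := (nat * nat)%type)) (iota 0 n).
Let box J K := [seq (j, k) | j <- iota 0 J, k <- iota 0 K].

Let sum_enum (V : nmodType) (F : nat * nat -> V) n :
  \sum_(k < n) enum_pairs F k = \sum_(p <- s n) F p.
Proof. by rewrite big_pmap big_iota0. Qed.

Let uniq_s n : uniq (s n).
Proof. by apply: pmap_uniq (iota_uniq _ _); exact: pickle_invK. Qed.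

Let mem_s n p : (p \in s n) = (pickle p < n)%N.
Proof.
rewrite mem_pmap; apply/mapP/idP => [[k]|pn].
  rewrite mem_iota add0n => /andP[_ kn] pk.
  by have := @pickle_invK (nat * nat)%type k; rewrite -pk /= => ->.
by exists (pickle p); rewrite ?mem_iota ?add0n// pickleK_inv.
Qed.

Let uniq_box J K : uniq (box J K).
Proof. by apply: allpairs_uniq; rewrite ?iota_uniq// => -[? ?] [? ?] _ _ [-> ->]. Qed.

Let mem_box J K p : (p \in box J K) = (p.1 < J)%N && (p.2 < K)%N.
Proof.
case: p => j k; apply/allpairsP/andP => [[[j' k'] /= [+ + [-> ->]]]|[/= jJ kK]].
  by rewrite !mem_iota !add0n.
by exists (j, k); rewrite !mem_iota !add0n.
Qed.

Let sum_box (V : nmodType) (F : nat * nat -> V) J K :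
  \sum_(p <- box J K) F p = \sum_(j < J) \sum_(k < K) F (nat_of_ord j, nat_of_ord k).
Proof.
by rewrite big_allpairs big_iota0; apply: eq_bigr => j _; rewrite big_iota0.
Qed.

Let w_ge0 p : 0 <= w p.
Proof. exact: le_trans (absint_ge0 _ _ _) (gw p). Qed.

Let W n := \sum_(k < n) enum_pairs w k.

Lemma enum_pairs_sum_le n : \sum_(k < n) enum_pairs w k <= T.
Proof.
rewrite sum_enum.
have [J hJ] := seq_ltn_bound fst (s n); have [K hK] := seq_ltn_bound snd (s n).
apply: le_trans (wT J K); rewrite -sum_box (big_uniq_sub w (uniq_s n) (uniq_box J K)).
  by rewrite lerDl sumr_ge0.
by move=> p ps; rewrite mem_box hJ// hK.
Qed.

Let cvgW : W @ \oo --> sup (range W).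
Proof.
apply: nondecreasing_cvgn.
  apply/nondecreasing_seqP => n; rewrite /W big_ord_recr /= lerDl.
  by rewrite /enum_pairs; case: pickle_inv => //=.
by exists T => _ [n _ <-]; exact: enum_pairs_sum_le.
Qed.

Let W_le n : W n <= sup (range W).
Proof.
apply: ub_le_sup; last by exists n.
by exists T => _ [k _ <-]; exact: enum_pairs_sum_le.
Qed.

(** The rows converge in L^1, and so does the series of their sums; hence large
    rectangles are close to [f]. A rectangle differs from an initial segment of the
    enumeration by terms whose norms sum to at most the remainder of the convergent
    series [W]. *)
Lemma absint_enum_remainder n :
  absint mu setT (fun x => f x - \sum_(k < n) enum_pairs (fun p => g p x) k) <=
  sup (range W) - W n.
Proof.
apply/ler_addgt0Pr => e e0.
have e20 : 0 < e / 2 by rewrite divr_gt0.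
have [J0 hJ0] := seq_ltn_bound fst (s n); have [K0 hK0] := seq_ltn_bound snd (s n).
move/cvgrPdist_le : fh => /(_ _ e20)[J1 _ hJ1].
pose J := maxn J0 J1.
have eJ0 : 0 < e / 2 / J.+1%:R by rewrite divr_gt0.
have /choice[Kf hKf] : forall j, exists Kf, forall K, (Kf <= K)%N ->
    absint mu setT (fun x => h j x - \sum_(k < K) g (j, nat_of_ord k) x) <= e / 2 / J.+1%:R.
  move=> j; move/cvgrPdist_le : (hg j) => /(_ _ eJ0)[K _ hK]; exists K => K' /hK.
  by rewrite sub0r normrN; apply: le_trans; exact: ler_norm.
pose K := (K0 + \sum_(j < J) Kf j)%N.
have KfK j : (j < J)%N -> (Kf j <= K)%N.
  by move=> jJ; rewrite /K (bigD1 (Ordinal jJ))//= addnCA leq_addr.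
have Si m : cintegrable mu (fun x => \sum_(k < m) enum_pairs (fun p => g p x) k).
  apply: (cintegrable_sum mufin (index_enum 'I_m) (F := fun (k : 'I_m) x => enum_pairs (fun p => g p x) k)) => k.
  by rewrite /enum_pairs; case: pickle_inv => //=; exact: cintegrable_cst.
have Bi : cintegrable mu (fun x => \sum_(p <- box J K) g p x) by exact: cintegrable_sum.
have sJK : {subset s n <= box J K}.
  move=> p ps; rewrite mem_box /J /K leq_max hJ0//=.
  by rewrite (leq_trans (hK0 _ ps))// leq_addr.
apply: le_trans (absint_triangle measurableT fi Bi (Si n)) _.
rewrite addrC; apply: lerD.
  have [N hN] := seq_ltn_bound pickle (box J K).
  apply: (@le_trans _ _ (\sum_(p <- box J K) w p - W n)); last first.
    rewrite lerD2r; apply: le_trans (W_le N); rewrite /W sum_enum.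
    rewrite (big_uniq_sub w (uniq_box J K) (uniq_s N)) ?lerDl ?sumr_ge0// => p /hN.
    by rewrite mem_s.
  rewrite /W sum_enum (big_uniq_sub w (uniq_s n) (uniq_box J K) sJK) addrAC subrr add0r.
  rewrite -big_filter.
  apply: (@le_trans _ _ (\sum_(p <- [seq p <- box J K | p \notin s n]) absint mu setT (g p))); last first.
    by apply: ler_sum => p _.
  apply: le_trans (absint_sum mufin _ measurableT gi).
  rewrite le_eqVlt; apply/orP; left; apply/eqP; apply: eq_Rintegral => x _.
  rewrite sum_enum (big_uniq_sub (fun p => g p x) (uniq_s n) (uniq_box J K) sJK).
  by rewrite addrAC subrr add0r big_filter.
have Hi m : cintegrable mu (fun x => \sum_(j < m) h j x) by exact: cintegrable_sum.
rewrite (splitr e).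
apply: le_trans (absint_triangle measurableT fi (Hi J) Bi) _; apply: lerD.
  have := hJ1 J (leq_maxr _ _); rewrite sub0r normrN; apply: le_trans; exact: ler_norm.
apply: (@le_trans _ _ (\sum_(j < J) absint mu setT (fun x => h j x - \sum_(k < K) g (nat_of_ord j, nat_of_ord k) x))).
  have di j : cintegrable mu (fun x => h j x - \sum_(k < K) g (j, nat_of_ord k) x).
    by apply: cintegrableB => //; exact: cintegrable_sum.
  apply: le_trans (absint_sum mufin (index_enum 'I_J) measurableT (fun j : 'I_J => di j)).
  rewrite le_eqVlt; apply/orP; left; apply/eqP; apply: eq_Rintegral => x _.
  by rewrite sum_box -sumrB.
apply: (@le_trans _ _ (\sum_(j < J) e / 2 / J.+1%:R)).
  by apply: ler_sum => j _; apply: hKf; exact: KfK.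
rewrite sumr_const card_ord -[X in X <= _]mulr_natr.
have J1_0 : 0 < J.+1%:R :> R by rewrite ltr0n.
by rewrite mulrAC ler_pdivrMr// ler_pM2l// ler_nat.
Qed.

Lemma enum_pairs_cvg :
  (fun n => absint mu setT (fun x => f x - \sum_(k < n) enum_pairs (fun p => g p x) k))
    @ \oo --> (0 : R).
Proof.
have h0 : (fun n => sup (range W) - W n) @ \oo --> (0 : R).
  by have := cvgB (cvg_cst (sup (range W))) cvgW; rewrite subrr; apply.
by apply: cvg0_le h0 => n; rewrite absint_ge0 absint_enum_remainder.
Qed.

End double_series.

(** * The Hardy spaces *)

Section hardy_space.
Context {d : measure_display} {R : realType} {M : borelMetricType d R}.
Variable mu : {measure set M -> \bar R}.
Hypothesis mufin : (mu setT < +oo)%E.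
Hypothesis mu0 : (0 < mu setT)%E.
Hypothesis ball_mass_gt0 : forall (x : M) (t : R), 0 < t -> 0 < mass mu (ball x t).
Variables (b : R) (r : \bar R).
Hypothesis r1 : (1 < r)%E.
Implicit Types (f g a : M -> R[i]).
Local Notation mass := (mass mu).
Local Notation absint := (absint mu).
Local Notation N := (hardy1_norm mu b r).

Lemma absint_indicM (A B : set M) f : measurable A -> measurable B ->
  absint B (fun x => (\1_A x : R)%:C%C * f x) = absint (B `&` A) f.
Proof.
move=> mA mB; rewrite /absint Rintegral_mkcondr; apply: eq_Rintegral => x _.
rewrite patchE indicE normcM normc_real; case: ifPn => _.
  by rewrite normr1 mul1r.
by rewrite normr0 mul0r.
Qed.

Lemma indicM_ae (A : set M) f : {ae mu, forall x, ~ A x -> f x = 0} ->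
  f = (fun x => (\1_A x : R)%:C%C * f x) %[ae mu].
Proof.
apply: filterS => x fx _; rewrite indicE; have [/set_mem Ax|/negP nAx] := boolP (x \in A).
  by rewrite mul1r.
by rewrite mul0r fx// => Ax; apply: nAx; exact: mem_set.
Qed.

Lemma absint_supported (A : set M) f : measurable A -> cintegrable mu f ->
  {ae mu, forall x, ~ A x -> f x = 0} -> absint setT f = absint A f.
Proof.
move=> mA fi fA; have gi := cintegrable_indicM mA fi.
rewrite (eq_ae_absint measurableT fi gi (indicM_ae fA)).
by rewrite (absint_indicM _ mA measurableT) setTI.
Qed.

Lemma Lnormy_leP (A : set M) a (v : R) : (Lnorm mu +oo (fun x => (normc (a x))%:E) <= v%:E)%E <->
  {ae mu, forall x, normc (a x) <= v}.
Proof.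
rewrite unlock mu0; split => [/ess_supP|h].
  by apply: filterS => x /=; rewrite lee_fin ger0_norm ?normc_ge0.
by apply/ess_supP; apply: filterS h => x /=; rewrite lee_fin ger0_norm ?normc_ge0.
Qed.

Lemma standard_atom_absint_le1 x (t : R) a : 0 < t ->
  standard_atom mu r (ball x t) a -> absint setT a <= 1.
Proof.
move=> t0 [ai aB _ ar]; have B0 := ball_mass_gt0 x t0; have mB := measurable_metric_ball x t.
rewrite (absint_supported mB ai aB).
have iB0 : 0 <= (mass (ball x t))^-1 by rewrite invr_ge0 ltW.
case: r r1 ar => [p| |//] p1 ar.
  have := power_mean_L1_le mufin (ltW p1) mB B0 ai iB0 ar.
  by rewrite divff// gt_eqF.
have /(Lnormy_leP setT) h := ar.
rewrite -lee_fin -absintE//.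
apply: (@le_trans _ _ (\int[mu]_(y in ball x t) ((mass (ball x t))^-1)%:E)%E).
  apply: ae_ge0_le_integral => //.
  - by move=> y _; rewrite lee_fin normc_ge0.
  - exact: measurable_int (integrable_normc mB ai).
  - by apply: filterS h => y hy _; rewrite lee_fin.
by rewrite integral_cst//= massE// -EFinM mulVf// gt_eqF.
Qed.

Lemma cintegrable_atom a : atom_le mu b r a -> cintegrable mu a.
Proof. by move=> [[x [t [_ []]]]|->] //; exact: cintegrable_cst. Qed.

Lemma mass_setT_gt0 : 0 < mass setT.
Proof. by rewrite -lte_fin -massE. Qed.

Lemma absint_exceptional : absint setT (exceptional_atom mu) = 1.
Proof.
rewrite absint_cst// normc_real ger0_norm ?invr_ge0 ?fine_ge0// mulVf//.
by rewrite gt_eqF// mass_setT_gt0.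
Qed.

Lemma atom_absint_le1 a : atom_le mu b r a -> absint setT a <= 1.
Proof.
move=> [[x [t [/andP[t0 _] ha]]]|->]; first exact: standard_atom_absint_le1 ha.
by rewrite absint_exceptional.
Qed.

Lemma L1norm_cvg0 (F : nat -> M -> R[i]) : (forall n, cintegrable mu (F n)) ->
  (fun n => L1norm mu (F n)) @ \oo --> 0%E <-> (fun n => absint setT (F n)) @ \oo --> (0 : R).
Proof.
move=> Fi; under [X in X @ _ --> _ <-> _]eq_fun do rewrite L1normE//.
by split => [/fine_cvgP[_]|h]; [apply|apply: cvg_EFin => //; exact: nearW].
Qed.

Lemma cintegrable_atomic (l : nat -> R[i]) (u : nat -> M -> R[i]) n : (forall k, atom_le mu b r (u k)) ->
  cintegrable mu (fun x => \sum_(k < n) l k * u k x).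
Proof.
move=> ua; apply: (cintegrable_sum mufin (index_enum 'I_n) (F := fun (k : 'I_n) x => l k * u k x)) => k.
by apply: cintegrableZ; exact: cintegrable_atom.
Qed.

Lemma atomic_decompositionP g l u : cintegrable mu g ->
  atomic_decomposition mu b r g l u <->
  [/\ forall k, atom_le mu b r (u k),
      (\sum_(0 <= k <oo) (normc (l k))%:E < +oo)%E &
      (fun n => absint setT (fun x => g x - \sum_(k < n) l k * u k x)) @ \oo --> (0 : R)].
Proof.
move=> gi; split=> [[ua ls cv]|[ua ls cv]]; split => //.
  by apply/L1norm_cvg0 => // n; apply: cintegrableB => //; exact: cintegrable_atomic.
by apply/L1norm_cvg0 => // n; apply: cintegrableB => //; exact: cintegrable_atomic.
Qed.

Lemma hardy1_norm_le g l u : atomic_decomposition mu b r g l u ->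
  (N g <= \sum_(0 <= k <oo) (normc (l k))%:E)%E.
Proof. by move=> h; apply: ereal_inf_lbound; exists l, u. Qed.

Lemma hardy1_norm_ge g (v : \bar R) :
  (forall l u, atomic_decomposition mu b r g l u ->
    (v <= \sum_(0 <= k <oo) (normc (l k))%:E)%E) -> (v <= N g)%E.
Proof. by move=> h; apply: le_ereal_inf_tmp => _ [l [u [lu ->]]]; exact: h lu. Qed.

Lemma hardy1_norm_ge0 g : (0 <= N g)%E.
Proof.
apply: hardy1_norm_ge => l u _; apply: nneseries_ge0 => k _ _.
by rewrite lee_fin normc_ge0.
Qed.

Lemma hardy1E : hardy1 mu b r = [set g | cintegrable mu g /\ (N g < +oo)%E].
Proof.
apply/seteqP; split => g [gi].
  move=> [l [u lu]]; split => //; apply: le_lt_trans (hardy1_norm_le lu) _.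
  by have [] := lu.
move=> /ereal_inf_lt[_ [l [u [lu _]]] _]; split => //; by exists l, u.
Qed.

Lemma exceptional_atom_le : atom_le mu b r (exceptional_atom mu).
Proof. by right. Qed.

Lemma hardy1_norm0 : N (fun=> 0) = 0%E.
Proof.
apply/eqP; rewrite eq_le hardy1_norm_ge0 andbT.
have s0 : (\sum_(0 <= k <oo) (normc (0 : R[i]))%:E = 0 :> \bar R)%E.
  by apply: eseries0 => k _ _; rewrite normc0.
rewrite -[leRHS]s0; apply: (@hardy1_norm_le _ (fun=> 0) (fun=> exceptional_atom mu)).
apply/atomic_decompositionP; first exact: cintegrable_cst.
split => [k||]; [by right|by rewrite s0|].
apply: cvg_near_cst; apply: nearW => n; apply: absint0 => // x.
by rewrite big1 ?subr0// => k _; rewrite mul0r.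
Qed.

Lemma hardy1_norm_ae f g : cintegrable mu f -> cintegrable mu g ->
  f = g %[ae mu] -> (N f <= N g)%E.
Proof.
move=> fi gi fg; apply: hardy1_norm_ge => l u /(atomic_decompositionP _ _ gi)[ua ls cv].
apply: (@hardy1_norm_le _ l u); apply/atomic_decompositionP => //; split => //.
have Si n := cintegrable_atomic l n ua.
rewrite (_ : (fun n => _) = (fun n => absint setT (fun x => g x - \sum_(k < n) l k * u k x)))//.
apply/funext => n; apply: eq_ae_absint => //; [exact: cintegrableB|exact: cintegrableB|].
by apply: filterS fg => x fgx xT; rewrite fgx.
Qed.

Lemma hardy1_normZ_le (z : R[i]) f : cintegrable mu f ->
  (N (fun x => z * f x)%R <= (normc z)%:E * N f)%E.
Proof.
move=> fi; have [->|z0] := eqVneq z 0.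
  rewrite normc0 mul0e (_ : (fun x => 0 * f x) = (fun=> 0)) ?hardy1_norm0//.
  by apply/funext => x; rewrite mul0r.
have nz0 : 0 < normc z.
  by rewrite lt_neqAle normc_ge0 andbT eq_sym; apply: contra_neq z0 => /eq0_normc.
rewrite -lee_pdivrMl//; apply: hardy1_norm_ge => l u /(atomic_decompositionP _ _ fi)[ua ls cv].
rewrite lee_pdivrMl// -nneseriesZl; last by move=> k _; rewrite lee_fin normc_ge0.
under eq_eseriesr do rewrite -EFinM -normcM.
apply: (@hardy1_norm_le _ (fun k => z * l k) u); apply/atomic_decompositionP; first exact: cintegrableZ.
split => //.
- under eq_eseriesr do rewrite normcM EFinM.
  rewrite nneseriesZl; last by move=> k _; rewrite lee_fin normc_ge0.
  by apply: lte_mul_pinfty => //; rewrite lee_fin normc_ge0.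
- have h0 : (fun n => normc z * absint setT (fun x => f x - \sum_(k < n) l k * u k x)) @ \oo --> (0 : R).
    by have := cvgM (cvg_cst (normc z)) cv; rewrite mulr0; apply.
  rewrite (_ : (fun n => _) = (fun n => normc z * absint setT (fun x => f x - \sum_(k < n) l k * u k x)))//.
  apply/funext => n; rewrite -absintZ//.
    apply: eq_Rintegral => x _; rewrite mulrBr mulr_sumr; congr (normc (_ - _)).
    by apply: eq_bigr => k _; rewrite mulrA.
  by apply: cintegrableB => //; exact: cintegrable_atomic.
Qed.

Lemma hardy1_L1_le f : cintegrable mu f -> (L1norm mu f <= N f)%E.
Proof.
move=> fi; apply: hardy1_norm_ge => l u /(atomic_decompositionP _ _ fi)[ua ls cv].
have hi k : cintegrable mu (fun x => l k * u k x).
  by apply: cintegrableZ; exact: cintegrable_atom.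
apply: le_trans (L1norm_series_le mufin fi hi cv) _.
apply: lee_nneseries => k _; first by rewrite L1normE// lee_fin absint_ge0.
rewrite L1normE// absintZ//; last exact: cintegrable_atom.
by rewrite lee_fin ler_piMr ?normc_ge0// atom_absint_le1.
Qed.

Lemma hardy1_norm_adherent f (e : R) : 0 < e -> cintegrable mu f -> (N f < +oo)%E ->
  exists lu : (nat -> R[i]) * (nat -> M -> R[i]),
    atomic_decomposition mu b r f lu.1 lu.2 /\
    (\sum_(0 <= k <oo) (normc (lu.1 k))%:E <= N f + e%:E)%E.
Proof.
move=> e0 fi fN; have Nfin : N f \is a fin_num by rewrite ge0_fin_numE// hardy1_norm_ge0.
have [_ [l [u [lu ->]]] /ltW h] := lb_ereal_inf_adherent e0 Nfin.
by exists (l, u).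
Qed.

(** Near-optimal decompositions of the terms, listed along an enumeration of
    the pairs of indices, form a decomposition of the sum. *)
Lemma hardy1_norm_series f (h : nat -> M -> R[i]) :
  cintegrable mu f -> (forall k, cintegrable mu (h k)) ->
  (fun n => absint setT (fun x => f x - \sum_(k < n) h k x)) @ \oo --> (0 : R) ->
  (N f <= \sum_(0 <= k <oo) N (h k))%E.
Proof.
move=> fi hi cv.
have [->|Sy] := eqVneq (\sum_(0 <= k <oo) N (h k))%E +oo%E; first exact: leey.
have S0 : (0 <= \sum_(0 <= k <oo) N (h k))%E by apply: nneseries_ge0 => k _ _; exact: hardy1_norm_ge0.
have Nh k : (N (h k) < +oo)%E.
  rewrite ltey; apply: contra_neq Sy => Nk.
  apply: (@eseries_pinfty _ _ _ k) => // j _.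
  by rewrite -ltNye (lt_le_trans _ (hardy1_norm_ge0 _)).
apply/lee_addgt0Pr => e e0.
have ek k : 0 < e / (2 ^ k.+1)%:R by rewrite divr_gt0// ltr0n expn_gt0.
have /choice[lu hlu] := fun k => hardy1_norm_adherent (ek k) (hi k) (Nh k).
have dec k : atomic_decomposition mu b r (h k) (lu k).1 (lu k).2 by have [] := hlu k.
have ua j k : atom_le mu b r ((lu j).2 k) by have [] := dec j.
pose w (p : nat * nat) : R := normc ((lu p.1).1 p.2).
pose g (p : nat * nat) x := (lu p.1).1 p.2 * (lu p.1).2 p.2 x.
have gi p : cintegrable mu (g p) by apply: cintegrableZ; exact: cintegrable_atom.
have gw p : absint setT (g p) <= w p.
  rewrite absintZ//; last exact: cintegrable_atom.
  by rewrite ler_piMr ?normc_ge0// atom_absint_le1.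
set S := (\sum_(0 <= k <oo) N (h k))%E in Sy S0 *.
have Sfin : S \is a fin_num by rewrite ge0_fin_numE// ltey.
pose T := fine S + e.
have wT J K : \sum_(j < J) \sum_(k < K) w (nat_of_ord j, nat_of_ord k) <= T.
  rewrite -lee_fin EFinD fineK//.
  apply: (le_trans _ (@epsilon_trick R (fun k => N (h k)) e xpredT (fun k => hardy1_norm_ge0 (h k)) (ltW e0))).
  rewrite -sumEFin.
  apply: (@le_trans _ _ (\sum_(j < J) (N (h j) + (e / (2 ^ j.+1)%:R)%:E))%E).
    apply: lee_sum => j _; have [_ hj] := hlu j; apply: le_trans hj.
    rewrite -sumEFin; have := @nneseries_lim_ge R (fun k => (normc ((lu j).1 k))%:E) xpredT 0%N K.
    by rewrite big_mkord; apply => k _ _; rewrite lee_fin normc_ge0.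
  have := @nneseries_lim_ge R (fun j => N (h j) + (e / (2 ^ j.+1)%:R)%:E)%E xpredT 0%N J.
  rewrite big_mkord; apply => k _ _.
  by rewrite adde_ge0 ?hardy1_norm_ge0// lee_fin ltW.
have hg j : (fun n => absint setT (fun x => h j x - \sum_(k < n) g (j, nat_of_ord k) x)) @ \oo --> (0 : R).
  by have /(atomic_decompositionP _ _ (hi j))[] := dec j.
have cvE := enum_pairs_cvg mufin fi hi gi gw wT cv hg.
have sumE := enum_pairs_sum_le gw wT.
pose l n := enum_pairs (fun p => (lu p.1).1 p.2) n.
pose u n := oapp (fun p : nat * nat => (lu p.1).2 p.2) (exceptional_atom mu) (pickle_inv n).
have lw n : normc (l n) = enum_pairs w n.
  by rewrite /l /enum_pairs; case: pickle_inv => // ; exact: normc0.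
have lsum : (\sum_(0 <= k <oo) (normc (l k))%:E <= T%:E)%E.
  apply: lime_le; first by apply: is_cvg_nneseries => k _ _; rewrite lee_fin normc_ge0.
  apply: nearW => n; rewrite big_mkord sumEFin lee_fin.
  by under eq_bigr do rewrite lw; exact: sumE.
rewrite -(fineK Sfin) -EFinD; apply: (le_trans _ lsum).
apply: (@hardy1_norm_le _ l u); apply/(atomic_decompositionP _ _ fi); split.
- by move=> k; rewrite /u; case: pickle_inv => //=; exact: exceptional_atom_le.
- by apply: le_lt_trans lsum _; exact: ltry.
- rewrite (_ : (fun n => _) = (fun n => absint setT (fun x => f x - \sum_(k < n) enum_pairs (fun p => g p x) k)))//.
  apply/funext => n; apply: eq_Rintegral => x _; congr (normc (_ - _)); apply: eq_bigr => k _.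
  by rewrite /l /u /enum_pairs; case: pickle_inv => //=; rewrite mul0r.
Qed.

Lemma hardy1_banach : L1_banach_space mu (hardy1 mu b r) N.
Proof.
rewrite hardy1E; refine (@L1_banach_space_of_norm _ _ _ mu mufin N _ _ _ _ _ _).
- exact: hardy1_norm0.
- exact: hardy1_norm_ge0.
- move=> f g fi gi fg; apply/eqP; rewrite eq_le !hardy1_norm_ae//.
  by apply: filterS fg => x fgx xT; rewrite fgx.
- exact: hardy1_normZ_le.
- exact: hardy1_L1_le.
- exact: hardy1_norm_series.
Qed.

End hardy_space.

(** * Comparison of the Hardy norms at two scales *)

Section hardy_scales.
Context {d : measure_display} {R : realType} {M : borelMetricType d R}.
Variable mu : {measure set M -> \bar R}.
Hypothesis mufin : (mu setT < +oo)%E.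
Hypothesis mu0 : (0 < mu setT)%E.
Hypothesis ball_mass_gt0 : forall (x : M) (t : R), 0 < t -> 0 < mass mu (ball x t).
Variable r : \bar R.
Hypothesis r1 : (1 < r)%E.
Implicit Types (f g a : M -> R[i]) (A B E : set M) (v : R).
Local Notation mass := (mass mu).
Local Notation absint := (absint mu).
Local Notation N c := (hardy1_norm mu c r).

(** The size condition in the definition of atoms, with the essential supremum
    replaced by an equivalent bound almost everywhere. *)
Definition size_bound B f v : Prop :=
  match r with
  | p%:E => (power_mean mu p B f <= v%:E)%E
  | +oo%E => {ae mu, forall x, normc (f x) <= v}
  | -oo%E => False
  end.

Lemma standard_atomP B a : standard_atom mu r B a <->
  [/\ cintegrable mu a, {ae mu, forall x, ~ B x -> a x = 0},
      cintegral mu B a = 0 & size_bound B a (mass B)^-1].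
Proof.
rewrite /standard_atom /size_bound; case: r => [p| |] //; split => -[? ? ? h]; split => //.
  by apply/(Lnormy_leP mu0 setT).
by apply/(Lnormy_leP mu0 setT).
Qed.

Lemma size_boundZ B f v (z : R[i]) : measurable B -> cintegrable mu f ->
  size_bound B f v -> size_bound B (fun x => z * f x) (normc z * v).
Proof.
move=> mB fi; rewrite /size_bound; case: r r1 => [p| |] // p1.
  have -> := power_meanZ z (ltW p1 : 1 <= p) mB fi.
  move=> h; rewrite EFinM.
  by apply: lee_wpmul2l => //; rewrite lee_fin normc_ge0.
by apply: filterS => x fx; rewrite normcM ler_wpM2l ?normc_ge0.
Qed.

Lemma size_boundD B f g v w : measurable B -> cintegrable mu f -> cintegrable mu g ->
  size_bound B f v -> size_bound B g w -> size_bound B (fun x => f x + g x) (v + w).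
Proof.
move=> mB fi gi; rewrite /size_bound; case: r r1 => [p| |] // p1.
  move=> hf hg; apply: le_trans (power_meanD (ltW p1) mB fi gi) _.
  by rewrite EFinD; exact: leeD.
by apply: filterS2 => x fx gx; apply: le_trans (le_normcD _ _) (lerD fx gx).
Qed.

Lemma size_bound_le B f v w : v <= w -> size_bound B f v -> size_bound B f w.
Proof.
move=> vw; rewrite /size_bound; case: r => [p| |] //.
  by move=> /le_trans; apply; rewrite lee_fin.
by apply: filterS => x /le_trans; apply.
Qed.

Lemma size_bound_sup B f v : measurable B -> 0 < mass B -> 0 <= v -> cintegrable mu f ->
  (forall x, normc (f x) <= v) -> size_bound B f v.
Proof.
move=> mB B0 v0 fi fv; rewrite /size_bound; case: r r1 => [p| |] // p1; last exact: aeW.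
have p0 : 0 < p by rewrite (lt_trans ltr01).
rewrite power_mean_leP//.
apply: (@le_trans _ _ (\int[mu]_(x in B) (v `^ p)%:E)%E).
  apply: ge0_le_integral => //.
  - by move=> x _; rewrite lee_fin powR_ge0.
  - exact: (measurable_normc_powRS p fi).
  - move=> x _; rewrite lee_fin; apply: ge0_ler_powR => //; first exact: ltW.
    by rewrite nnegrE normc_ge0.
by rewrite integral_cst//= massE// -EFinM mulrC.
Qed.

(** An average over [B] is replaced by an average over [B'] at the cost of the
    ratio of the masses; the [p]-th root of [L] is at most [L] because [1 <= L]. *)
Lemma size_bound_restrict B B' E f v (L : R) : measurable B -> measurable B' ->
  measurable E -> E `<=` B -> 0 < mass B -> 0 < mass B' -> 1 <= L ->
  mass B <= L * mass B' -> 0 <= v -> cintegrable mu f ->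
  size_bound B f v -> size_bound B' (fun x => (\1_E x : R)%:C%C * f x) (L * v).
Proof.
move=> mB mB' mE EB B0 B'0 L1 BB' v0 fi; have L0 : 0 <= L by rewrite (le_trans ler01).
rewrite /size_bound; case: r r1 => [p| |] // p1; last first.
  apply: filterS => x fx; rewrite normcM normc_real indicE.
  apply: (@le_trans _ _ v); last by rewrite ler_peMl.
  case: (x \in E); rewrite ?normr1 ?mul1r// normr0 mul0r//.
have p0 : 0 < p by rewrite (lt_trans ltr01).
rewrite !power_mean_leP// ?mulr_ge0// => h.
apply: (@le_trans _ _ (\int[mu]_(x in B) (normc (f x) `^ p)%:E)%E).
  rewrite [leLHS]integral_mkcond [leRHS]integral_mkcond; apply: ge0_le_integral => //.
  - by move=> x _; apply: erestrict_ge0 => y _; rewrite lee_fin powR_ge0.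
  - apply/(measurable_restrictT _ mB').
    exact: (measurable_normc_powRS p (cintegrable_indicM mE fi)).
  - by apply/(measurable_restrictT _ mB); exact: (measurable_normc_powRS p fi).
  move=> x _; rewrite !patchE normcM normc_real indicE.
  have [/set_mem Ex|nEx] := boolP (x \in E); last first.
    rewrite normr0 mul0r powR0 ?gt_eqF//.
    have [xB'|xB'] := boolP (x \in B'); have [xB|xB] := boolP (x \in B);
      by rewrite lee_fin// powR_ge0.
  rewrite normr1 mul1r (mem_set (EB _ Ex)).
  by case: (x \in B') => //; rewrite lee_fin powR_ge0.
apply: le_trans h _; rewrite lee_fin powRM//.
apply: (@le_trans _ _ (L * mass B' * v `^ p)); first by rewrite ler_wpM2r// powR_ge0.
rewrite mulrA ler_wpM2r ?powR_ge0// mulrC ler_wpM2l ?mass_ge0//.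
by rewrite -[leLHS]powRr1//; apply: ler_powR => //; exact: ltW.
Qed.

Lemma cintegral_indicM A B f : measurable A -> measurable B ->
  cintegral mu B (fun x => (\1_A x : R)%:C%C * f x) = cintegral mu (B `&` A) f.
Proof.
move=> mA mB; rewrite /cintegral !Rintegral_mkcondr.
congr (_ +i* _)%C; apply: eq_Rintegral => x _; rewrite patchE ?ReMc ?ImMc /= indicE;
  by case: ifPn => _; rewrite ?mul1r !mul0r ?subr0 ?addr0.
Qed.

Definition unit_indic A : M -> R[i] := fun x => (\1_A x : R)%:C%C * ((mass A)^-1)%:C%C.

Lemma cintegrable_unit_indic A : measurable A -> cintegrable mu (unit_indic A).
Proof. by move=> mA; apply: cintegrable_indicM => //; exact: cintegrable_cst. Qed.

Lemma cintegral_unit_indic A B : measurable A -> measurable B -> A `<=` B -> 0 < mass A ->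
  cintegral mu B (unit_indic A) = 1.
Proof.
move=> mA mB AB A0; rewrite /unit_indic cintegral_indicM// setIidr// cintegral_cst//.
by rewrite -rmorphM/= divff ?gt_eqF.
Qed.

Lemma normc_unit_indic A x : normc (unit_indic A x) <= (mass A)^-1.
Proof.
rewrite /unit_indic normcM !normc_real [X in _ * X]ger0_norm ?invr_ge0 ?mass_ge0//.
rewrite indicE; case: (x \in A); rewrite ?normr1 ?mul1r// normr0 mul0r invr_ge0.
exact: mass_ge0.
Qed.

Lemma unit_indic_out A B x : A `<=` B -> ~ B x -> unit_indic A x = 0.
Proof.
move=> AB nBx; rewrite /unit_indic indicE memNset ?mul0r// => Ax.
by apply: nBx; exact: AB.
Qed.

Variable c : R.
Hypothesis c0 : 0 < c.

Lemma hardy1_normD f g : cintegrable mu f -> cintegrable mu g ->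
  (N c (fun x => f x + g x)%R <= N c f + N c g)%E.
Proof.
apply: normed_subadditive => //.
- exact: hardy1_norm0.
- exact: hardy1_norm_ge0.
- exact: hardy1_norm_series.
Qed.

(** An atom followed by null terms is a decomposition of itself. *)
Lemma hardy1_norm_atom a : atom_le mu c r a -> (N c a <= 1)%E.
Proof.
move=> ha; have ai := cintegrable_atom mufin ha.
pose l (k : nat) : R[i] := if k is 0%N then 1 else 0.
have ls : (\sum_(0 <= k <oo) (normc (l k))%:E = 1 :> \bar R)%E.
  rewrite (nneseries_split 0 1); last by move=> k _; rewrite lee_fin normc_ge0.
  rewrite big_nat1 eseries0 ?adde0 /l ?normc1//.
  by case=> // k _ _; rewrite normc0.
rewrite -ls; apply: (@hardy1_norm_le _ _ _ mu c r a l (fun=> a)).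
apply/(atomic_decompositionP mufin c r l (fun=> a) ai); split => //; first by rewrite ls ltry.
apply/cvgrPdist_lt => e e0; exists 1%N => // -[//|n] _ /=.
rewrite absint0 ?subrr ?normr0// => x.
by rewrite big_ord_recl /= mul1r big1 ?addr0 ?subrr// => k _; rewrite mul0r.
Qed.

(** Division by [K] turns [f] into an atom. *)
Lemma hardy1_norm_multiple x f (K : R) : 0 < K -> cintegrable mu f ->
  {ae mu, forall y, ~ ball x c y -> f y = 0} -> cintegral mu (ball x c) f = 0 ->
  size_bound (ball x c) f (K * (mass (ball x c))^-1) -> (N c f <= K%:E)%E.
Proof.
move=> K0 fi fB f0 fK.
have Kne : (K%:C)%C != 0 :> R[i] by rewrite eq_complex /= eqxx andbT gt_eqF.
pose a y := (K%:C)%C^-1 * f y.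
have ai : cintegrable mu a by exact: cintegrableZ.
have nK : normc (K%:C)%C^-1 = K^-1 by rewrite normcV normc_real gtr0_norm.
have ha : atom_le mu c r a.
  left; exists x, c; split; first by rewrite c0 lexx.
  apply/standard_atomP; split => //.
  - by apply: filterS fB => y hy /hy; rewrite /a => ->; rewrite mulr0.
  - by rewrite cintegralZ// f0 mulr0.
  - have := size_boundZ (K%:C)%C^-1 (measurable_metric_ball x c) fi fK.
    by rewrite nK mulKf// gt_eqF.
rewrite (_ : f = (fun y => (K%:C)%C * a y)); last first.
  by apply/funext => y; rewrite /a mulVKf.
apply: le_trans (hardy1_normZ_le mufin c r (K%:C)%C ai) _.
rewrite normc_real gtr0_norm// -[leRHS]mule1.
by apply: lee_wpmul2l; [rewrite lee_fin ltW|exact: hardy1_norm_atom].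
Qed.

(** Both normalized indicators have integral 1, so that their difference is a
    multiple of an atom. *)
Lemma hardy1_norm_unit_indicB x A (L : R) : measurable A -> A `<=` ball x c ->
  0 < mass A -> mass (ball x c) <= L * mass A -> 0 <= L ->
  (N c (fun y => unit_indic A y - unit_indic (ball x c) y)%R <= (L + 1)%:E)%E.
Proof.
move=> mA AB A0 BA L0; have B0 := ball_mass_gt0 x c0; have mB := measurable_metric_ball x c.
have uA := cintegrable_unit_indic mA; have uB := cintegrable_unit_indic mB.
apply: (@hardy1_norm_multiple x).
- by rewrite ltr_wpDl.
- exact: cintegrableB.
- by apply: aeW => y nB; rewrite !(unit_indic_out _ nB)// subrr.
- rewrite -[X in cintegral mu _ X](_ : (fun y => unit_indic A y + (-1) * unit_indic (ball x c) y) = _).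
    rewrite cintegralD//; last exact: cintegrableZ.
    by rewrite cintegralZ// !cintegral_unit_indic// mulN1r subrr.
  by apply/funext => y; rewrite mulN1r.
- apply: size_bound_sup => //.
  + by rewrite mulr_ge0 ?addr_ge0// invr_ge0 ltW.
  + exact: cintegrableB.
  + move=> y; apply: le_trans (le_normcD _ _) _; rewrite normcN mulrDl mul1r.
    apply: lerD; last exact: normc_unit_indic.
    apply: le_trans (normc_unit_indic _ _) _.
    by rewrite ler_pdivlMr// mulrC ler_pdivrMr.
Qed.

Variables (R0 beta b : R).
Hypothesis LD : locally_doubling mu.
Hypothesis AM : approx_midpoint M R0 beta.
Hypothesis Rc : R0 / (1 - beta) < c.
Hypothesis cb : c < b.

Lemma hardy1_norm_opp f : cintegrable mu f -> (N c (fun x => - f x)%R <= N c f)%E.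
Proof.
move=> fi; have := hardy1_normZ_le mufin c r (-1) fi.
rewrite normcN normc1 mul1e (_ : (fun x => -1 * f x) = (fun x => - f x))//.
by apply/funext => x; rewrite mulN1r.
Qed.

Lemma hardy1_norm_distC f g : cintegrable mu f -> cintegrable mu g ->
  (N c (fun x => f x - g x)%R <= N c (fun x => g x - f x)%R)%E.
Proof.
move=> fi gi; rewrite (_ : (fun x => f x - g x) = (fun x => - (g x - f x))).
  by apply: hardy1_norm_opp; exact: cintegrableB.
by apply/funext => x; rewrite opprB.
Qed.

Lemma hardy1_norm_triangle f g h : cintegrable mu f -> cintegrable mu g -> cintegrable mu h ->
  (N c (fun x => f x - h x)%R <= N c (fun x => f x - g x)%R + N c (fun x => g x - h x)%R)%E.
Proof.
move=> fi gi hi; rewrite (_ : (fun x => f x - h x) = (fun x => (f x - g x) + (g x - h x))).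
  by apply: hardy1_normD; exact: cintegrableB.
by apply/funext => x; rewrite subrKA.
Qed.

(** One step of a chain passes through the ball of radius [c / 2] about [x], which
    lies in both balls of radius [c]. *)
Lemma hardy1_norm_ball_shift : exists2 K : R, 0 <= K & forall x y, mdist x y <= b ->
  (N c (fun z => unit_indic (ball x c) z - unit_indic (ball y c) z)%R <= K%:E)%E.
Proof.
have [n chain] := chain_bound b AM Rc c0.
have [D D1 Dc] := ex_doubling_upto mufin LD c0.
have D0 : 0 <= D by rewrite (le_trans ler01).
exists (2 ^+ n * ((D + 1) + (D ^+ 2 + 1))).
  by rewrite mulr_ge0 ?exprn_ge0// !addr_ge0 ?exprn_ge0.
have ui x t : cintegrable mu (unit_indic (ball x t)).
  exact: cintegrable_unit_indic.
apply: (chain (fun x y => N c (fun z => unit_indic (ball x c) z - unit_indic (ball y c) z)%R)).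
- by rewrite !addr_ge0 ?exprn_ge0.
- by move=> x y z; exact: hardy1_norm_triangle.
move=> x y xy; have c20 : 0 < c / 2 by rewrite divr_gt0.
have m0 := ball_mass_gt0 x c20.
have near z : mdist z x <= c / 2 -> ball x (c / 2) `<=` ball z c.
  by move=> zx; apply: sub_ball; lra.
have d1 : mass (ball x c) <= D * mass (ball x (c / 2)).
  have := doubling_iter (k := 1) (t := c / 2) D1 Dc x c20.
  by rewrite !expr1 mulrCA divff// mulr1; apply; lra.
have d2 : mass (ball y c) <= D ^+ 2 * mass (ball x (c / 2)).
  apply: le_trans (doubling_iter (k := 2) D1 Dc x c20 _); last by rewrite expr2; lra.
  by apply: le_mass => //; apply: sub_ball; rewrite expr2; lra.
apply: le_trans (hardy1_norm_triangle (ui x c) (ui x (c / 2)) (ui y c)) _.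
rewrite EFinD; apply: leeD.
  apply: le_trans (hardy1_norm_distC _ _) _ => //.
  by apply: hardy1_norm_unit_indicB => //; apply: near; rewrite mdistxx ltW.
apply: hardy1_norm_unit_indicB => //; rewrite ?exprn_ge0//.
by apply: near; rewrite metric_sym.
Qed.

Lemma indicU_funE (E A : set M) f : (fun x => (\1_E x : R)%:C%C * f x) =
  (fun x => (\1_(E `&` A) x : R)%:C%C * f x + (\1_(E `\` A) x : R)%:C%C * f x).
Proof.
apply/funext => x; rewrite -mulrDl !indicE in_setI in_setD.
by case: (x \in E); case: (x \in A); rewrite /= ?addr0 ?add0r.
Qed.

Lemma cintegral_split (E A : set M) f : measurable E -> measurable A -> cintegrable mu f ->
  cintegral mu E f = cintegral mu (E `&` A) f + cintegral mu (E `\` A) f.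
Proof.
move=> mE mA fi; have mI := measurableI _ _ mE mA; have mD := measurableD mE mA.
rewrite -[E in LHS]setTI -cintegral_indicM// (indicU_funE E A) cintegralD//.
- by rewrite !cintegral_indicM// !setTI.
- exact: cintegrable_indicM.
- exact: cintegrable_indicM.
Qed.

(** An atom on a ball of radius at most [b] is cut along a cover of the ball by
    boundedly many balls of radius [c]; the mean of each piece is transported to the
    ball with the same centre as the atom. The total mass transported is the integral
    of the atom, which vanishes. *)
Lemma hardy1_norm_atom_le : exists2 K : R, 0 < K & forall a, atom_le mu b r a ->
  (N c a <= K%:E)%E.
Proof.
have b0 : 0 < b by apply: lt_trans cb.
have [k hk] := ex_pow_ge (2 * b) c0.
have kc0 : 0 < 2 ^+ k * c by rewrite mulr_gt0// exprn_gt0.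
have [D D1 Dk] := ex_doubling_upto mufin LD kc0.
have [L' L'1 Lb] := ex_doubling_upto mufin LD b0.
have [N0 net] := ex_net mufin LD ball_mass_gt0 c0 b0.
have [K2 K20 shift] := hardy1_norm_ball_shift.
pose L := D ^+ k; have L1 : 1 <= L by rewrite exprn_ege1.
pose K1 := L * L' + 1; have K10 : 0 < K1.
  by rewrite ltr_wpDl// mulr_ge0// ?(le_trans ler01).
exists (1 + (K1 + K2) * N0%:R).
  by rewrite ltr_pwDl// mulr_ge0// addr_ge0// ltW.
move=> a [[x [t [/andP[t0 tb] sa]]]|->]; last first.
  apply: (@le_trans _ _ 1%E); first by apply: hardy1_norm_atom; right.
  by rewrite lee_fin lerDl mulr_ge0// addr_ge0// ltW.
have [tc|ct] := leP t c.
  apply: (@le_trans _ _ 1%E); first by apply: hardy1_norm_atom; left; exists x, t; rewrite t0.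
  by rewrite lee_fin lerDl mulr_ge0// addr_ge0// ltW.
have a1 : absint setT a <= 1 by exact: standard_atom_absint_le1 sa.
have B0 := ball_mass_gt0 x t0; have mB := measurable_metric_ball x t.
have /standard_atomP[ai aB Ia sba] := sa.
pose chi y := unit_indic (ball y c).
have chi_i y : cintegrable mu (chi y) by exact: cintegrable_unit_indic.
have masses y : ball x t y -> mass (ball x t) <= L * mass (ball y c) /\
    mass (ball y c) <= L' * mass (ball x t).
  rewrite in_ballE => xy; split.
    apply: le_trans (doubling_iter D1 Dk y c0 (_ : 2 ^+ k * c <= _)); last by lra.
    by apply: le_mass => //; apply: sub_ball; rewrite metric_sym; lra.
  apply: le_trans (Lb x t _); last by rewrite t0.
  by apply: le_mass => //; apply: sub_ball; lra.
have I1 (E : set M) : measurable E -> normc (cintegral mu E a) <= 1.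
  move=> mE; apply: le_trans (normc_cintegral_le mE ai) _.
  by apply: le_trans a1; exact: absint_mono.
(* A piece of the atom, minus its mean carried by the ball [ball y c] that
   contains it, is a multiple of an atom. *)
have piece y E : ball x t y -> measurable E -> E `<=` ball x t -> E `<=` ball y c ->
    (N c (fun z => (\1_E z : R)%:C%C * a z - cintegral mu E a * chi y z)%R <= K1%:E)%E.
  move=> xy mE EB Ey; have [m1 m2] := masses y xy.
  have My := ball_mass_gt0 y c0; have mBy := measurable_metric_ball y c.
  have Ei := cintegrable_indicM mE ai.
  have Ci := cintegrableZ (- cintegral mu E a) (chi_i y).
  rewrite (_ : (fun z => (\1_E z : R)%:C%C * a z - cintegral mu E a * chi y z) =
    (fun z => (\1_E z : R)%:C%C * a z + (- cintegral mu E a) * chi y z)); last first.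
    by apply/funext => z; rewrite mulNr.
  apply: (@hardy1_norm_multiple y _ _ K10).
  - exact: cintegrableD.
  - apply: aeW => z nz; rewrite /chi (unit_indic_out _ nz)// mulr0 addr0 indicE memNset ?mul0r//.
    by move=> Ez; apply: nz; exact: Ey.
  - rewrite cintegralD// cintegralZ// cintegral_indicM// setIidr//.
    by rewrite cintegral_unit_indic// mulr1 subrr.
  rewrite /K1 mulrDl mul1r; apply: size_boundD => //.
    have iB0 : 0 <= (mass (ball x t))^-1 by rewrite invr_ge0 ltW.
    have := size_bound_restrict mB mBy mE EB B0 My L1 m1 iB0 ai sba.
    apply: size_bound_le; rewrite -mulrA ler_wpM2l ?(le_trans ler01)//.
    by rewrite ler_pdivlMr// mulrC ler_pdivrMr.
  apply: size_bound_sup => //; first by rewrite invr_ge0 ltW.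
  move=> z; rewrite normcM normcN -[leRHS]mul1r.
  by rewrite ler_pM ?normc_ge0 ?I1// normc_unit_indic.
have [s [sN _ sx cov]] := net x t (ltac:(by rewrite (ltW ct))).
(* The pieces are cut off one by one; each mean travels from its ball to the
   ball [ball x c]. *)
have cut : forall (s : seq M) (E : set M), measurable E -> E `<=` ball x t ->
    (forall z, E z -> exists2 y, y \in s & ball y c z) -> (forall y, y \in s -> ball x t y) ->
    (N c (fun z => (\1_E z : R)%:C%C * a z - cintegral mu E a * chi x z)%R <= ((K1 + K2) * (size s)%:R)%:E)%E.
  elim=> [|y s' IH] E mE EB Ecov sB.
    have -> : E = set0 by apply/seteqP; split => // z /Ecov[].
    rewrite mulr0 (_ : (fun z => _) = (fun=> 0)) ?hardy1_norm0//.
    apply/funext => z; rewrite /cintegral !Rintegral_set0 indic0 mul0r.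
    by rewrite [X in X * _](_ : _ = 0)// mul0r subr0.
  have xy : ball x t y by apply: sB; rewrite mem_head.
  have mBy := measurable_metric_ball y c.
  have mI := measurableI _ _ mE mBy; have mD := measurableD mE mBy.
  set I := cintegral mu (E `&` ball y c) a.
  set J := cintegral mu (E `\` ball y c) a.
  have f1i : cintegrable mu (fun z => (\1_(E `&` ball y c) z : R)%:C%C * a z - I * chi y z).
    by apply: cintegrableB; [exact: cintegrable_indicM|exact: cintegrableZ].
  have f2i : cintegrable mu (fun z => I * (chi y z - chi x z)).
    by apply: cintegrableZ; exact: cintegrableB.
  have f3i : cintegrable mu (fun z => (\1_(E `\` ball y c) z : R)%:C%C * a z - J * chi x z).
    by apply: cintegrableB; [exact: cintegrable_indicM|exact: cintegrableZ].
  rewrite (_ : (fun z => _) = (fun z =>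
    (((\1_(E `&` ball y c) z : R)%:C%C * a z - I * chi y z) + I * (chi y z - chi x z)) +
    ((\1_(E `\` ball y c) z : R)%:C%C * a z - J * chi x z))); last first.
    apply/funext => z; have := congr1 (fun F : M -> R[i] => F z) (indicU_funE E (ball y c) a).
    rewrite /= => ->; rewrite (cintegral_split mE mBy ai) -/I -/J; ring.
  apply: le_trans (hardy1_normD (cintegrableD f1i f2i) f3i) _.
  have -> : (K1 + K2) * (size (y :: s'))%:R = (K1 + K2) + (K1 + K2) * (size s')%:R.
    by rewrite /= -natr1 mulrDr mulr1 addrC.
  rewrite EFinD; apply: leeD; last first.
    apply: IH => //.
    - by move=> z [Ez _]; exact: EB.
    - move=> z [Ez nz]; have [y' + y'z] := Ecov z Ez.
      by rewrite inE => /predU1P[y'y|y's]; [case: nz; rewrite -y'y|exists y'].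
    - by move=> y' y's; apply: sB; rewrite inE y's orbT.
  apply: le_trans (hardy1_normD f1i f2i) _; rewrite EFinD; apply: leeD.
    by apply: piece => // z [] // Ez _; exact: EB.
  apply: le_trans (hardy1_normZ_le mufin c r I (cintegrableB (chi_i y) (chi_i x))) _.
  apply: (@le_trans _ _ (1%:E * K2%:E)%E); last by rewrite mul1e.
  apply: lee_pmul; rewrite ?lee_fin ?normc_ge0 ?hardy1_norm_ge0//.
    exact: I1.
  by apply: shift; move: xy; rewrite in_ballE metric_sym => /ltW/le_trans; apply.
have gi := cintegrable_indicM mB ai.
have := cut s _ mB (@subset_refl _ _) cov sx.
rewrite Ia (_ : (fun z => _) = (fun z => (\1_(ball x t) z : R)%:C%C * a z)); last first.
  by apply/funext => z; rewrite mul0r subr0.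
move=> h; apply: le_trans (hardy1_norm_ae mufin c r ai gi _) _; first exact: indicM_ae.
apply: le_trans h _; rewrite lee_fin -[leLHS]add0r lerD//.
by rewrite ler_wpM2l ?ler_nat// addr_ge0// ltW.
Qed.

Lemma hardy1_norm_scale : exists2 K : R, 0 < K & forall f, cintegrable mu f ->
  (N c f <= K%:E * N b f)%E.
Proof.
have [K K0 atomK] := hardy1_norm_atom_le; exists K => // f fi.
rewrite -lee_pdivrMl//; apply: hardy1_norm_ge => l u /(atomic_decompositionP mufin _ _ _ _ fi)[ua ls cv].
rewrite lee_pdivrMl// -nneseriesZl; last by move=> k _; rewrite lee_fin normc_ge0.
have ui k : cintegrable mu (u k) by exact: cintegrable_atom (ua k).
have hi k : cintegrable mu (fun x => l k * u k x) by exact: cintegrableZ.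
apply: le_trans (hardy1_norm_series mufin mu0 ball_mass_gt0 c r1 fi hi cv) _.
apply: lee_nneseries => k _; first by move=> _; exact: hardy1_norm_ge0.
apply: le_trans (hardy1_normZ_le mufin c r (l k) (ui k)) _.
by rewrite muleC; apply: lee_wpmul2r; rewrite ?lee_fin ?normc_ge0//; exact: atomK.
Qed.

Lemma hardy1_norm_mono f : cintegrable mu f -> (N b f <= N c f)%E.
Proof.
move=> fi; apply: hardy1_norm_ge => l u [ua ls cv].
apply: (@hardy1_norm_le _ _ _ mu b r f l u); split => // k.
case: (ua k) => [[x [t [/andP[t0 tc] sa]]]|->]; last by right.
by left; exists x, t; rewrite t0 (le_trans tc (ltW cb)).
Qed.

Lemma hardy1_id_isomorphism :
  id_banach_isomorphism mu (hardy1 mu c r) (N c) (hardy1 mu b r) (N b).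
Proof.
have [K K0 hK] := hardy1_norm_scale.
have eqV : hardy1 mu c r = hardy1 mu b r.
  rewrite (hardy1E mu c r) (hardy1E mu b r); apply/seteqP; split => f [fi h]; split => //.
    by apply: le_lt_trans h; exact: hardy1_norm_mono.
  by apply: le_lt_trans (hK f fi) _; apply: lte_mul_pinfty => //; rewrite lee_fin ltW.
split; [exact: hardy1_banach|exact: hardy1_banach|exact: eqV|].
exists (K + 1); first by rewrite addr_gt0.
have mulK1 f (v : \bar R) : (0 <= v)%E -> (v <= (K + 1)%:E * v)%E.
  by move=> v0; rewrite -[leLHS]mul1e; apply: lee_wpmul2r => //; rewrite lee_fin lerDr ltW.
move=> f [fi _]; split.
  apply: le_trans (hardy1_norm_mono fi) _; apply: mulK1 => //; exact: hardy1_norm_ge0.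
apply: le_trans (hK f fi) _; apply: lee_wpmul2r; first exact: hardy1_norm_ge0.
by rewrite lee_fin lerDl.
Qed.

End hardy_scales.

(** * Differentiation of integrals *)

Section differentiation.
Context {d : measure_display} {R : realType} {M : borelMetricType d R}.
Variable mu : {measure set M -> \bar R}.
Hypothesis mufin : (mu setT < +oo)%E.
Hypothesis LD : locally_doubling mu.
Hypothesis ball_mass_gt0 : forall (x : M) (t : R), 0 < t -> 0 < mass mu (ball x t).
Implicit Types (f g : M -> R[i]) (A U : set M) (s : seq M) (e : R).
Local Notation mass := (mass mu).
Local Notation absint := (absint mu).
Local Notation avg := (average mu).

(** The bounded overlap of the balls, integrated against [f]. *)
Lemma overlap_absint : exists2 N1 : R, 0 < N1 & forall e s f, 0 < e <= 1 ->
  pairwise (net_sep e) s -> cintegrable mu f ->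
  \sum_(y <- s) absint (ball y e) f <= N1 * absint setT f.
Proof.
have [N0 hN] := net_overlap mufin LD ball_mass_gt0 (ltr01 : (0 : R) < 1).
exists (N0%:R + 1); first by rewrite ltr_wpDl.
move=> e s f e01 sep fi; rewrite -lee_fin -sumEFin.
under eq_bigr => y _ do rewrite -(absintE (measurable_metric_ball y e) fi) integral_mkcond.
have mf := measurable_int _ (integrable_normc measurableT fi).
rewrite -ge0_integral_sum//; first last.
- by move=> y x _; apply: erestrict_ge0 => z _; rewrite lee_fin normc_ge0.
- by move=> y; apply/(measurable_restrictT _ (measurable_metric_ball y e)); exact: measurable_funTS mf.
rewrite EFinM -absintE// -ge0_integralZl_EFin//; first last.
- by move=> x _; rewrite lee_fin normc_ge0.
apply: ge0_le_integral => //.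
- move=> x _; apply: sume_ge0 => y _.
  by apply: erestrict_ge0 => z _; rewrite lee_fin normc_ge0.
- apply: emeasurable_sum => y.
  by apply/(measurable_restrictT _ (measurable_metric_ball y e)); exact: measurable_funTS mf.
- exact: measurable_funeM.
move=> x _.
have -> : (\sum_(y <- s) ((fun x => (normc (f x))%:E) \_ (ball y e)) x =
    ((count (fun y => `[< ball y e x >]) s)%:R * normc (f x))%:E)%E.
  elim: s {sep} => [|y s IH]; first by rewrite big_nil /= mul0r.
  rewrite big_cons IH /= patchE natrD mulrDl EFinD; congr (_ + _)%E.
  have -> : (x \in (ball y e : set M)) = `[< ball y e x >] by [].
  by case: asboolP => _; rewrite ?mul1r ?mul0r.
rewrite -EFinM lee_fin ler_wpM2r ?normc_ge0//.
by apply: le_trans (_ : N0%:R <= _); rewrite ?lerDl// ler_nat hN.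
Qed.

(** A weak form of the differentiation of integrals. Constants other than the
    averages are admitted, and the errors on all balls are added, to make the
    property stable under linear combinations and limits in L^1. *)
Definition small_osc f := forall h : R, 0 < h -> exists2 e0 : R, 0 < e0 &
  forall e, 0 < e < e0 -> forall s, pairwise (net_sep e) s -> exists a : M -> R[i],
    \sum_(y <- s) absint (ball y e) (fun x => f x - a y) <= h.

Lemma small_oscD f g : cintegrable mu f -> cintegrable mu g ->
  small_osc f -> small_osc g -> small_osc (fun x => f x + g x).
Proof.
move=> fi gi hf hg h h0; have h20 : 0 < h / 2 by rewrite divr_gt0.
have [e1 e10 H1] := hf _ h20; have [e2 e20 H2] := hg _ h20.
exists (Num.min e1 e2); first by rewrite lt_min e10.
move=> e; rewrite lt_min => /andP[e_gt0 /andP[ee1 ee2]] s sep.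
have [a1 ha1] := H1 e (ltac:(by rewrite e_gt0)) s sep.
have [a2 ha2] := H2 e (ltac:(by rewrite e_gt0)) s sep.
exists (fun y => a1 y + a2 y); rewrite (splitr h).
apply: le_trans (lerD ha1 ha2); rewrite -big_split; apply: ler_sum => y _.
have ci z := cintegrable_cst mufin z.
apply: le_trans (absintD _ (cintegrableB fi (ci (a1 y))) (cintegrableB gi (ci (a2 y)))) => //.
rewrite le_eqVlt; apply/orP; left; apply/eqP; apply: eq_Rintegral => x _.
by rewrite opprD addrACA.
Qed.

Lemma small_osc_cst0 : small_osc (fun=> 0).
Proof.
move=> h h0; exists 1 => // e _ s _; exists (fun=> 0).
by rewrite big1 ?ltW// => y _; rewrite absint0// => x; rewrite subrr.
Qed.

Lemma small_oscZ (z : R[i]) f : cintegrable mu f -> small_osc f -> small_osc (fun x => z * f x).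
Proof.
move=> fi hf h h0; have nz : 0 < normc z + 1 by rewrite ltr_wpDl ?normc_ge0.
have [e1 e10 H1] := hf _ (divr_gt0 h0 nz); exists e1 => // e ee1 s sep.
have [a ha] := H1 e ee1 s sep; exists (fun y => z * a y).
apply: (@le_trans _ _ ((normc z + 1) * \sum_(y <- s) absint (ball y e) (fun x => f x - a y))).
  rewrite big_distrr /=; apply: ler_sum => y _.
  have fai := cintegrableB fi (cintegrable_cst mufin (a y)).
  apply: (@le_trans _ _ (normc z * absint (ball y e) (fun x => f x - a y))).
    rewrite -absintZ//; rewrite le_eqVlt; apply/orP; left; apply/eqP.
    by apply: eq_Rintegral => x _; rewrite mulrBr.
  by rewrite ler_wpM2r ?absint_ge0// lerDl.
by rewrite mulrC -ler_pdivlMr.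
Qed.

Lemma small_osc_sum (I : Type) (s : seq I) (F : I -> M -> R[i]) :
  (forall i, cintegrable mu (F i)) -> (forall i, small_osc (F i)) ->
  small_osc (fun x => \sum_(i <- s) F i x).
Proof.
move=> Fi FT; elim: s => [|i s IH].
  rewrite (_ : (fun x => _) = (fun=> 0)); first exact: small_osc_cst0.
  by apply/funext => x; rewrite big_nil.
rewrite (_ : (fun x => _) = (fun x => F i x + \sum_(i <- s) F i x)).
  by apply: small_oscD => //; exact: cintegrable_sum.
by apply/funext => x; rewrite big_cons.
Qed.

(** By bounded overlap, replacing [f] by [g] on all balls changes the sum of the
    errors by at most a multiple of the distance from [f] to [g] in L^1. *)
Lemma small_osc_closed f : cintegrable mu f ->
  (forall h : R, 0 < h -> exists g, [/\ cintegrable mu g, small_osc g &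
     absint setT (fun x => f x - g x) <= h]) ->
  small_osc f.
Proof.
move=> fi H h h0; have [N1 N10 ov] := overlap_absint.
have h20 : 0 < h / 2 by rewrite divr_gt0.
have [g [gi gT fg]] := H (h / 2 / N1) (divr_gt0 h20 N10).
have [e1 e10 H1] := gT _ h20; exists (Num.min 1 e1); first by rewrite lt_min ltr01.
move=> e; rewrite lt_min => /andP[e_gt0 /andP[e1_ ee1]] s sep.
have [a ha] := H1 e (ltac:(by rewrite e_gt0)) s sep.
exists a; rewrite (splitr h).
apply: (@le_trans _ _ (\sum_(y <- s) (absint (ball y e) (fun x => f x - g x) +
    absint (ball y e) (fun x => g x - a y)))).
  by apply: ler_sum => y _; apply: absint_triangle => //; exact: cintegrable_cst.
rewrite big_split /=; apply: lerD => //.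
apply: le_trans (ov e s _ _ sep (cintegrableB fi gi)) _; first by rewrite e_gt0 ltW.
by rewrite mulrC -ler_pdivlMr.
Qed.

Lemma absint_indicB A B : measurable A -> measurable B -> A `<=` B ->
  absint setT (fun x => (\1_B x : R)%:C%C - (\1_A x : R)%:C%C) = mass (B `\` A).
Proof.
move=> mA mB AB; rewrite -[RHS]mul1r -(@normc1 R) -absint_cst; last exact: measurableD.
rewrite -[X in _ = absint X _](setTI (B `\` A)) -absint_indicM//; last exact: measurableD.
apply: eq_Rintegral => x _; congr normc; rewrite mulr1 !indicE in_setD.
case: (boolP (x \in A)) => xA; last by rewrite andbT subr0.
by rewrite (mem_set (AB _ (set_mem xA))) subrr.
Qed.

(** The indicator of [U] fails to be constant only on the balls that meet both [U]
    and its complement; such a ball meets [U] in points close to the complement. The sets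
    of points of [U] at distance less than [1 / n] from the complement decrease
    to the empty set, so their measure tends to 0. *)
Lemma small_osc_open U : open U -> small_osc (fun x => (\1_U x : R)%:C%C).
Proof.
move=> Uo h h0; have [N1 N10 ov] := overlap_absint.
pose W (n : nat) := \bigcup_(z in ~` U) ball z (n.+1%:R^-1 : R).
have Wo n : open (W n) by apply: bigcup_open => z _; exact: open_metric_ball.
pose V n := U `&` W n.
have mU := measurable_open Uo.
have mV n : measurable (V n) by apply: measurableI => //; exact: measurable_open.
have Vlim : (fun n => mu (V n)) @ \oo --> mu (\bigcap_n V n).
  apply: nonincreasing_cvg_mu => //.
  - by rewrite ltey_eq mu_fin_num.
  - exact: bigcap_measurable.
  - apply/nonincreasing_seqP => n; apply/subsetPset => x [Ux [z nUz zx]]; split => //.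
    exists z => //; apply: le_ball zx.
    by rewrite lef_pV2 ?posrE ?ltr0n// ler_nat.
have V0 : \bigcap_n V n = set0.
  apply/seteqP; split => // x Vx; have [Ux _] := Vx 0%N I.
  have /nbhs_ballP[r /= r0 rU] : nbhs x U by apply: open_nbhs_nbhs.
  have [n hn] : exists n, n.+1%:R^-1 < r.
    exists (Num.bound r^-1); rewrite -[ltRHS]invrK ltf_pV2 ?posrE ?invr_gt0//.
    have r'0 : 0 <= r^-1 by rewrite invr_ge0 ltW.
    by apply: lt_le_trans (archi_boundP r'0) _; rewrite ler_nat.
  have [_ [z nUz zx]] := Vx n I; apply: nUz; apply: rU.
  by apply: ball_sym; apply: le_ball zx; exact: ltW.
rewrite V0 measure0 in Vlim.
have [n /(_ n (leqnn n)) hn] := cvge0_ex_le Vlim (divr_gt0 h0 N10).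
have d0 : 0 < n.+1%:R^-1 / 2 :> R by rewrite divr_gt0// invr_gt0.
exists (Num.min 1 (n.+1%:R^-1 / 2)); first by rewrite lt_min ltr01.
move=> e; rewrite lt_min => /andP[e0 /andP[e1 ed]] s sep.
exists (fun y => if `[< ball y e `<=` U >] then 1 else 0).
have Vi : cintegrable mu (fun x => (\1_(V n) x : R)%:C%C) by exact: cintegrable_indic.
have Ui : cintegrable mu (fun x => (\1_U x : R)%:C%C) by exact: cintegrable_indic.
apply: (@le_trans _ _ (\sum_(y <- s) absint (ball y e) (fun x => (\1_(V n) x : R)%:C%C))).
  apply: ler_sum => y _; apply: le_absint => //.
    by apply: cintegrableB => //; exact: cintegrable_cst.
  move=> x yx; case: asboolP => [yU|nyU].
    by rewrite indicE (mem_set (yU _ yx)) subrr normc0 normc_ge0.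
  rewrite subr0 !normc_real !indicE in_setI.
  case: (boolP (x \in U)) => /= xU; last by rewrite normr0.
  suff -> : x \in W n by [].
  apply: mem_set; have [z [yz nUz]] : exists z, ball y e z /\ ~ U z.
    apply: contrapT => nz; apply: nyU => z yz; apply: contrapT => nUz.
    by apply: nz; exists z.
  exists z => //; rewrite in_ballE; apply: le_lt_trans (metric_triangle z y x) _.
  rewrite (splitr n.+1%:R^-1); apply: ltrD; last by rewrite -in_ballE; apply: le_ball yx; exact: ltW.
  by rewrite metric_sym -in_ballE; apply: le_ball yz; exact: ltW.
apply: le_trans (ov e s _ _ sep Vi) _; first by rewrite e0 ltW.
rewrite mulrC -ler_pdivlMr//; apply: le_trans (_ : mass (V n) <= _).
  have := absint_indicB (@measurable0 _ M) (mV n) (@sub0set _ (V n)).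
  rewrite setD0 => <-; rewrite le_eqVlt; apply/orP; left; apply/eqP.
  by apply: eq_Rintegral => x _; rewrite indic0 subr0.
by rewrite -lee_fin -massE.
Qed.

(** The sets whose indicator has the property form a lambda-system, and the
    open sets form a pi-system. *)
Lemma small_osc_indic A : measurable A -> small_osc (fun x => (\1_A x : R)%:C%C).
Proof.
move=> mA0.
pose H := [set A : set M | measurable A /\ small_osc (fun x => (\1_A x : R)%:C%C)].
suff HM : (measurable : set (set M)) `<=` H by have [] := HM A mA0.
rewrite {1}measurable_borelE; apply: lambda_system_subset.
- by move=> U V Uo Vo; exact: openI.
- split.
  + by [].
  + by split=> //; apply: small_osc_open; exact: openT.
  + move=> B A' AB [mB HB] [mA HA]; split; first exact: measurableD.
    rewrite (_ : (fun x => _) = (fun x => (\1_B x : R)%:C%C + (-1) * (\1_A' x : R)%:C%C)).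
      apply: small_oscD => //; first exact: cintegrable_indic.
        by apply: cintegrableZ; exact: cintegrable_indic.
      by apply: small_oscZ => //; exact: cintegrable_indic.
    apply/funext => x; rewrite !indicE in_setD mulN1r.
    case: (boolP (x \in A')) => xA; last by rewrite andbT subr0.
    by rewrite (mem_set (AB _ (set_mem xA))) subrr.
  + move=> F ndF HF; have mF n : measurable (F n) by have [] := HF n.
    have mUF : measurable (\bigcup_n F n) by exact: bigcup_measurable.
    split => //; apply: small_osc_closed; first exact: cintegrable_indic.
    move=> h h0.
    have cvF : (fun n => mu (F n)) @ \oo --> mu (\bigcup_n F n) by exact: nondecreasing_cvg_mu.
    have [n hn] : exists n, mass (\bigcup_n F n `\` F n) <= h.
      rewrite massE// in cvF.
      have : fine \o (fun n => mu (F n)) @ \oo --> mass (\bigcup_n F n) by apply: fine_cvg; exact: cvF.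
      move=> /cvgrPdist_le/(_ h h0)[n _ /(_ n (leqnn n))] /= hn.
      exists n; apply: le_trans hn; apply: le_trans (ler_norm _).
      have FU : F n `<=` \bigcup_n F n by exact: bigcup_sup.
      rewrite /mass measureD//; last by rewrite ltey_eq mu_fin_num.
      rewrite setIidr// fineB ?mu_fin_num//.
    exists (fun x => (\1_(F n) x : R)%:C%C); split.
    - exact: cintegrable_indic.
    - by have [] := HF n.
    - by rewrite absint_indicB//; exact: bigcup_sup.
- by move=> U Uo; split; [exact: measurable_open|exact: small_osc_open].
- by [].
Qed.

Import HBSimple.

(** Simple functions are dense in L^1. *)
Lemma small_osc_real (f : M -> R) : mu.-integrable setT (EFin \o f) ->
  small_osc (fun x => (f x)%:C%C).
Proof.
move=> fi; have Cfi : cintegrable mu (fun x => (f x)%:C%C).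
  by split => //=; exact: (cintegrable_cst mufin 0).2.
apply: small_osc_closed => // h h0.
have [g_ [gi _ gL]] := approximation_sfun_integrable measurableT fi.
have [n /(_ n (leqnn n)) hn] := cvge0_ex_le gL h0.
have Cgi : cintegrable mu (fun x => (g_ n x)%:C%C).
  by split => //=; [exact: gi|exact: (cintegrable_cst mufin 0).2].
exists (fun x => (g_ n x)%:C%C); split => //.
  rewrite (_ : (fun x => _) = (fun x => \sum_(v <- finmap.enum_fset (fset_set (range (g_ n))))
     (v%:C)%C * (\1_(g_ n @^-1` [set v]) x : R)%:C%C)).
    apply: small_osc_sum => v.
      by apply: cintegrableZ; exact: cintegrable_indic.
    by apply: small_oscZ; [exact: cintegrable_indic|exact: small_osc_indic].
  apply/funext => x; rewrite [in LHS]fimfunE fsbig_finite//=.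
  rewrite (big_morph (@real_complex R) (id1 := 0) (op1 := +%R)) //; last exact: rmorphD.
  by apply: eq_bigr => v _; rewrite rmorphM.
rewrite -lee_fin -absintE//; last exact: cintegrableB.
apply: le_trans hn; rewrite le_eqVlt; apply/orP; left; apply/eqP.
by apply: eq_integral => x _; rewrite -(rmorphB (real_complex R)) normc_real.
Qed.

Lemma small_osc_cintegrable f : cintegrable mu f -> small_osc f.
Proof.
move=> [fR fI].
rewrite (_ : f = (fun x => (complex.Re (f x))%:C%C + 'i%C * (complex.Im (f x))%:C%C)).
  have iR : cintegrable mu (fun x => (complex.Re (f x))%:C%C).
    by split => //=; exact: (cintegrable_cst mufin 0).2.
  have iI : cintegrable mu (fun x => (complex.Im (f x))%:C%C).
    by split => //=; exact: (cintegrable_cst mufin 0).2.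
  apply: small_oscD => //; first exact: cintegrableZ.
    exact: small_osc_real.
  by apply: small_oscZ => //; exact: small_osc_real.
by apply/funext => x; exact: complexE.
Qed.

(** The average is, up to a factor 2, the best constant on a ball. *)
Lemma sum_osc_small f : cintegrable mu f -> forall h : R, 0 < h ->
  exists2 e0 : R, 0 < e0 & forall e, 0 < e < e0 -> forall s, pairwise (net_sep e) s ->
    \sum_(y <- s) absint (ball y e) (fun x => f x - avg (ball y e) f) <= h.
Proof.
move=> fi h h0; have [e0 e00 H] := small_osc_cintegrable fi (divr_gt0 h0 (ltr0n R 2)).
exists e0 => // e ee0 s sep; have [a ha] := H e ee0 s sep.
have e_gt0 : 0 < e by have /andP[] := ee0.
apply: (@le_trans _ _ (2 * \sum_(y <- s) absint (ball y e) (fun x => f x - a y))); last first.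
  by rewrite mulrC -ler_pdivlMr.
rewrite big_distrr /=; apply: ler_sum => y _.
have mB := measurable_metric_ball y e; have B0 := ball_mass_gt0 y e_gt0.
have ci z := cintegrable_cst mufin z.
apply: le_trans (absint_triangle mB fi (ci (a y)) (ci (avg (ball y e) f))) _.
rewrite mulr_natl mulr2n lerD2l absint_cst// normc_distC.
rewrite mulrC -ler_pdivlMl// mulrC; apply: le_trans (average_dist_le mufin (a y) mB B0 fi) _.
by rewrite mulrC.
Qed.

End differentiation.

(** * The John--Nirenberg inequality *)

(** The family is built by decreasing scale, and is completed to a maximal one at
    each scale; an element that has not been selected is then excluded by one
    selected at its own scale or before. *)
Lemma greedy_selection (T : eqType) (P : T -> Prop) (r : rel T) (sc : T -> nat) (m n : nat) :
  (forall p, P p -> (sc p <= m)%N) ->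
  (forall s, pairwise r s -> (forall p, p \in s -> P p) -> (size s <= n)%N) ->
  exists s, [/\ pairwise r s, forall p, p \in s -> P p &
    forall p, P p -> exists2 p', p' \in s & (sc p <= sc p')%N && ~~ r p p'].
Proof.
move=> Pm Pn.
suff H j : exists s, [/\ pairwise r s, forall p, p \in s -> P p /\ (m <= sc p + j)%N &
    forall p, P p -> (m <= sc p + j)%N ->
      exists2 p', p' \in s & (sc p <= sc p')%N && ~~ r p p'].
  have [s [rs sP sm]] := H m; exists s; split => //; first by move=> p /sP[].
  by move=> p Pp; apply: sm => //; exact: leq_addl.
elim: j => [|j [s0 [r0 s0P s0m]]].
- pose Q s := pairwise r s /\ forall p, p \in s -> P p /\ (m <= sc p + 0)%N.
  have [||s [rs sP] smax] := @maximal_seq _ Q n; first by [].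
    by move=> s [rs sP]; apply: Pn => // p /sP[].
  exists s; split => // p Pp pm.
  have [/allP h|/allPn[p' p's rpp']] := boolP (all (r p) s).
    exfalso; apply: (smax p); split; first by rewrite /= rs andbT; apply/allP.
    by move=> p'; rewrite inE => /predU1P[->|/sP].
  exists p' => //; rewrite rpp' andbT; have [_] := sP _ p's; rewrite addn0.
  exact: leq_trans (Pm _ Pp).
pose Q s := pairwise r (s ++ s0) /\ forall p, p \in s -> P p /\ (m = sc p + j.+1)%N.
have [||s [rs sP] smax] := @maximal_seq _ Q n; first by [].
  move=> s [rs sP]; apply: (@leq_trans (size (s ++ s0))); first by rewrite size_cat leq_addr.
  by apply: Pn => // p; rewrite mem_cat => /orP[/sP[]|/s0P[]].
exists (s ++ s0); split => //.
  move=> p; rewrite mem_cat => /orP[/sP[Pp ->]|/s0P[Pp pm]]; split => //.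
  by rewrite addnS ltnW.
move=> p Pp; rewrite leq_eqVlt addnS ltnS => /orP[/eqP pm|pm]; last first.
  have [p' p's h] := s0m _ Pp pm; exists p' => //.
  by rewrite mem_cat p's orbT.
have [/allP h|/allPn[p' p's rpp']] := boolP (all (r p) (s ++ s0)).
  exfalso; apply: (smax p); split; first by rewrite /= rs andbT; apply/allP.
  by move=> p'; rewrite inE => /predU1P[->|/sP//]; rewrite addnS.
exists p' => //; rewrite rpp' andbT; move: p's; rewrite mem_cat => /orP[/sP[_ ]|/s0P[_]].
  by rewrite pm addnS => -[/eqP]; rewrite eqn_add2r => /eqP ->.
rewrite pm -addnS => h; rewrite -(leq_add2r j); apply: leq_trans h.
by rewrite addnS.
Qed.

Section john_nirenberg.
Context {d : measure_display} {R : realType} {M : borelMetricType d R}.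
Variable mu : {measure set M -> \bar R}.
Hypothesis mufin : (mu setT < +oo)%E.
Hypothesis ball_mass_gt0 : forall (x : M) (t : R), 0 < t -> 0 < mass mu (ball x t).
Local Notation mass := (mass mu).
Local Notation absint := (absint mu).
Local Notation avg := (average mu).

Lemma measurable_normc_gt (A : set M) (g : M -> R[i]) (L : R) : measurable A ->
  cintegrable mu g -> measurable [set z | A z /\ L < normc (g z)].
Proof.
move=> mA gi.
rewrite (_ : [set z | _] = A `&` (fun z => normc (g z)) @^-1` `]L, +oo[%classic).
  by apply: (measurable_funTS (measurable_normcT gi)) => //; exact: measurable_itv.
by apply/seteqP; split => z /=; rewrite in_itv /= andbT.
Qed.

Lemma chebyshev (A : set M) (g : M -> R[i]) (L : R) : measurable A -> cintegrable mu g ->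
  0 <= L -> L * mass [set z | A z /\ L < normc (g z)] <= absint A g.
Proof.
move=> mA gi L0; set G := [set z | _].
have mG : measurable G by exact: measurable_normc_gt.
have GA : G `<=` A by move=> z [].
apply: le_trans (absint_mono mG mA GA gi).
rewrite -(ger0_norm L0) -normc_real -absint_cst//.
apply: le_absint => //; first exact: cintegrable_cst.
by move=> z [_ /ltW]; rewrite normc_real ger0_norm.
Qed.

Lemma mass_bigsetU (T : Type) (s : seq T) (E : T -> set M) : (forall p, measurable (E p)) ->
  mass (\big[setU/set0]_(p <- s) E p) <= \sum_(p <- s) mass (E p).
Proof.
move=> mE; elim: s => [|p s IH]; first by rewrite !big_nil /mass measure0.
rewrite !big_cons; apply: le_trans (lerD (lexx _) IH).
have mU : measurable (\big[setU/set0]_(p <- s) E p) by exact: bigsetU_measurable.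
rewrite -lee_fin EFinD -!massE//; last exact: measurableU.
exact: measureU2.
Qed.

Variables (D b : R).
Hypothesis D1 : 1 <= D.
Hypothesis Db : doubling_upto mu D (4 * b).
Variables (f : M -> R[i]) (N : R).
Hypothesis fi : cintegrable mu f.
Hypothesis N0 : 0 < N.
Hypothesis fN : forall z t, 0 < t <= 4 * b ->
  absint (ball z t) (fun x => f x - avg (ball z t) f) <= mass (ball z t) * N.

(* The stopping threshold. The oscillation about the average over a ball [B] has
   integral at most [2 * D ^+ 2 * N * mass B] on the double of [B]; division by the
   threshold bounds the mass of the stopping balls, and doubling these costs
   another factor [D]. The result is [mass B / 2]. *)
Local Notation L := (4 * D ^+ 3 * N).

Let D0 : 0 < D. Proof. exact: lt_le_trans D1. Qed.

Let L0 : 0 < L. Proof. by rewrite !mulr_gt0// exprn_gt0. Qed.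

Let DNL : D ^+ 2 * N + D * N <= L.
Proof.
rewrite -mulrDl ler_pM2r//.
have h1 : D <= D ^+ 2 by rewrite expr2 ler_peMl// ltW.
have h2 : D ^+ 2 <= D ^+ 3 by rewrite [leRHS]exprS ler_peMl// exprn_ge0// ltW.
have h3 : 0 < D ^+ 3 by rewrite exprn_gt0.
lra.
Qed.

Let average_double x t : 0 < t <= 2 * b ->
  normc (avg (ball x t) f - avg (ball x (2 * t)) f) <= D * N.
Proof.
move=> /andP[t0 tb].
apply: (average_nested mufin (A := ball x t) (B := ball x (2 * t))) => //.
- by apply: sub_ball; rewrite mdistxx; lra.
- exact: ball_mass_gt0.
- by apply: Db; rewrite t0; lra.
- exact: ltW.
- by apply: fN; lra.
Qed.

(** Both averages are compared with the average over [ball x (2 * t)]. *)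
Lemma average_same_radius x y t : 0 < t <= 2 * b -> mdist x y <= t ->
  normc (avg (ball y t) f - avg (ball x t) f) <= L.
Proof.
move=> /andP[t0 tb] xy.
apply: le_trans (normc_triangle _ (avg (ball x (2 * t)) f) _) _.
apply: le_trans DNL; apply: lerD; last by rewrite normc_distC average_double ?t0.
apply: (average_nested mufin (A := ball y t) (B := ball x (2 * t))) => //.
- by apply: sub_ball; lra.
- exact: ball_mass_gt0.
- apply: le_trans (doubling_iter D1 Db y t0 _ (k := 2)); last by rewrite expr2; lra.
  by apply: le_mass => //; apply: sub_ball; rewrite expr2 metric_sym; lra.
- exact: ltW.
- by apply: fN; lra.
Qed.

Variable e : R.
Hypothesis e0 : 0 < e.
Local Notation rad k := (2 ^+ k * e).

Let rad0 k : 0 < rad k. Proof. by rewrite mulr_gt0// exprn_gt0. Qed.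

Let le_rad j k : (j <= k)%N -> rad j <= rad k.
Proof. by move=> jk; rewrite ler_pM2r// ler_weXn2l// ler1n. Qed.

(** A ball is stopped when its average is far from that of [B] while the average
    over its double is not. Chebyshev's inequality bounds the measure of disjoint
    stopping balls, and a family selected greedily has doubles that cover the points
    where the average at scale [e] is far. *)
Lemma calderon_zygmund x m : rad m <= b -> exists s : seq (M * nat),
  [/\ forall p, p \in s -> (p.2 < m)%N,
      \sum_(p <- s) mass (ball p.1 (rad p.2.+1)) <= 2^-1 * mass (ball x (rad m)),
      forall p, p \in s ->
        normc (avg (ball p.1 (rad p.2.+1)) f - avg (ball x (rad m)) f) <= L &
      forall z, ball x (rad m) z ->
        L < normc (avg (ball z e) f - avg (ball x (rad m)) f) ->
        exists2 p, p \in s & ball p.1 (rad p.2.+1) z].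
Proof.
move=> mb; set B := ball x (rad m).
have b0 : 0 < b := lt_le_trans (rad0 m) mb.
pose dev y k := normc (avg (ball y (rad k)) f - avg B f).
pose bad (p : M * nat) := [/\ B p.1, (p.2 < m)%N, L < dev p.1 p.2 & dev p.1 p.2.+1 <= L].
pose B_ (p : M * nat) := (p.1, rad p.2).
pose sep (p p' : M * nat) := separated (B_ p) (B_ p').
have [||s [seps sbad scov]] := @greedy_selection _ bad sep snd m (Num.truncn (D ^+ m.+2)).
- by move=> p [_ /ltnW].
- move=> s seps sbad; rewrite -(size_map B_) truncn_ge_nat; last by rewrite exprn_ge0// ltW.
  apply: (packing mufin D1 Db ball_mass_gt0 (x := x) (t := rad m) (rho := e)) => //.
  + by rewrite !exprS; have := rad0 m; lra.
  + by rewrite !exprS; lra.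
  + by rewrite pairwise_map.
  + move=> _ /mapP[p /sbad[xp pm _ _] ->]; split => //=.
    by rewrite le_rad ?(ltnW pm)// andbT -{1}[e]mul1r -(expr0 2) le_rad.
exists s; split.
- by move=> p /sbad[].
- have gi : cintegrable mu (fun y => f y - avg B f) by exact: cintegrable_osc.
  have mB2 := measurable_metric_ball x (rad m.+1).
  have subB p : p \in map B_ s -> ball_of p `<=` ball x (rad m.+1).
    move=> /mapP[p' /sbad[]]; rewrite /B in_ballE => xp pm _ _ ->; apply: sub_ball => /=.
    by have := le_rad (ltnW pm); rewrite exprS; lra.
  have seps' : pairwise separated (map B_ s) by rewrite pairwise_map.
  have tot : L * \sum_(p <- map B_ s) mass (ball_of p) <= absint (ball x (rad m.+1)) (fun y => f y - avg B f).
    apply: (le_trans _ (sum_absint_separated mB2 gi seps' subB)).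
    rewrite big_distrr /= !big_map big_seq [leRHS]big_seq; apply: ler_sum => p /sbad[_ _ Lp _].
    have mp := measurable_metric_ball p.1 (rad p.2); have p0 := ball_mass_gt0 p.1 (rad0 p.2).
    have := average_dist_le mufin (avg B f) mp p0 fi.
    rewrite ler_pdivlMl// mulrC => h; apply: le_trans h.
    by rewrite ler_pM2r// ltW.
  have B2B : mass (ball x (rad m.+1)) <= D * mass B.
    by rewrite exprS -mulrA; apply: Db; rewrite rad0; lra.
  have tot2 : absint (ball x (rad m.+1)) (fun y => f y - avg B f) <= 2 * D ^+ 2 * N * mass B.
    have ci z := cintegrable_cst mufin z.
    apply: le_trans (absint_triangle mB2 fi (ci (avg (ball x (rad m.+1)) f)) (ci (avg B f))) _.
    apply: (@le_trans _ _ (mass (ball x (rad m.+1)) * N + D * N * mass (ball x (rad m.+1)))).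
      apply: lerD; first by apply: fN; rewrite rad0 exprS; lra.
      rewrite absint_cst// ler_wpM2r ?mass_ge0// normc_distC exprS -mulrA average_double// rad0.
      by lra.
    apply: (@le_trans _ _ (2 * D * N * mass (ball x (rad m.+1)))).
      have : 1 * (N * mass (ball x (rad m.+1))) <= D * (N * mass (ball x (rad m.+1))).
        by rewrite ler_wpM2r// mulr_ge0 ?mass_ge0// ltW.
      by lra.
    have : 2 * D * N * mass (ball x (rad m.+1)) <= 2 * D * N * (D * mass B).
      by rewrite ler_wpM2l// !mulr_ge0 ?ltW.
    by move/le_trans; apply; rewrite le_eqVlt; apply/orP; left; apply/eqP; ring.
  rewrite -(ler_pM2l L0).
  apply: (@le_trans _ _ (L * (D * \sum_(p <- map B_ s) mass (ball_of p)))).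
    rewrite ler_pM2l// big_distrr /= big_map big_seq [leRHS]big_seq.
    apply: ler_sum => p /sbad[_ pm _ _]; rewrite exprS -mulrA; apply: Db.
    by rewrite rad0 /=; have := le_rad (ltnW pm); lra.
  rewrite mulrCA; apply: le_trans (ler_wpM2l (ltW D0) (le_trans tot tot2)) _.
  by rewrite le_eqVlt; apply/orP; left; apply/eqP; field.
- by move=> p /sbad[].
- move=> z xz Lz.
  have exk : exists k, dev z k <= L.
    exists m; apply: average_same_radius; first by rewrite rad0; lra.
    by apply/ltW; rewrite -in_ballE.
  have devm : dev z m <= L.
    apply: average_same_radius; first by rewrite rad0; lra.
    by apply/ltW; rewrite -in_ballE.
  (* At the scale before the smallest one where the average is close to that of
     [B], the ball about [z] is stopped. *)
  case: (ex_minnP exk) => -[|k] devk kmin.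
    by move: devk; rewrite /dev expr0 mul1r leNgt Lz.
  have km : (k < m)%N by exact: kmin devm.
  have badz : bad (z, k).
    split => //=; rewrite ltNge; apply/negP => /kmin; by rewrite ltnn.
  have [p ps /andP[kp nsep]] := scov _ badz.
  exists p => //; rewrite in_ballE metric_sym; move: nsep.
  rewrite /sep /separated -ltNge /= => h; apply: lt_le_trans h _.
  by rewrite [in leRHS]exprS; have := le_rad kp; rewrite /=; lra.
Qed.

(** Iterating the decomposition halves the measure each time the threshold
    increases by [L]. *)
Lemma averages_exp_decay j x m : rad m <= b -> exists E : set M,
  [/\ measurable E, mass E <= 2^-1 ^+ j * mass (ball x (rad m)) &
    forall z, ball x (rad m) z ->
      j%:R * L < normc (avg (ball z e) f - avg (ball x (rad m)) f) -> E z].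
Proof.
elim: j x m => [|j IH] x m mb.
  by exists (ball x (rad m)); split => //; rewrite expr0 mul1r.
have [s [sm smass sL scov]] := calderon_zygmund x mb.
have /choice[E hE] : forall p : M * nat, exists E : set M, measurable E /\ (p \in s ->
    mass E <= 2^-1 ^+ j * mass (ball p.1 (rad p.2.+1)) /\
    forall z, ball p.1 (rad p.2.+1) z ->
      j%:R * L < normc (avg (ball z e) f - avg (ball p.1 (rad p.2.+1)) f) -> E z).
  move=> p; have [ps|ps] := boolP (p \in s); last by exists set0.
  have [E [mE Em Ej]] := IH p.1 p.2.+1 (le_trans (le_rad (sm _ ps)) mb).
  by exists E; split.
exists (\big[setU/set0]_(p <- s) E p); split.
- by apply: bigsetU_measurable => p _; have [] := hE p.
- apply: le_trans (mass_bigsetU s (fun p => (hE p).1)) _.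
  apply: (@le_trans _ _ (2^-1 ^+ j * \sum_(p <- s) mass (ball p.1 (rad p.2.+1)))).
    rewrite big_distrr /= big_seq [leRHS]big_seq; apply: ler_sum => p ps.
    by have [_ /(_ ps)[]] := hE p.
  by rewrite exprSr -mulrA ler_wpM2l// exprn_ge0// invr_ge0.
- move=> z xz jz.
  have [|p ps pz] := scov z xz.
    by apply: le_lt_trans jz; rewrite ler_peMl ?(ltW L0)// ler1n.
  rewrite -bigcup_seq; exists p => //; have [_ /(_ ps)[_]] := hE p; apply => //.
  move: jz; rewrite -natr1 mulrDl mul1r -ltrBrDr => /lt_le_trans; apply.
  rewrite lerBlDr; apply: le_trans (normc_triangle _ (avg (ball p.1 (rad p.2.+1)) f) _) _.
  by rewrite lerD2l sL.
Qed.

End john_nirenberg.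

Section john_nirenberg_limit.
Context {d : measure_display} {R : realType} {M : borelMetricType d R}.
Variable mu : {measure set M -> \bar R}.
Hypothesis mufin : (mu setT < +oo)%E.
Hypothesis LD : locally_doubling mu.
Hypothesis ball_mass_gt0 : forall (x : M) (t : R), 0 < t -> 0 < mass mu (ball x t).
Local Notation mass := (mass mu).
Local Notation absint := (absint mu).
Local Notation avg := (average mu).
Variables (D b : R).
Hypothesis D1 : 1 <= D.
Hypothesis Db : doubling_upto mu D (4 * b).
Variables (f : M -> R[i]) (N : R).
Hypothesis fi : cintegrable mu f.
Hypothesis N0 : 0 < N.
Hypothesis fN : forall z t, 0 < t <= 4 * b ->
  absint (ball z t) (fun x => f x - avg (ball z t) f) <= mass (ball z t) * N.

Local Notation L := (4 * D ^+ 3 * N).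

Let L0 : 0 < L. Proof. by rewrite mulr_gt0// mulr_gt0// exprn_gt0// (lt_le_trans ltr01). Qed.

(** At a small scale [e], the average over [ball z e] is compared with the
    average over a ball about a point of an [e]-net that contains [z]; the latter is
    close to [f z] outside a set of small measure, by Chebyshev's inequality. *)
Lemma oscillation_exp_decay j x t : 0 < t <= b ->
  mass [set z | ball x t z /\ j.+2%:R * L < normc (f z - avg (ball x t) f)] <=
  2^-1 ^+ j * mass (ball x t).
Proof.
move=> /andP[t0 tb]; have b0 : 0 < b := lt_le_trans t0 tb.
set G := [set z | _]; apply/ler_addgt0Pr => h h0.
have [e1 e10 He] := sum_osc_small mufin LD ball_mass_gt0 fi (mulr_gt0 L0 h0).
have [m hm] := @ex_pow_ge R (2 * t) e1 e10.
pose e := t / 2 ^+ m; have m0 : 0 < 2 ^+ m :> R by rewrite exprn_gt0.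
have e0 : 0 < e by rewrite divr_gt0.
have te : 2 ^+ m * e = t by rewrite /e mulrC divfK// gt_eqF.
have ee1 : e < e1.
  rewrite -(ltr_pM2l m0) te; apply: lt_le_trans hm; lra.
have et : e <= t by rewrite -te ler_peMl ?(ltW e0)// exprn_ege1// ler1n.
have mb : 2 ^+ m * e <= b by rewrite te.
have [E []] := averages_exp_decay mufin ball_mass_gt0 D1 Db fi N0 fN e0 j x mb.
rewrite te => mE Em jE.
have [n0 /(_ x t)] := ex_net mufin LD ball_mass_gt0 e0 b0.
rewrite et tb => /(_ isT)[s [_ sep sx scov]].
pose F y := [set z | ball y e z /\ L < normc (f z - avg (ball y e) f)].
have gi y : cintegrable mu (fun z => f z - avg (ball y e) f) by exact: cintegrable_osc.
have mF y : measurable (F y) by exact: measurable_normc_gt.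
have mUF : measurable (\big[setU/set0]_(y <- s) F y) by exact: bigsetU_measurable.
have GEF : G `<=` E `|` \big[setU/set0]_(y <- s) F y.
  move=> z [xz Gz].
  have [jz|jz] := ltP (j%:R * L) (normc (avg (ball z e) f - avg (ball x t) f)).
    by left; exact: jE.
  right; rewrite -bigcup_seq; have [y ys yz] := scov z xz; exists y => //; split => //.
  have zy : normc (avg (ball z e) f - avg (ball y e) f) <= L.
    apply: (average_same_radius mufin ball_mass_gt0 D1 Db fi N0 fN).
      by rewrite e0; lra.
    by apply/ltW; rewrite -in_ballE.
  have h1 := normc_triangle (f z) (avg (ball y e) f) (avg (ball x t) f).
  have h2 := normc_triangle (avg (ball y e) f) (avg (ball z e) f) (avg (ball x t) f).
  rewrite normc_distC in zy.
  move: Gz; rewrite -addn2 natrD mulrDl; move: h1 h2 zy jz; move: L0.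
  set l := L; clearbody l; set jl := _ * l; clearbody jl.
  set n1 := normc _; set n2 := normc _; set n3 := normc _; set n4 := normc _; set n5 := normc _.
  clearbody n1 n2 n3 n4 n5; lra.
have mG : measurable G by apply: measurable_normc_gt => //; exact: cintegrable_osc.
apply: (@le_trans _ _ (mass (E `|` \big[setU/set0]_(y <- s) F y))).
  by apply: le_mass => //; exact: measurableU.
apply: (@le_trans _ _ (mass E + mass (\big[setU/set0]_(y <- s) F y))).
  rewrite -lee_fin EFinD -!massE//; last exact: measurableU.
  exact: measureU2.
apply: lerD => //; apply: le_trans (mass_bigsetU mufin s mF) _.
rewrite -(ler_pM2l L0) big_distrr /=; apply: le_trans (He e _ s sep); last by rewrite e0.
apply: ler_sum => y _; apply: chebyshev => //; exact: ltW.
Qed.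

Lemma oscillation_distribution j x t : 0 < t <= b ->
  mass [set z | ball x t z /\ j%:R * L < normc (f z - avg (ball x t) f)] <=
  4 * 2^-1 ^+ j * mass (ball x t).
Proof.
(* The bounds for [j < 2] are trivial thanks to the factor 4. *)
move=> tb; case: j => [|[|j]]; last first.
  apply: le_trans (oscillation_exp_decay j x tb) _.
  rewrite !exprS le_eqVlt; apply/orP; left; apply/eqP; by field.
all: apply: (le_trans (le_mass mufin _ (measurable_metric_ball x t) _));
  [by apply: measurable_normc_gt => //; exact: cintegrable_osc|by move=> z []|].
- by rewrite ler_peMl ?mass_ge0// expr1; lra.
- by rewrite ler_peMl ?mass_ge0// expr0; lra.
Qed.

End john_nirenberg_limit.

(** * Comparison of the exponents *)

Section exponential_integrability.
Context {d : measure_display} {R : realType} {M : borelMetricType d R}.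
Variable mu : {measure set M -> \bar R}.
Hypothesis mufin : (mu setT < +oo)%E.
Local Notation mass := (mass mu).
Local Notation absint := (absint mu).
Local Notation avg := (average mu).

(** The inequality [x <= expR x], for [x] a multiple of [n.+1] such that
    [expR x ^ p] is [2 ^ n.+1]. *)
Lemma powR_le_exp2 (p : R) : 0 < p ->
  exists2 A : R, 0 < A & forall n : nat, n.+1%:R `^ p <= A * 2 ^+ n.+1.
Proof.
move=> p0; have l20 : 0 < ln 2 :> R by rewrite ln_gt0// ltr1n.
pose a := ln 2 / p; have a0 : 0 < a by rewrite divr_gt0.
exists (a^-1 `^ p); first by rewrite powR_gt0// invr_gt0.
move=> n; have -> : 2 ^+ n.+1 = expR (n.+1%:R * a) `^ p.
  by rewrite -expRM -mulrA divfK ?gt_eqF// expRM_natl lnK// posrE ltr0n.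
rewrite -powRM ?invr_ge0 ?(ltW a0) ?expR_ge0//.
apply: ge0_ler_powR; [exact: ltW|by rewrite nnegrE| |].
  by rewrite nnegrE mulr_ge0 ?expR_ge0 ?invr_ge0 ?(ltW a0).
by rewrite ler_pdivlMl// mulrC; apply: le_trans (expR_ge1Dx _); lra.
Qed.

(** Where [|g|] lies between [2 n L] and [2 (n + 1) L], its [p]-th power is at
    most a multiple of [2 ^ n L ^ p], while the measure of this layer is at most a
    multiple of [4 ^ -n mass B]; a geometric series remains. *)
Lemma power_mean_distribution (p : R) : 0 < p -> exists2 C : R, 0 < C &
  forall (B : set M) g L, measurable B -> 0 < mass B -> cintegrable mu g -> 0 < L ->
    (forall j, mass [set z | B z /\ j%:R * L < normc (g z)] <= 4 * 2^-1 ^+ j * mass B) ->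
    (power_mean mu p B g <= (C * L)%:E)%E.
Proof.
move=> p0; have [A A0 hA] := powR_le_exp2 p0.
have A32 : 0 < 32 * A by rewrite mulr_gt0.
exists (2 * (32 * A) `^ p^-1); first by rewrite mulr_gt0// powR_gt0.
move=> B g L mB B0 gi L0 dist.
have L2 : 0 < 2 * L by rewrite mulr_gt0.
have P0 : 0 < (2 * L) `^ p by rewrite powR_gt0.
rewrite power_mean_leP//; last by rewrite mulr_ge0 ?(ltW L0)// mulr_ge0// powR_ge0.
have -> : (2 * (32 * A) `^ p^-1 * L) `^ p = (2 * L) `^ p * (32 * A).
  rewrite mulrAC (powRM p (ltW L2) (powR_ge0 _ _)).
  by rewrite -powRrM mulVf ?gt_eqF// powRr1// ltW.
(* The threshold [2 n - 1] instead of [2 n] turns a non-strict inequality into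
   a strict one; for [n = 0] it is 0, by truncation. *)
pose G (n : nat) := [set z | B z /\ n.*2.-1%:R * L < normc (g z)].
have mG n : measurable (G n) by exact: (measurable_normc_gt _ mB gi).
have Gm n : mass (G n) <= 8 * (2^-1 ^+ n * 2^-1 ^+ n) * mass B.
  apply: le_trans (dist _) _; rewrite ler_wpM2r ?mass_ge0//.
  case: n => [|n]; first by rewrite expr0; lra.
  rewrite doubleS /= -addnn exprS exprD !exprS le_eqVlt; apply/orP; left; apply/eqP; by field.
pose c (n : nat) := (2 * L) `^ p * (A * 2 ^+ n.+1).
have c0 n : 0 <= c n by rewrite mulr_ge0 ?(ltW P0)// mulr_ge0 ?exprn_ge0// ltW.
pose F n x := ((c n)%:E * (\1_(G n) x)%:E)%E.
have F0 n x : (0 <= F n x)%E by rewrite mule_ge0 ?lee_fin.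
have mF n : measurable_fun B (F n).
  apply: measurable_funeM; apply/measurable_EFinP; exact: measurable_indic.
apply: (@le_trans _ _ (\int[mu]_(x in B) \sum_(0 <= n <oo) F n x)%E).
  apply: ge0_le_integral => //.
  - by move=> x _; rewrite lee_fin powR_ge0.
  - exact: (measurable_normc_powRS p gi).
  - exact: ge0_emeasurable_sum.
  move=> x Bx; have [->|x0] := eqVneq (normc (g x)) 0.
    by rewrite powR0 ?gt_eqF// nneseries_ge0.
  have {}x0 : 0 < normc (g x) by rewrite lt_neqAle eq_sym x0 normc_ge0.
  have q0 : 0 <= normc (g x) / (2 * L) by rewrite divr_ge0 ?ltW.
  pose n := Num.truncn (normc (g x) / (2 * L)).
  have := truncn_itv q0; rewrite -/n ler_pdivlMr// ltr_pdivrMr// => /andP[nx xn].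
  apply: (@le_trans _ _ (F n x)); last first.
    apply: le_trans (nneseries_lim_ge n.+1 _) => //.
    by rewrite big_nat_recr//= leeDr// sume_ge0.
  have Gx : G n x.
    split => //; case: (n) nx => [|k] kx; first by rewrite mul0r.
    apply: lt_le_trans kx; rewrite doubleS /= mulrA ltr_pM2r// -natrM muln2 doubleS.
    by rewrite ltr_nat.
  rewrite /F indicE (mem_set Gx) mule1 lee_fin /c.
  apply: (@le_trans _ _ (((2 * L) * n.+1%:R) `^ p)).
    apply: ge0_ler_powR; rewrite ?nnegrE ?normc_ge0 ?(ltW p0) ?mulr_ge0 ?(ltW L2) ?(ltW L0)//.
    by rewrite mulrC ltW.
  by rewrite powRM ?(ltW L2)// ler_pM2l.
rewrite integral_nneseries//.
apply: (@le_trans _ _ (\sum_(0 <= n <oo) ((32 * A * (2 * L) `^ p * mass B)%:E * ((2 ^ (n + 1))%:R^-1)%:E))%E).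
  apply: lee_nneseries => [n _ _|n _]; first by apply: integral_ge0 => x _; exact: F0.
  rewrite ge0_integralZl_EFin//; last first.
    by apply/measurable_EFinP; exact: measurable_indic.
  rewrite integral_indic// setIidl; last by move=> z [].
  rewrite massE// -!EFinM lee_fin; apply: le_trans (ler_wpM2l (c0 n) (Gm n)) _.
  rewrite /c addn1 natrX exprVn exprS le_eqVlt; apply/orP; left; apply/eqP; field.
  by rewrite expf_neq0.
rewrite nneseriesZl//.
rewrite (nneseries_half 0) expn0 invr1 mule1 lee_fin.
by rewrite le_eqVlt; apply/orP; left; apply/eqP; ring.
Qed.

Hypothesis LD : locally_doubling mu.
Hypothesis ball_mass_gt0 : forall (x : M) (t : R), 0 < t -> 0 < mass (ball x t).
Variables (R0 beta b : R).
Hypothesis AM : approx_midpoint M R0 beta.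
Hypothesis Rb : R0 / (1 - beta) < b.
Hypothesis b0 : 0 < b.

(** The decomposition meets balls of radius up to [4 * b], where the oscillation
    is controlled by [BMO_seminorm_scale]. *)
Lemma seminorm_distribution : exists2 kappa : R, 0 < kappa &
  forall f v, cintegrable mu f -> 0 < v -> (BMO_seminorm mu b 1 f <= v%:E)%E ->
  forall j x t, 0 < t <= b ->
    mass [set z | ball x t z /\ j%:R * (kappa * v) < normc (f z - avg (ball x t) f)] <=
    4 * 2^-1 ^+ j * mass (ball x t).
Proof.
have b4 : b < 4 * b by rewrite ltr_pMl// ltr1n.
have b40 : 0 < 4 * b by rewrite mulr_gt0.
have [K K1 hK] := BMO_seminorm_scale mufin LD ball_mass_gt0 AM Rb b0 b4.
have K0 : 0 < K := lt_le_trans ltr01 K1.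
have [D D1 Db] := ex_doubling_upto mufin LD b40.
have D0 : 0 < D := lt_le_trans ltr01 D1.
exists (4 * D ^+ 3 * K); first by rewrite mulr_gt0// mulr_gt0// exprn_gt0.
move=> f v fi v0 fv j x t tb; rewrite -[_ * K * v]mulrA.
apply: (oscillation_distribution mufin LD ball_mass_gt0 D1 Db fi) => //.
  by rewrite mulr_gt0.
move=> z u ub; have u0 : 0 < u by have /andP[] := ub.
rewrite mulrC -ler_pdivrMr ?ball_mass_gt0// mulrC -lee_fin.
rewrite -power_mean1//; last exact: cintegrable_osc.
apply: le_trans (osc_le_seminorm mu 1 f z ub) _.
apply: le_trans (hK _ _ (lexx 1) fi) _.
by rewrite EFinM lee_wpmul2l// lee_fin ltW.
Qed.

Lemma osc1_le_absint f x t v : cintegrable mu f -> 0 < t <= b ->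
  (BMO_seminorm mu b 1 f <= v%:E)%E ->
  absint (ball x t) (fun z => f z - avg (ball x t) f) <= mass (ball x t) * v.
Proof.
move=> fi tb fv; have t0 : 0 < t by have /andP[] := tb.
rewrite mulrC -ler_pdivrMr ?ball_mass_gt0// mulrC -lee_fin.
rewrite -power_mean1//; last exact: cintegrable_osc.
exact: le_trans (osc_le_seminorm mu 1 f x tb) fv.
Qed.

Lemma john_nirenberg_inequality : exists c0 C : R, [/\ 0 < c0, 0 < C &
  forall f, BMO mu b 1 f -> forall (x : M) (t : R), 0 < t <= b ->
  forall s : R, 0 < s ->
    (mu [set y | ball x t y /\ (s < normc (f y - average mu (ball x t) f))%R]
       <= (C * exp_decay c0 s (fine (BMO_seminorm mu b 1 f)))%:E * mu (ball x t))%E].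
Proof.
have [k k0 hk] := seminorm_distribution.
have l20 : 0 < ln 2 :> R by rewrite ln_gt0// ltr1n.
exists (ln 2 / k), 8; split => //; first by rewrite divr_gt0.
move=> f [fi fin] x t tb s s0; have t0 : 0 < t by have /andP[] := tb.
have gi : cintegrable mu (fun z => f z - avg (ball x t) f) by exact: cintegrable_osc.
have mG (u : R) : measurable [set y | ball x t y /\ u < normc (f y - avg (ball x t) f)].
  exact: (measurable_normc_gt u (measurable_metric_ball x t) gi).
rewrite (massE mufin (mG s)) (massE mufin (measurable_metric_ball x t)) -EFinM lee_fin.
have v0 := seminorm_ge0 mu 1 f b0.
have vE : BMO_seminorm mu b 1 f = (fine (BMO_seminorm mu b 1 f))%:E.
  by rewrite fineK// ge0_fin_numE.
have {}v0 := fine_ge0 v0.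
have fv : (BMO_seminorm mu b 1 f <= (fine (BMO_seminorm mu b 1 f))%:E)%E by rewrite -vE.
move: (fine _) v0 fv => v v0 fv; rewrite /exp_decay; case: eqVneq => [v00|vn0].
  have := le_trans (chebyshev mufin (measurable_metric_ball x t) gi (ltW s0)) (osc1_le_absint x fi tb fv).
  by rewrite v00 !(mulr0, mul0r) pmulr_rle0.
have {vn0 v0}v0 : 0 < v by rewrite lt_neqAle eq_sym vn0.
have L0 : 0 < k * v by rewrite mulr_gt0.
have q0 : 0 <= s / (k * v) by rewrite divr_ge0 ?ltW.
(* Since [s < j.+1 * (k * v)], passing from [2^-1 ^+ j] to the exponential costs
   a factor 2. *)
pose j := Num.truncn (s / (k * v)).
have /andP[js sj] := truncn_itv q0; rewrite -/j in js sj.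
apply: (@le_trans _ _ (4 * 2^-1 ^+ j * mass (ball x t))).
  apply: le_trans (hk f v fi v0 fv j x t tb); apply: le_mass => // y [xy sy]; split => //.
  by apply: le_lt_trans sy; rewrite -ler_pdivlMr.
rewrite ler_wpM2r ?mass_ge0//.
have -> : ln 2 / k * s / v = s / (k * v) * ln 2 by field; rewrite !gt_eqF.
have : expR (- (j.+1%:R * ln 2)) <= expR (- (s / (k * v) * ln 2)) :> R.
  by rewrite ler_expR lerN2 ler_pM2r// ltW.
rewrite expRN expRM_natl lnK ?posrE// -exprVn exprS.
set E := expR _; set H := _ ^+ j; clearbody E H; lra.
Qed.

Lemma seminorm1_le (p : R) f : 1 <= p -> BMO mu b p f ->
  (BMO_seminorm mu b 1 f <= BMO_seminorm mu b p f)%E.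
Proof.
move=> p1 [fi]; have := seminorm_ge0 mu p f b0.
case E : (BMO_seminorm mu b p f) => [v| |]// v0 _; rewrite lee_fin in v0.
apply: seminorm_le => x t tb; have t0 : 0 < t by have /andP[] := tb.
have gi : cintegrable mu (fun z => f z - avg (ball x t) f) by exact: cintegrable_osc.
rewrite /osc power_mean1// lee_fin ler_pdivrMl ?ball_mass_gt0//.
apply: (power_mean_L1_le mufin p1) => //; first exact: ball_mass_gt0.
by rewrite -E; exact: osc_le_seminorm.
Qed.

(** The estimate of the distribution is stated for positive bounds of the seminorm;
    when the seminorm vanishes, they tend to 0. *)
Lemma seminorm_le1 (p : R) : 0 < p -> exists C : R, forall f,
  cintegrable mu f -> (BMO_seminorm mu b 1 f < +oo)%E ->
  (BMO_seminorm mu b p f <= C%:E * BMO_seminorm mu b 1 f)%E.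
Proof.
move=> p0; have [k k0 hk] := seminorm_distribution.
have [C C0 hC] := power_mean_distribution p0.
exists (C * k) => f fi; have := seminorm_ge0 mu 1 f b0.
case E : (BMO_seminorm mu b 1 f) => [v| |]// v0 _; rewrite lee_fin in v0.
have Ck : 0 < C * k by rewrite mulr_gt0.
apply: seminorm_le => x t tb; have t0 : 0 < t by have /andP[] := tb.
apply/lee_addgt0Pr => h h0; have hk0 : 0 < h / (C * k) by rewrite divr_gt0.
have v'0 : 0 < v + h / (C * k) by rewrite ltr_wpDl.
have fv : (BMO_seminorm mu b 1 f <= (v + h / (C * k))%:E)%E by rewrite E lee_fin lerDl ltW.
have := hC (ball x t) (fun z => f z - avg (ball x t) f) (k * (v + h / (C * k)))
  (measurable_metric_ball x t) (ball_mass_gt0 x t0) (cintegrable_osc mufin _ fi)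
  (mulr_gt0 k0 v'0) (fun j => hk f _ fi v'0 fv j x t tb).
by rewrite mulrA mulrDr [C * k * (h / _)]mulrC divfK ?gt_eqF// EFinD EFinM.
Qed.

End exponential_integrability.

Theorem proposition3p4 (d : measure_display) (R : realType)
    (M : borelMetricType d R) (mu : {measure set M -> \bar R})
    (R0 beta : R) (r : \bar R) (q b c : R)
    (Munbounded : unbounded_space M)
    (muM : (0 < mu [set: M] < +oo)%E)
    (LD : locally_doubling mu)
    (AM : approx_midpoint M R0 beta)
    (Ic : complementary_isoperimetric mu)
    (r_gt1 : (1 < r)%E) (q_ge1 : 1 <= q)
    (b_gt0 : 0 < b) (c_gt0 : 0 < c)
    (c_gt : R0 / (1 - beta) < c) (c_lt_b : c < b) :
  [/\ id_banach_isomorphism mu (hardy1 mu c r) (hardy1_norm mu c r)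
                               (hardy1 mu b r) (hardy1_norm mu b r) /\
      id_banach_isomorphism mu (BMO mu b q) (BMO_norm mu b q)
                               (BMO mu c q) (BMO_norm mu c q),
      exists c0 C : R, [/\ 0 < c0, 0 < C &
        forall f, BMO mu b 1 f ->
        forall (x : M) (t : R), 0 < t <= b ->
        forall s : R, 0 < s ->
          (mu [set y | ball x t y /\
                       (s < normc (f y - average mu (ball x t) f))%R]
             <= (C * exp_decay c0 s (fine (BMO_seminorm mu b 1 f)))%:E
                  * mu (ball x t))%E] &
      forall p : R, 1 < p -> exists C : R, forall f, BMO mu b p f ->
        (BMO_seminorm mu b 1 f <= BMO_seminorm mu b p f
           <= C%:E * BMO_seminorm mu b 1 f)%E].
Proof.
have /andP[mu0 mufin] := muM.
have bm := doubling_ball_mass_gt0 mufin LD mu0.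
have Rb := lt_trans c_gt c_lt_b.
split.
- split; first exact: (hardy1_id_isomorphism mufin mu0 bm r_gt1 c_gt0 LD AM c_gt c_lt_b).
  exact: (BMO_id_isomorphism mufin LD bm AM c_gt c_gt0 c_lt_b q_ge1).
- exact: (john_nirenberg_inequality mufin LD bm AM Rb b_gt0).
- move=> p p1; have [C hC] := seminorm_le1 mufin LD bm AM Rb b_gt0 (lt_trans ltr01 p1).
  exists C => f fp; have [fi pfin] := fp.
  have h1 := seminorm1_le mufin bm b_gt0 (ltW p1) fp.
  by rewrite h1 hC// (le_lt_trans h1).
Qed.
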